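(* Let $n\ge1$, let $\theta\in(0,\pi]$ and let $\mathbf{a}=(a_1,\dots,a_n)$, $0\le a_1\le\dots\le a_n$ integers, index an irreducible representation of $SO(2n+1)$. For any real $\alpha>0$, $$r_{\mathbf a}(\theta)=\frac{(2n-1)!}{\left(2n\sin\frac\theta2\right)^{2n-1}}\cdot\frac1{2\pi i}\int_{\alpha-i\infty}^{\alpha+i\infty}\frac{e^{n\theta z}}{\prod_{j=1}^n(\alpha_j^2+z^2)}\,dz,$$ where $\alpha_j=\frac{1}{n}\left(a_j+j-\tfrac12\right)$.
   Context: Irreducible representations $\rho_{\mathbf a}$ of $SO(2n+1)$ are indexed by integer strings $\mathbf a=(a_1,\dots,a_n)$ with $0\le a_1\le\dots\le a_n$; $\rho_{\mathbf a}$ is the representation whose highest weight has coordinates, in decreasing order, $(a_n,a_{n-1},\dots,a_1)$. $d_{\mathbf a}$ and $\chi_{\mathbf a}$ are its dimension and character, and $r_{\mathbf a}(\theta)=\chi_{\mathbf a}(R(1,2;\theta))/d_{\mathbf a}$ is the character ratio at the rotation $R(1,2;\theta)$ by angle $\theta$ in the first coordinate $2$-plane (identity on the remaining coordinates). *)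

(* Defs.v *)
From HB Require Import structures.
From mathcomp Require Import all_boot all_order all_algebra.
From mathcomp Require Import complex.
From mathcomp Require Import all_classical all_reals all_analysis.

Set Implicit Arguments.
Unset Strict Implicit.
Unset Printing Implicit Defensive.

Import Order.TTheory GRing.Theory Num.Theory.
Import numFieldNormedType.Exports.

Local Open Scope classical_set_scope.
Local Open Scope ring_scope.
Local Open Scope complex_scope.

Definition special_orthogonal (R : realType) (m : nat) : set 'M[R]_m :=
  [set A | A *m A^T = 1%:M /\ \det A = 1].
Arguments special_orthogonal R m : clear implicits.

(* Coordinates are numbered from 0, so R(1,2;t) is [plane_rot m 0 1 t]. *)
Definition plane_rot (R : realType) (m p q : nat) (t : R) : 'M[R]_m :=
  \matrix_(i, j)
    if (i == p :> nat) && (j == p :> nat) then cos t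
    else if (i == q :> nat) && (j == q :> nat) then cos t
    else if (i == p :> nat) && (j == q :> nat) then - sin t
    else if (i == q :> nat) && (j == p :> nat) then sin t
    else (i == j)%:R.
Arguments plane_rot {R} m p q t.

(* A finite-dimensional continuous complex representation of SO(m), given by
   matrices.  Only the values of [rho] on SO(m) matter, and they are invertible
   by the first two clauses.  Continuity for the topology of C^(d x d) is
   stated on the real and imaginary parts of the entries. *)
Definition SO_representation (R : realType) (m d : nat)
    (rho : 'M[R]_m -> 'M[R[i]]_d) : Prop :=
  [/\ rho 1%:M = 1%:M,
      forall A B, special_orthogonal R m A -> special_orthogonal R m B ->
        rho (A *m B) = rho A *m rho B &
      forall i j,
        {within special_orthogonal R m,
          continuous (fun A => complex.Re (rho A i j))} /\
        {within special_orthogonal R m,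
          continuous (fun A => complex.Im (rho A i j))}].

(* As in mxrepresentation, matrices act on row vectors from the right and a
   subspace is the row space of a matrix. *)
Definition SO_irreducible (R : realType) (m d : nat)
    (rho : 'M[R]_m -> 'M[R[i]]_d) : Prop :=
  (0 < d)%N /\
  forall V : 'M[R[i]]_d,
    (forall A, special_orthogonal R m A -> stablemx V (rho A)) ->
    V != 0 -> row_full V.

Definition cexp (R : realType) (z : R[i]) : R[i] :=
  (expR (complex.Re z))%:C * (cos (complex.Im z) +i* sin (complex.Im z)).

(* The element of the standard maximal torus of SO(2n+1) with angle t_k in the
   k-th coordinate plane. *)
Definition torus (R : realType) (n : nat) (t : 'I_n -> R) : 'M[R]_(n.*2.+1) :=
  \prod_(k < n) plane_rot n.*2.+1 k.*2 k.*2.+1 (t k).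

Definition is_weight (R : realType) (n d : nat)
    (rho : 'M[R]_(n.*2.+1) -> 'M[R[i]]_d) (mu : 'I_n -> int) : Prop :=
  exists2 v : 'rV[R[i]]_d, v != 0 &
    forall t : 'I_n -> R,
      v *m rho (torus t) = cexp ('i%C * (\sum_(k < n) (mu k)%:~R * t k)%:C) *: v.

(* Simple roots of type B_n, coordinates numbered from 0: e_i - e_(i+1) for i < n - 1, and e_(n-1). *)
Definition simple_root (n : nat) (i : 'I_n) : 'I_n -> int :=
  fun k => (k == i)%:Z - (k == i.+1 :> nat)%:Z.

Definition weight_le (n : nat) (mu lambda : 'I_n -> int) : Prop :=
  exists c : 'I_n -> nat,
    forall k, lambda k - mu k = \sum_(i < n) (c i)%:Z * simple_root i k.

Definition is_highest_weight (R : realType) (n d : nat)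
    (rho : 'M[R]_(n.*2.+1) -> 'M[R[i]]_d) (lambda : 'I_n -> int) : Prop :=
  is_weight rho lambda /\ forall mu, is_weight rho mu -> weight_le mu lambda.

(* [rho] is rho_a: its highest weight is (a_n, ..., a_1). *)
Definition SO_irrep_indexed_by (R : realType) (n d : nat) (a : 'I_n -> nat)
    (rho : 'M[R]_(n.*2.+1) -> 'M[R[i]]_d) : Prop :=
  [/\ SO_representation rho, SO_irreducible rho &
      is_highest_weight rho (fun k => (a (rev_ord k))%:Z)].

Definition character_ratio (R : realType) (m d : nat)
    (rho : 'M[R]_m -> 'M[R[i]]_d) (theta : R) : R[i] :=
  \tr (rho (plane_rot m 0 1 theta)) / d%:R.

(* The index j runs from 0, so a_(j+1) is [a j]. *)
Definition alpha_coef (R : realType) (n : nat) (a : 'I_n -> nat) (j : 'I_n) : R :=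
  ((a j)%:R + j.+1%:R - 2^-1) / n%:R.
Arguments alpha_coef R {n} a j.

(* The integral of f(z) dz over the line Re z = alpha, with z = alpha + i t. *)
Definition vline_integrable (R : realType) (alpha : R) (f : R[i] -> R[i]) :
    Prop :=
  (@lebesgue_measure R).-integrable setT
    (fun t => (complex.Re (f (alpha +i* t)))%:E) /\
  (@lebesgue_measure R).-integrable setT
    (fun t => (complex.Im (f (alpha +i* t)))%:E).

Definition vline_integral (R : realType) (alpha : R) (f : R[i] -> R[i]) :
    R[i] :=
  'i%C * (\int[@lebesgue_measure R]_t complex.Re (f (alpha +i* t)) +i*
        \int[@lebesgue_measure R]_t complex.Im (f (alpha +i* t))).

(* Main.v *)
Require Import Defs.
From HB Require Import structures.
From mathcomp Require Import all_boot all_order all_algebra.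
From mathcomp Require Import fingroup perm.
From mathcomp Require Import complex.
From mathcomp Require Import all_classical all_reals all_analysis measurable_realfun.
From mathcomp Require Import ring lra.

Set Implicit Arguments.
Unset Strict Implicit.
Unset Printing Implicit Defensive.

Import Order.TTheory GRing.Theory Num.Theory.
Import numFieldNormedType.Exports.

Local Open Scope ring_scope.
Local Open Scope complex_scope.

(* Restrict the character chi to the maximal torus, with angles t_1, ..., t_n.  The
   Casimir element acts by a scalar, and taking traces turns this into a second
   order differential equation for chi; multiplying by the Weyl denominator delta
   removes its first order part, so that all frequencies of delta * chi have the
   norm of lambda + rho.  Since the weights are invariant under permutations and sign
   changes, dominance then forces each coordinate of a frequency to be some +-l_k,
   where l_k = n alpha_j for j = n + 1 - k.

   Letting all angles but the first tend to 0, sin(t/2)^(2n-1) chi(R(1,2;t)) is a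
   combination of the 2n exponentials e^{+-i l_k t}.  It vanishes to order 2n-1 at 0
   with leading coefficient d / 2^(2n-1), which determines the 2n coefficients by
   Lagrange interpolation.

   On the analytic side partial fractions reduce the integral to one factor, where it
   is the Fourier inversion of y |-> e^{-alpha y} sin(beta y) / beta: regularise by
   e^{-eps |t|}, exchange the integrals, and let the Poisson kernel concentrate. *)

(** * Complex exponentials *)

(** The obstacle is that R(1,2;theta) is a singular torus element: delta vanishes there once n > 1,
    so a formula for delta * chi cannot simply be evaluated at it. This is why the argument retains
    a set of frequencies, which survives the limit because an exponential sum with given frequencies
    depends linearly on finitely many of its samples.

    The representation is only continuous. A plane rotation group is a circle, so rho restricted to
    it is diagonal with integer frequencies and can be differentiated; its derivative at 0 plays the
    part of a Lie algebra element. The adjoint action on these derivatives comes from an Euler angle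
    factorisation in SO(3), since a curve is differentiated under rho by writing it through plane
    rotations.

    The Casimir scalar is identified through the frequency lambda + rho: it occurs in delta * chi
    without cancellation, so its norm must be the one prescribed by the differential equation. *)

Section Expi.
Local Open Scope classical_set_scope.
Local Open Scope ring_scope.
Local Open Scope complex_scope.
Variable R : realType.
Implicit Types (x y : R) (z : R[i]).
Local Notation C := R[i].

Definition expi (x : R) : C := cos x +i* sin x.

Lemma expi0 : expi 0 = 1.
Proof. by rewrite /expi cos0 sin0. Qed.

Lemma expiD x y : expi (x + y) = expi x * expi y.
Proof.
rewrite /expi cosD sinD; apply/eqP; rewrite eq_complex /=; apply/andP; split; apply/eqP; ring.
Qed.

Lemma cexp_i x : cexp ('i * x%:C) = expi x.
Proof. rewrite /cexp /expi /= !mul0r !mul1r subr0 expR0.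
by rewrite ?addr0 ?add0r ?mul1r. Qed.

Lemma expiN x : expi (- x) * expi x = 1.
Proof. by rewrite -expiD addNr expi0. Qed.

Lemma expi_neq0 x : expi x != 0.
Proof.
by apply: contra_eq_neq (expiN x) => ->; rewrite mulr0 eq_sym oner_neq0.
Qed.

Lemma expiV x : (expi x)^-1 = expi (- x).
Proof.
by apply: (mulIf (expi_neq0 x)); rewrite mulVf ?expi_neq0 // expiN.
Qed.

Lemma expi_sum (I : Type) (r : seq I) (P : pred I) (F : I -> R) :
  expi (\sum_(i <- r | P i) F i) = \prod_(i <- r | P i) expi (F i).
Proof. by apply: (big_morph _ expiD expi0). Qed.

Lemma expiMn x n : expi (x *+ n) = expi x ^+ n.
Proof. by elim: n => [|n IH]; rewrite ?expi0 // mulrS exprS expiD IH. Qed.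

Lemma expi_2pi : expi (2 * pi) = 1.
Proof. by rewrite /expi mulr_natl cos2pi sin2pi. Qed.

Lemma expi_pi : expi pi = -1.
Proof. by rewrite /expi cospi sinpi; apply/eqP; rewrite eq_complex /= oppr0 !eqxx. Qed.

Lemma expi_2piZ (k : int) : expi (k%:~R * (2 * pi)) = 1.
Proof.
case: k => k; first by rewrite -pmulrn (mulr_natl (2 * pi)) expiMn expi_2pi expr1n.
rewrite NegzE mulrNz mulNr -expiV -pmulrn (mulr_natl (2 * pi)) expiMn expi_2pi expr1n.
by rewrite invr1.
Qed.

(** The real part gives 1 - cos x = 2 sin(x/2)^2 = 0, while sin is positive on (0, pi). *)
Lemma expi_eq1 x : 0 <= x < 2 * pi -> expi x = 1 -> x = 0.
Proof.
move=> /andP[x0 x2] [] c1 _.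
have /eqP := c1; have {1}-> : x = (x / 2) *+ 2 by rewrite -mulr_natr divfK.
rewrite cos_mulr2n cos2sin2 mulrnBl mulr2n addrAC -subr_eq0.
rewrite [X in X == _](_ : _ = - (sin (x / 2) ^+ 2 *+ 2)); last by rewrite mulr2n; ring.
rewrite oppr_eq0 mulrn_eq0 /= sqrf_eq0 => s0.
apply/eqP; apply: contraT => xn0.
suff : 0 < sin (x / 2) by rewrite (eqP s0) ltxx.
have xp : 0 < x by rewrite lt_def xn0.
by apply: sin_gt0_pi; rewrite divr_gt0 //= ltr_pdivrMr // mulrC.
Qed.

Lemma expi_eq1_int x : expi x = 1 -> exists k : int, x = k%:~R * (2 * pi).
Proof.
have p2 : 0 < 2 * pi :> R by rewrite mulr_gt0 ?pi_gt0.
move=> x1; exists (Num.floor (x / (2 * pi))).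
apply/eqP; rewrite -subr_eq0; apply/eqP/expi_eq1.
  have /andP[] := floor_itv (x / (2 * pi)).
  rewrite ler_pdivlMr // ltr_pdivrMr // intrD (mulrDl _ _ (2 * pi)) mul1r => l1 l2.
  by rewrite subr_ge0 l1 /= ltrBlDl.
by rewrite expiD x1 mul1r -mulNr -mulrNz expi_2piZ.
Qed.

Lemma expi_sin x : expi x - expi (- x) = 2 * 'i%C * (sin x)%:C.
Proof.
rewrite /expi cosN sinN; apply/eqP; rewrite eq_complex /=; apply/andP.
split; apply/eqP; ring.
Qed.

Lemma ReM z1 z2 : complex.Re (z1 * z2 : C) =
  complex.Re z1 * complex.Re z2 - complex.Im z1 * complex.Im z2.
Proof. by case: z1 z2 => [? ?] []. Qed.

Lemma ImM z1 z2 : complex.Im (z1 * z2 : C) =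
  complex.Re z1 * complex.Im z2 + complex.Im z1 * complex.Re z2.
Proof. by case: z1 z2 => [? ?] []. Qed.

Lemma ReD z1 z2 : complex.Re (z1 + z2 : C) = complex.Re z1 + complex.Re z2.
Proof. by case: z1 z2 => [? ?] []. Qed.

Lemma ImD z1 z2 : complex.Im (z1 + z2 : C) = complex.Im z1 + complex.Im z2.
Proof. by case: z1 z2 => [? ?] []. Qed.

Lemma Re_sum (I : Type) (r : seq I) (P : pred I) (F : I -> C) :
  complex.Re (\sum_(i <- r | P i) F i) = \sum_(i <- r | P i) complex.Re (F i).
Proof. by apply: (big_morph _ ReD). Qed.

Lemma Im_sum (I : Type) (r : seq I) (P : pred I) (F : I -> C) :
  complex.Im (\sum_(i <- r | P i) F i) = \sum_(i <- r | P i) complex.Im (F i).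
Proof. by apply: (big_morph _ ImD). Qed.

Lemma eqC z1 z2 : complex.Re z1 = complex.Re z2 -> complex.Im z1 = complex.Im z2 -> z1 = z2.
Proof. by case: z1 z2 => [? ?] [? ?] /= -> ->. Qed.

(** Continuity is read off the real and imaginary parts, the form in which [SO_representation]
    provides it. *)
Definition ccont (f : R -> C) :=
  continuous (fun s => complex.Re (f s)) /\ continuous (fun s => complex.Im (f s)).

Lemma ccont_cst c : ccont (fun=> c).
Proof. by split=> x; exact: cvg_cst. Qed.

Lemma ccontM f g : ccont f -> ccont g -> ccont (fun s => f s * g s).
Proof.
move=> [f1 f2] [g1 g2]; split.
  rewrite (_ : (fun s => _) = (fun s => complex.Re (f s) * complex.Re (g s) -
     complex.Im (f s) * complex.Im (g s))); last by apply/funext=> s; rewrite ReM.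
  by move=> x; apply: cvgB; apply: cvgM; [exact: f1|exact: g1|exact: f2|exact: g2].
rewrite (_ : (fun s => _) = (fun s => complex.Re (f s) * complex.Im (g s) +
     complex.Im (f s) * complex.Re (g s))); last by apply/funext=> s; rewrite ImM.
by move=> x; apply: cvgD; apply: cvgM; [exact: f1|exact: g2|exact: f2|exact: g1].
Qed.

Lemma ccontD f g : ccont f -> ccont g -> ccont (fun s => f s + g s).
Proof.
move=> [f1 f2] [g1 g2]; split.
  rewrite (_ : (fun s => _) = (fun s => complex.Re (f s) + complex.Re (g s)));
    last by apply/funext=> s; rewrite ReD.
  by move=> x; apply: cvgD; [exact: f1|exact: g1].
rewrite (_ : (fun s => _) = (fun s => complex.Im (f s) + complex.Im (g s)));
  last by apply/funext=> s; rewrite ImD.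
by move=> x; apply: cvgD; [exact: f2|exact: g2].
Qed.

Lemma ccont_sum (I : Type) (r : seq I) (P : pred I) (F : I -> R -> C) :
  (forall i, ccont (F i)) -> ccont (fun s => \sum_(i <- r | P i) F i s).
Proof.
move=> cF; elim: r => [|a r IH].
  rewrite (_ : (fun _ => _) = cst 0); first exact: ccont_cst.
  by apply/funext=> s; rewrite big_nil.
rewrite (_ : (fun _ => _) = (fun s => (if P a then F a s else 0) +
   \sum_(i <- r | P i) F i s)).
  apply: ccontD => //; case: (P a) => //; exact: ccont_cst.
by apply/funext=> s; rewrite big_cons; case: (P a); rewrite ?add0r.
Qed.

Lemma ccont_prod (I : Type) (r : seq I) (P : pred I) (F : I -> R -> C) :
  (forall i, ccont (F i)) -> ccont (fun s => \prod_(i <- r | P i) F i s).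
Proof.
move=> cF; elim: r => [|a r IH].
  rewrite (_ : (fun _ => _) = cst 1); first exact: ccont_cst.
  by apply/funext=> s; rewrite big_nil.
rewrite (_ : (fun _ => _) = (fun s => (if P a then F a s else 1) *
   \prod_(i <- r | P i) F i s)).
  apply: ccontM => //; case: (P a) => //; exact: ccont_cst.
by apply/funext=> s; rewrite big_cons; case: (P a); rewrite ?mul1r.
Qed.

Lemma ccontR (u : R -> R) : continuous u -> ccont (fun s => (u s)%:C).
Proof. by move=> cu; split => //= x; exact: cvg_cst. Qed.

Lemma ccont_expi (u : R -> R) : continuous u -> ccont (fun s => expi (u s)).
Proof.
move=> cu; split => x /=.
  by apply: continuous_comp; [exact: cu|exact: continuous_cos].
by apply: continuous_comp; [exact: cu|exact: continuous_sin].
Qed.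

Lemma continuous_affine (a b : R) : continuous (fun s : R => a + b * s).
Proof. by move=> x; apply: cvgD; [exact: cvg_cst|apply: cvgMr; exact: cvg_id]. Qed.

(** Identities proved where the Weyl denominator is nonzero reach the singular points through this
    limit. *)
Lemma ccont_eq0 (f : R -> C) a : ccont f -> (\forall s \near a^', f s = 0) -> f a = 0.
Proof.
move=> [f1 f2] fa0.
have H (g : R -> R) : continuous g -> (\forall s \near a^', g s = 0) -> g a = 0.
  move=> cg g0.
  have c1 : g x @[x --> a^'] --> g a by apply: cvg_within_filter; exact: cg.
  have c2 : g x @[x --> a^'] --> (0 : R) by exact: cvg_near_cst.
  exact: (cvg_unique _ c1 c2).
by apply: eqC; [apply: (H _ f1)|apply: (H _ f2)]; apply: filterS fa0 => s ->.
Qed.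

End Expi.

(** * Derivatives of complex functions and matrices of a real variable *)

Section Cderiv.
Variable R : realType.
Local Notation C := R[i].
Implicit Types (f g : R -> C) (x : R) (c : C).

Definition cderiv f x c :=
  is_derive x 1 (fun s => complex.Re (f s)) (complex.Re c) /\
  is_derive x 1 (fun s => complex.Im (f s)) (complex.Im c).

Lemma cderiv_unique f x c c' : cderiv f x c -> cderiv f x c' -> c = c'.
Proof.
move=> [[_ h1] [_ h2]] [[_ h3] [_ h4]].
by apply: eqC; [rewrite -h1 -h3|rewrite -h2 -h4].
Qed.

Lemma cderiv_eq f x c c' : cderiv f x c -> c = c' -> cderiv f x c'.
Proof. by move=> ? <-. Qed.

Lemma cderiv_ext f g x c : f =1 g -> cderiv f x c -> cderiv g x c.
Proof. by move=> /funext->. Qed.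

Lemma cderiv_cst c x : cderiv (fun=> c) x 0.
Proof. by split; exact: is_derive_cst. Qed.

Lemma cderivD f g x c c' : cderiv f x c -> cderiv g x c' ->
  cderiv (fun s => f s + g s) x (c + c').
Proof.
move=> [f1 f2] [g1 g2]; split.
  rewrite (_ : (fun s => _) = (fun s => complex.Re (f s)) \+ (fun s => complex.Re (g s)));
    last by apply/funext=> s; rewrite ReD.
  by rewrite ReD; exact: is_deriveD.
rewrite (_ : (fun s => _) = (fun s => complex.Im (f s)) \+ (fun s => complex.Im (g s)));
  last by apply/funext=> s; rewrite ImD.
by rewrite ImD; exact: is_deriveD.
Qed.

Lemma cderivM f g x c c' : cderiv f x c -> cderiv g x c' ->
  cderiv (fun s => f s * g s) x (c * g x + f x * c').
Proof.
move=> [f1 f2] [g1 g2]; split.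
  rewrite (_ : (fun s => _) = (fun s => complex.Re (f s)) * (fun s => complex.Re (g s)) -
    (fun s => complex.Im (f s)) * (fun s => complex.Im (g s)));
    last by apply/funext=> s; rewrite ReM.
  apply: is_derive_eq; rewrite ReD !ReM /GRing.scale /=; ring.
rewrite (_ : (fun s => _) = (fun s => complex.Re (f s)) * (fun s => complex.Im (g s)) +
    (fun s => complex.Im (f s)) * (fun s => complex.Re (g s)));
    last by apply/funext=> s; rewrite ImM.
apply: is_derive_eq; rewrite ImD !ImM /GRing.scale /=; ring.
Qed.

Lemma cderiv_sum (I : Type) (r : seq I) (P : pred I) (F : I -> R -> C) (D : I -> C) x :
  (forall i, P i -> cderiv (F i) x (D i)) ->
  cderiv (fun s => \sum_(i <- r | P i) F i s) x (\sum_(i <- r | P i) D i).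
Proof.
move=> cF; elim: r => [|a r IH].
  rewrite (_ : (fun _ => _) = cst 0) ?big_nil; first exact: cderiv_cst.
  by apply/funext=> s; rewrite big_nil.
rewrite (_ : (fun _ => _) = (fun s => (if P a then F a s else 0) +
   \sum_(i <- r | P i) F i s)).
  rewrite big_cons; case: ifPn => Pa; first by apply: cderivD => //; exact: cF.
  by rewrite -[X in cderiv _ _ X]add0r; apply: cderivD => //; exact: cderiv_cst.
by apply/funext=> s; rewrite big_cons; case: (P a); rewrite ?add0r.
Qed.

Lemma cderiv_real (u : R -> R) x du : is_derive x 1 u du -> cderiv (fun s => (u s)%:C) x du%:C.
Proof. by move=> hu; split => //=; exact: is_derive_cst. Qed.

Lemma cderiv_expi (u : R -> R) x du : is_derive x 1 u du ->
  cderiv (fun s => expi (u s)) x ('i * du%:C * expi (u x)).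
Proof.
move=> hu; split.
  rewrite (_ : (fun s => _) = cos \o u) //.
  apply: (is_derive_eq (is_derive1_comp (is_derive_cos _) hu)).
  by rewrite /= !(mul0r, mulr0, mul1r, subr0, addr0, add0r, sub0r); ring.
rewrite (_ : (fun s => _) = sin \o u) //.
apply: (is_derive_eq (is_derive1_comp (is_derive_sin _) hu)).
by rewrite /= !(mul0r, mulr0, mul1r, subr0, addr0, add0r, sub0r); ring.
Qed.

Lemma is_derive_lin (k x : R) : is_derive x 1 (fun s : R => k * s) k.
Proof.
rewrite (_ : (fun s => _) = k *: id); last by apply/funext.
by apply: is_derive_eq; rewrite /GRing.scale /= mulr1.
Qed.

Lemma cderiv_expi_lin (k x : R) :
  cderiv (fun s => expi (k * s)) x ('i * k%:C * expi (k * x)).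
Proof. exact: cderiv_expi (is_derive_lin k x). Qed.

Definition mderiv m n (F : R -> 'M[C]_(m, n)) x (D : 'M[C]_(m, n)) :=
  forall i j, cderiv (fun s => F s i j) x (D i j).

Lemma mderiv_unique m n (F : R -> 'M[C]_(m, n)) x D D' :
  mderiv F x D -> mderiv F x D' -> D = D'.
Proof. by move=> h h'; apply/matrixP=> i j; apply: cderiv_unique (h i j) (h' i j). Qed.

Lemma mderiv_cst m n (A : 'M[C]_(m, n)) x : mderiv (fun=> A) x 0.
Proof. by move=> i j; rewrite mxE; exact: cderiv_cst. Qed.

Lemma mderivM m n p (F : R -> 'M[C]_(m, n)) (G : R -> 'M[C]_(n, p)) x D D' :
  mderiv F x D -> mderiv G x D' ->
  mderiv (fun s => F s *m G s) x (D *m G x + F x *m D').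
Proof.
move=> hF hG i j; rewrite !mxE -big_split /=.
apply: (@cderiv_ext (fun s => \sum_k F s i k * G s k j)) => [s|]; first by rewrite mxE.
by apply: cderiv_sum => k _; exact: cderivM.
Qed.

Lemma mderivMl m n p (A : 'M[C]_(m, n)) (G : R -> 'M[C]_(n, p)) x D :
  mderiv G x D -> mderiv (fun s => A *m G s) x (A *m D).
Proof.
by move=> /(mderivM (mderiv_cst A x)); rewrite mul0mx add0r.
Qed.

Lemma mderivMr m n p (F : R -> 'M[C]_(m, n)) (A : 'M[C]_(n, p)) x D :
  mderiv F x D -> mderiv (fun s => F s *m A) x (D *m A).
Proof.
by move=> h i j; have := mderivM h (mderiv_cst A x) i j; rewrite mulmx0 addr0.
Qed.

(** In a weight basis a one-parameter group is such a diagonal matrix; the inner function [u] allows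
    arbitrary speed along it. *)
Lemma mderiv_diag d (k : 'I_d -> R) (u : R -> R) x du : is_derive x 1 u du ->
  mderiv (fun s => diag_mx (\row_a expi (k a * u s))) x
    (du%:C *: (diag_mx (\row_a ('i * (k a)%:C)) *m diag_mx (\row_a expi (k a * u x)))).
Proof.
move=> hu i j; rewrite mulmx_diag !mxE.
apply: (@cderiv_ext (fun s => if i == j then expi (k i * u s) else 0)).
  by move=> s; rewrite !mxE; case: eqP => [->|]; rewrite ?mulr1n ?mulr0n.
case: eqP => [->|]; rewrite ?mulr1n ?mulr0n ?mulr0; last by move=> _; exact: cderiv_cst.
have hku : is_derive x 1 (fun s => k j * u s) (k j * du).
  rewrite (_ : (fun s => _) = k j *: u); last by apply/funext.
  by apply: is_derive_eq.
apply: cderiv_eq; first exact: cderiv_expi hku.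
rewrite rmorphM /=; ring.
Qed.

End Cderiv.

(** * Continuous characters of the circle and of the torus *)

Section CircleCharacter.
Variable R : realType.
Local Open Scope classical_set_scope.
Local Open Scope ring_scope.
Local Open Scope complex_scope.
Local Notation C := R[i].

Lemma expr2_lt (s e : R) : 0 < s -> 0 < e -> exists N : nat, s / 2 ^+ N < e.
Proof.
move=> s0 e0; exists (Num.truncn (s / e)).+1.
rewrite ltr_pdivrMr ?exprn_gt0 // -ltr_pdivrMl // mulrC.
have /andP[_ h] := truncn_itv (divr_ge0 (ltW s0) (ltW e0)).
apply: (lt_le_trans h); rewrite -natrX ler_nat; exact/ltnW/ltn_expl.
Qed.

(** The dyadic multiples of [s0] are dense in the half-line, and nonvanishing is an open
    condition. *)
Lemma dyadic_eq0 (f : R -> R) (s0 : R) : continuous f -> 0 < s0 ->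
  (forall m r : nat, f (m%:R * (s0 / 2 ^+ r)) = 0) -> forall s, 0 <= s -> f s = 0.
Proof.
move=> cf s0p f0 s sp; apply/eqP/negPn/negP => fs.
have : \forall x \near s, f x != 0.
  exact: (cvgr_neq0 (f s) (cf s)).
move=> /nbhs_ballP[e /= e0 He].
have [N hN] := expr2_lt s0p e0.
have dp : 0 < s0 / 2 ^+ N by rewrite divr_gt0 ?exprn_gt0.
have /andP[h1 h2] := truncn_itv (divr_ge0 sp (ltW dp)).
have := He ((Num.truncn (s / (s0 / 2 ^+ N)))%:R * (s0 / 2 ^+ N)).
rewrite f0 eqxx /ball /=; case/(_ _)/Bool.diff_false_true.
move: h1 h2; rewrite ler_pdivlMr // ltr_pdivrMr // -[(Num.truncn _).+1%:R]natr1 => h1 h2.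
rewrite ger0_norm ?subr_ge0 // ltrBlDl.
by apply: (lt_trans h2); rewrite mulrDl mul1r ltrD2l.
Qed.

Lemma ccont_dyadic_eq0 (f : R -> C) (s0 : R) : ccont f -> 0 < s0 ->
  (forall m r : nat, f (m%:R * (s0 / 2 ^+ r)) = 0) -> forall s, 0 <= s -> f s = 0.
Proof.
move=> [f1 f2] s0p f0 s sp.
by apply: eqC; [apply: (dyadic_eq0 f1 s0p)|apply: (dyadic_eq0 f2 s0p)] => // m r; rewrite f0.
Qed.

Section Hom.
Variable l : R -> C.
Hypothesis lD : forall s t, l (s + t) = l s * l t.
Hypothesis lc : ccont l.
Hypothesis l2pi : l (2 * pi) = 1.

Lemma charhom0 : l 0 = 1.
Proof. by have := lD (2 * pi) 0; rewrite addr0 l2pi mul1r => <-. Qed.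

Lemma charhomMn s n : l (n%:R * s) = l s ^+ n.
Proof.
elim: n => [|n IH]; first by rewrite mul0r charhom0.
by rewrite -[n.+1%:R]natr1 mulrDl mul1r lD IH exprSr.
Qed.

(** Halving determines the values: [l (s / 2)] is a square root of [l s], and positivity of its real
    part near 0 selects the right one. This fixes [l] on the dyadic multiples of a small [s0], hence
    everywhere by density, and the period 2 pi makes the exponent an integer. *)
Lemma circle_char : exists k : int, forall s, l s = expi (k%:~R * s).
Proof.
have p0 : 0 < 2 * pi :> R by rewrite mulr_gt0 ?pi_gt0.
have [e e0 He] : exists2 e : R, 0 < e & forall s, `|s| < e -> 0 < complex.Re (l s).
  have : \forall s \near (0 : R), 0 < complex.Re (l s).
    by apply: (cvgr_gt (complex.Re (l 0)) (lc.1 0)); rewrite charhom0 /= ltr01.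
  move=> /nbhs_ballP[e /= e0 He]; exists e => // s hs.
  by apply: He; rewrite /ball /= sub0r normrN.
have [N hN] := expr2_lt p0 e0.
set s0 := 2 * pi / 2 ^+ N in hN.
have s0p : 0 < s0 by rewrite divr_gt0 ?exprn_gt0.
have Res0 : 0 < complex.Re (l s0) by apply: He; rewrite gtr0_norm.
(* [l s0] is a root of unity of order dividing 2^N, so it has modulus 1. *)
have nl : (complex.Re (l s0)) ^+ 2 + (complex.Im (l s0)) ^+ 2 = 1.
  have : l s0 ^+ (2 ^ N) = 1.
    by rewrite -charhomMn natrX /s0 mulrC divfK ?expf_neq0 ?pnatr_eq0.
  move=> /(congr1 Num.norm); rewrite normrX normr1 => /eqP.
  rewrite pexpr_eq1 ?expn_gt0 ?normr_ge0 // => /eqP h.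
  apply: (@complexI R); rewrite add_Re2_Im2 h expr1n //.
pose a := asin (complex.Im (l s0)).
have Im1 : -1 <= complex.Im (l s0) <= 1.
  rewrite -ler_norml -(ler_pXn2r (n := 2)) ?nnegrE ?normr_ge0 ?ler01 //.
  by rewrite expr1n real_normK ?num_real // -nl lerDr sqr_ge0.
have la : l s0 = expi a.
  apply: eqC => /=; last by rewrite asinK.
  rewrite cos_asin // -nl addrK sqrtr_sqr gtr0_norm //.
have ha : `|a| <= pi / 2.
  by rewrite ler_norml asin_geNpi2 // asin_lepi2.
have lr r : l (s0 / 2 ^+ r) = expi (a / 2 ^+ r).
  elim: r => [|r IH]; first by rewrite expr0 !divr1.
  have hs : s0 / 2 ^+ r.+1 + s0 / 2 ^+ r.+1 = s0 / 2 ^+ r.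
    by rewrite exprS; field; rewrite ?expf_neq0 ?pnatr_eq0.
  have hs' : a / 2 ^+ r.+1 + a / 2 ^+ r.+1 = a / 2 ^+ r.
    by rewrite exprS; field; rewrite ?expf_neq0 ?pnatr_eq0.
  have : l (s0 / 2 ^+ r.+1) ^+ 2 = expi (a / 2 ^+ r.+1) ^+ 2.
    by rewrite !expr2 -lD -expiD hs hs'.
  (* In the remaining case the two roots are opposite, which is impossible since both have positive
     real part. *)
  move=> /eqP; rewrite eqf_sqr => /orP[/eqP //|/eqP E].
  have h1 : 0 < complex.Re (l (s0 / 2 ^+ r.+1)).
    apply: He; rewrite gtr0_norm ?divr_gt0 ?exprn_gt0 //.
    apply: le_lt_trans hN; rewrite ler_pdivrMr ?exprn_gt0 // ler_peMr ?(ltW s0p) //.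
    by rewrite exprn_ege1 // ler1n.
  have h2 : 0 < cos (a / 2 ^+ r.+1).
    apply: cos_gt0_pihalf; rewrite -ltr_norml normrM.
    rewrite [`|_^-1|]ger0_norm ?invr_ge0 ?exprn_ge0 //.
    rewrite ltr_pdivrMr ?exprn_gt0 //; apply: (le_lt_trans ha).
    by rewrite ltr_pMr ?divr_gt0 ?pi_gt0 // exprn_egt1 // ltr1n.
  by move: h1; rewrite E /= oppr_gt0 ltNge (ltW h2).
have ls s : 0 <= s -> l s = expi (a / s0 * s).
  move=> sp; apply/eqP; rewrite -subr_eq0; apply/eqP.
  apply: (@ccont_dyadic_eq0 (fun s => l s - expi (a / s0 * s)) s0) => // [|m r].
    apply: ccontD => //.
    rewrite (_ : (fun _ => _) = (fun s => (-1) * expi (0 + a / s0 * s))); last first.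
      by apply/funext => x; rewrite mulN1r add0r.
    apply: ccontM; first exact: ccont_cst.
    by apply: ccont_expi; exact: continuous_affine.
  rewrite charhomMn lr -expiMn -[X in expi X]mulr_natl.
  rewrite (_ : a / s0 * _ = m%:R * (a / 2 ^+ r)) ?subrr //.
  have s0n : s0 != 0 by rewrite gt_eqF.
  by field; rewrite s0n ?expf_neq0 ?pnatr_eq0.
have ls' s : l s = expi (a / s0 * s).
  have [/ls //|/ltW sp] := leP 0 s.
  have := ls (- s); rewrite oppr_ge0 => /(_ sp) h.
  have : l (- s) * l s = 1 by rewrite -lD addNr charhom0.
  rewrite h mulrN => E.
  by apply: (mulfI (expi_neq0 (- (a / s0 * s)))); rewrite E expiN.
have := ls' (2 * pi); rewrite l2pi => /esym/expi_eq1_int [k hk].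
by exists k => s; rewrite ls' (mulIf _ hk) // gt_eqF.
Qed.

End Hom.
End CircleCharacter.

(** * Simultaneous diagonalisation of torus actions *)

Section TorusDiag.
Variable R : realType.
Local Notation C := R[i].

(** Adding a vector outside the current span raises its dimension, so the induction on the
    codimension [c] stops. This reduces an infinite commuting family to the finite list that
    [codiagonalizable] accepts. *)
Lemma finite_span (F : fieldType) (V : vectType F) (T : Type) (f : T -> V) :
  exists ts : seq T, forall t, f t \in <<[seq f t | t <- ts]>>%VS.
Proof.
suff H c (ts : seq T) : (\dim {:V} - \dim <<[seq f t | t <- ts]>> <= c)%N ->
    exists ts : seq T, forall t, f t \in <<[seq f t | t <- ts]>>%VS.
  exact: (H _ [::] (leqnn _)).
elim: c ts => [|c IH] ts hc.
  exists ts => t; suff -> : <<[seq f t | t <- ts]>>%VS = fullv by rewrite memvf.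
  by apply/eqP; rewrite eqEdim subvf /= -subn_eq0 -leqn0.
have [?|/existsNP[t /negP ht]] := pselect (forall t, f t \in <<[seq f t | t <- ts]>>%VS).
  by exists ts.
apply: (IH (t :: ts)) => /=.
have lt : (\dim <<[seq f t | t <- ts]>> < \dim <<f t :: [seq f t | t <- ts]>>)%N.
  rewrite ltnNge; apply: contra ht => hle.
  have sub : (<<[seq f t | t <- ts]>> <= <<f t :: [seq f t | t <- ts]>>)%VS.
    by rewrite span_cons addvSr.
  have /eqP -> : (<<[seq f t | t <- ts]>> == <<f t :: [seq f t | t <- ts]>>)%VS.
    by rewrite eqEdim sub.
  by rewrite memv_span // mem_head.
by rewrite -ltnS; apply: leq_trans hc; rewrite ltn_sub2l // (leq_trans lt) // dimvS // subvf.
Qed.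

Lemma prim_root_expi N : (0 < N)%N -> N.-primitive_root (expi (2 * pi / N%:R) : C).
Proof.
move=> N0; apply/andP; split=> //; apply/forallP => i; apply/eqP.
rewrite unity_rootE -expiMn -[X in expi X]mulr_natr.
have N0R : N%:R != 0 :> R by rewrite pnatr_eq0 -lt0n.
have [->|neq] := eqVneq i.+1 N.
  by rewrite divfK // expi_2pi eqxx.
apply/eqP => h; have := expi_eq1 _ h.
have iN : (i.+1 < N)%N by rewrite ltn_neqAle neq ltn_ord.
rewrite !mulr_ge0 ?invr_ge0 ?ler0n ?pi_ge0 //= -mulrA gtr_pMr ?mulr_gt0 ?pi_gt0 //.
rewrite mulrC ltr_pdivrMr ?ltr0n // mul1r ltr_nat iN => /(_ erefl) /eqP.
by rewrite !mulf_eq0 invr_eq0 !pnatr_eq0 (gt_eqF (pi_gt0 R)) (gtn_eqF N0).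
Qed.

(** The minimal polynomial divides X^N - 1, which has N distinct roots. *)
Lemma diagonalizable_finite_order d (A : 'M[C]_d.+1) N : (0 < N)%N -> A ^+ N = 1 ->
  diagonalizable A.
Proof.
move=> N0 AN; apply/diagonalizableP.
pose z : C := expi (2 * pi / N%:R).
have pz : N.-primitive_root z by exact: prim_root_expi.
exists [seq z ^+ i | i <- index_iota 0 N].
  rewrite map_inj_in_uniq ?iota_uniq // => i j; rewrite !mem_index_iota /= => iN jN.
  by move/eqP; rewrite (eq_prim_root_expr pz) !modn_small // => /eqP.
rewrite big_map (factor_Xn_sub_1 pz); apply: mxminpoly_min.
by rewrite rmorphB /= rmorphXn /= horner_mx_X rmorph1 AN subrr.
Qed.

(** Torsion points of 2-power order on the coordinate circles act by commuting matrices of finite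
    order, so one base change diagonalises all of them. Density and continuity extend this to the
    whole circles, and the diagonal entries are circle characters. *)
Lemma torus_diag (k d : nat) (phi : ('I_k -> R) -> 'M[C]_d)
    (e := fun (i : 'I_k) (s : R) (j : 'I_k) => if j == i then s else 0) :
  (forall t t', phi (fun i => t i + t' i) = phi t *m phi t') ->
  phi (fun=> 0) = 1%:M ->
  (forall i, phi (e i (2 * pi)) = 1%:M) ->
  (forall i a b, ccont (fun s => phi (e i s) a b)) ->
  exists2 P : 'M[C]_d, P \in unitmx & exists mu : 'I_d -> 'I_k -> int,
    forall t, P *m phi t = diag_mx (\row_a expi (\sum_i (mu a i)%:~R * t i)) *m P.
Proof.
case: d phi => [|d] phi phiD phi0 phi2pi phic.
  by exists 1%:M; rewrite ?unitmx1 //; exists (fun _ _ => 0) => t; rewrite [LHS]flatmx0 [RHS]flatmx0.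
have eD i s t : e i (s + t) = fun j => e i s j + e i t j.
  by apply/funext => j; rewrite /e; case: eqP; rewrite ?addr0.
have e0 i : e i 0 = fun=> 0 by apply/funext => j; rewrite /e; case: eqP.
have phieD i s t : phi (e i (s + t)) = phi (e i s) *m phi (e i t) by rewrite eD phiD.
have phieMn i s (n : nat) : phi (e i (n%:R * s)) = phi (e i s) ^+ n.
  elim: n => [|n IH]; first by rewrite mul0r e0 phi0 expr0.
  by rewrite -[n.+1%:R]natr1 mulrDl mul1r phieD IH exprSr.
have comm t t' : phi t *m phi t' = phi t' *m phi t.
  by rewrite -!phiD; congr phi; apply/funext => i; rewrite addrC.
pose T : Type := ('I_k * nat * nat)%type.
pose f (x : T) := phi (e x.1.1 (x.1.2%:R * (2 * pi / 2 ^+ x.2))).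
have [ts hts] := finite_span f.
have : codiagonalizable [seq f t | t <- ts].
  apply/codiagonalizableP; split.
    by move=> A B /mapP[x _ ->] /mapP[y _ ->]; rewrite /comm_mx /f comm.
  move=> A /mapP[x _ ->]; apply: (@diagonalizable_finite_order _ _ (2 ^ x.2)%N).
    by rewrite expn_gt0.
  rewrite /f -phieMn natrX mulrCA [_ * (_ / _)]mulrC divfK ?expf_neq0 ?pnatr_eq0 //.
  by rewrite phieMn phi2pi; exact: expr1n.
move=> [P Pu /allP Pd].
(* Every [f x] lies in the span of the finite list, so it is diagonal in the same basis. *)
have {}Pd x i j : i != j -> (P *m f x *m invmx P) i j = 0.
  move=> ij; rewrite (coord_span (X := in_tuple [seq f t | t <- ts]) (hts x)).
  rewrite mulmx_sumr mulmx_suml summxE big1 // => l _.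
  rewrite -scalemxAr -scalemxAl mxE.
  set A := _`_l; have /Pd : A \in [seq f t | t <- ts].
    by apply: mem_nth; exact: ltn_ord.
  rewrite /similar_to /= conjumx // => /is_diag_mxP /(_ i j ij) ->; rewrite mulr0 //.
pose Q i s := P *m phi (e i s) *m invmx P.
have QD i s t : Q i (s + t) = Q i s *m Q i t.
  by rewrite /Q phieD !mulmxA mulmxKV.
have Qc i a b : ccont (fun s => Q i s a b).
  rewrite (_ : (fun s => _) =
    (fun s => \sum_u (\sum_v P a v * phi (e i s) v u) * invmx P u b)); last first.
    by apply/funext => s; rewrite /Q mxE; apply: eq_bigr => u _; rewrite mxE.
  apply: ccont_sum => u; apply: ccontM; last exact: ccont_cst.
  by apply: ccont_sum => v; apply: ccontM => //; exact: ccont_cst.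
have Q2pi i : Q i (2 * pi) = 1%:M by rewrite /Q phi2pi mulmx1 mulmxV.
have Qn i s (n : nat) : Q i (s + n%:R * (2 * pi)) = Q i s.
  by rewrite QD /Q phieMn phi2pi (expr1n _ n) mulmx1 mulmxV // mulmx1.
have Qd0 i s a b : a != b -> 0 <= s -> Q i s a b = 0.
  move=> ab; apply: (@ccont_dyadic_eq0 _ (fun s => Q i s a b) (2 * pi)) => //.
    by rewrite mulr_gt0 ?pi_gt0.
  by move=> m r; exact: (Pd (i, m, r)).
(* The density lemma covers s >= 0; a multiple of 2 pi moves a negative s there. *)
have Qd i s a b : a != b -> Q i s a b = 0.
  move=> ab; rewrite -(Qn i s (Num.truncn (`|s| / (2 * pi))).+1); apply: Qd0 => //.
  have p2 : 0 < 2 * pi :> R by rewrite mulr_gt0 ?pi_gt0.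
  have /andP[_] := truncn_itv (divr_ge0 (normr_ge0 s) (ltW p2)).
  rewrite ltr_pdivrMr // => h; rewrite -lerBlDl sub0r (le_trans (ler_norm _)) //.
  by rewrite normrN ltW.
have QdD i s t a : Q i (s + t) a a = Q i s a a * Q i t a a.
  rewrite QD mxE (bigD1 a) //= big1 ?addr0 // => b ba.
  by rewrite Qd ?mul0r // eq_sym.
have /choice[mu hmu] : forall ai : 'I_d.+1 * 'I_k, exists m : int,
    forall s, Q ai.2 s ai.1 ai.1 = expi (m%:~R * s).
  move=> [a i]; apply: (@circle_char _ (fun s => Q i s a a)) => [s t||].
  - exact: QdD.
  - exact: Qc.
  - by rewrite Q2pi mxE eqxx.
exists P => //; exists (fun a i => mu (a, i)) => t.
suff H (r : seq 'I_k) : uniq r -> P *m phi (fun j => if j \in r then t j else 0) =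
    diag_mx (\row_a expi (\sum_(i <- r) (mu (a, i))%:~R * t i)) *m P.
  have := H _ (index_enum_uniq _); congr (P *m phi _ = _); apply/funext => j.
  by rewrite mem_index_enum.
have Qdiag i s : P *m phi (e i s) = diag_mx (\row_a expi ((mu (a, i))%:~R * s)) *m P.
  rewrite -[LHS](mulmxKV Pu); congr (_ *m _).
  apply/matrixP => a b; rewrite [RHS]mxE [in RHS]mxE; have [->|ab] := eqVneq a b.
    by rewrite mulr1n -(hmu (b, i)).
  by rewrite mulr0n [LHS]Qd.
elim: r => [_|i r IH /= /andP[ir ur]].
  rewrite phi0 mulmx1 [diag_mx _](_ : _ = 1%:M) ?mul1mx //.
  by apply/matrixP => a b; rewrite !mxE big_nil expi0.
have -> : (fun j => if j \in i :: r then t j else 0) =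
    fun j => e i (t i) j + (if j \in r then t j else 0).
  apply/funext => j; rewrite /e inE; have [->|] := eqVneq j i; last by rewrite add0r.
  by rewrite (negPf ir) addr0.
rewrite phiD mulmxA Qdiag -mulmxA IH // mulmxA mulmx_diag; congr (diag_mx _ *m P).
by apply/rowP => a; rewrite !mxE big_cons expiD.
Qed.

End TorusDiag.

(** * Plane rotations and generation of SO(m) *)

Section PlaneRot.
Variables (R : realType) (m : nat).
Implicit Types (p q r u v : 'I_m) (s t : R).
Local Notation rot p q t := (@plane_rot R m (p : 'I_m) (q : 'I_m) t).

Lemma plane_rotE p q t : p != q ->
  rot p q t = 1%:M + (cos t - 1) *: (delta_mx p p + delta_mx q q)
              + sin t *: (delta_mx q p - delta_mx p q).
Proof.
move=> pq; apply/matrixP => i j; rewrite !mxE -!val_eqE /=.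
have {pq} : nat_of_ord p != q by [].
move: (nat_of_ord p) (nat_of_ord q) (nat_of_ord i) (nat_of_ord j) => {}p {}q {}i {}j pq.
have [ei|ip] := eqVneq i p; have [ej|jp] := eqVneq j p;
have [ei'|iq] := eqVneq i q; have [ej'|jq] := eqVneq j q => /=.
all: try by move: pq; rewrite -ei ei' eqxx.
all: try by move: pq; rewrite -ej ej' eqxx.
all: rewrite ?mulr1n ?mulr0n.
all: try (rewrite ei ej eqxx /=; ring).
all: try (rewrite ei' ej' eqxx /=; ring).
all: try (rewrite ei 1?eq_sym (negPf jp) /=; ring).
all: try (rewrite ei' 1?eq_sym (negPf jq) /=; ring).
all: try (rewrite ej (negPf ip) /=; ring).
all: try (rewrite ej' (negPf iq) /=; ring).
all: ring.
Qed.

Lemma delta_mxM p q u v :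
  delta_mx p q *m delta_mx u v = (q == u)%:R *: delta_mx p v :> 'M[R]_m.
Proof. by case: eqP => [->|/eqP qu]; rewrite ?scale1r ?scale0r ?mul_delta_mx // mul_delta_mx_0. Qed.

Lemma plane_rot0 p q : p != q -> rot p q 0 = 1%:M.
Proof. by move=> pq; rewrite plane_rotE // cos0 sin0 subrr !scale0r !addr0. Qed.

(** With [N] the projection onto the plane and [K] its infinitesimal rotation, the group law reduces
    to N^2 = N, NK = KN = K and K^2 = -N. *)
Lemma plane_rotD p q s t : p != q -> rot p q (s + t) = rot p q s *m rot p q t.
Proof.
move=> pq; rewrite !plane_rotE //.
set N := (delta_mx p p + delta_mx q q); set K := (delta_mx q p - delta_mx p q).
have qp : q != p by rewrite eq_sym.
have NN : N *m N = N.
  by rewrite mulmxDl !mulmxDr !delta_mxM !eqxx (negPf pq) (negPf qp) !scale0r !scale1r addr0 add0r.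
have NK : N *m K = K.
  rewrite mulmxDl !mulmxBr !delta_mxM !eqxx (negPf pq) (negPf qp) !scale0r !scale1r.
  by rewrite sub0r subr0 addrC.
have KN : K *m N = K.
  rewrite mulmxBl !mulmxDr !delta_mxM !eqxx (negPf pq) (negPf qp) !scale0r !scale1r.
  by rewrite add0r addr0.
have KK : K *m K = - N.
  rewrite mulmxBl !mulmxBr !delta_mxM !eqxx (negPf pq) (negPf qp) !scale0r !scale1r.
  by rewrite sub0r subr0 opprD addrC.
rewrite !(mulmxDl, mulmxDr) !(mul1mx, mulmx1) -!scalemxAl -!scalemxAr !scalerA NN NK KN KK.
rewrite cosD sinD; apply/matrixP => i j; rewrite [LHS]mxE [in LHS]mxE [RHS]mxE.
move: N K {NN NK KN KK} => N K; rewrite !mxE; ring.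
Qed.

Lemma plane_rotC p q t : p != q -> rot q p t = rot p q (- t).
Proof.
move=> pq; rewrite !plane_rotE // 1?eq_sym // cosN sinN scaleNr -scalerN opprB.
by rewrite [delta_mx q q + _]addrC.
Qed.

Lemma tr_plane_rot p q t : p != q -> (rot p q t)^T = rot p q (- t).
Proof.
move=> pq; rewrite !plane_rotE //; apply/matrixP => i j; rewrite !mxE cosN sinN.
by rewrite (eq_sym j i) ![(j == _) && _]andbC; ring.
Qed.

Lemma plane_rot_orth p q t : p != q -> rot p q t *m (rot p q t)^T = 1%:M.
Proof. by move=> pq; rewrite tr_plane_rot // -plane_rotD // subrr plane_rot0. Qed.

(** The rotation is the square of the rotation by half the angle, and the determinant of an
    orthogonal matrix squares to 1. *)
Lemma det_plane_rot p q t : p != q -> \det (rot p q t) = 1.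
Proof.
move=> pq; have -> : t = t / 2 + t / 2 by field.
rewrite plane_rotD // det_mulmx -expr2.
have := congr1 determinant (plane_rot_orth (t / 2) pq).
by rewrite det_mulmx det_tr det1 expr2.
Qed.

Lemma plane_rot_SO p q t : p != q -> special_orthogonal R m (rot p q t).
Proof. by move=> pq; split; [exact: plane_rot_orth|exact: det_plane_rot]. Qed.

Lemma plane_rot_commute p q u v s t : p != q -> u != v ->
  p != u -> p != v -> q != u -> q != v ->
  rot p q s *m rot u v t = rot u v t *m rot p q s.
Proof.
move=> pq uv pu pv qu qv; rewrite !plane_rotE // -!addrA.
set A := (cos s - 1) *: _ + _; set B := (cos t - 1) *: _ + _.
have H (a b c d : 'I_m) : b != c -> delta_mx a b *m delta_mx c d = 0 :> 'M[R]_m.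
  by move=> bc; rewrite delta_mxM (negPf bc) scale0r.
have AB : A *m B = 0.
  rewrite /A /B !(mulmxDl, mulmxDr, mulmxBl, mulmxBr) -!scalemxAl -!scalemxAr.
  rewrite !(mulmxDl, mulmxDr, mulmxBl, mulmxBr) !H // ?(mulNmx, mulmxN) !H //.
  by rewrite !(oppr0, addr0, scaler0).
have BA : B *m A = 0.
  rewrite /A /B !(mulmxDl, mulmxDr, mulmxBl, mulmxBr) -!scalemxAl -!scalemxAr.
  rewrite !(mulmxDl, mulmxDr, mulmxBl, mulmxBr) ?(mulNmx, mulmxN) !H 1?eq_sym //.
  by rewrite !(oppr0, addr0, scaler0).
move: A B AB BA => A B AB BA.
by rewrite !(mulmxDl, mulmxDr) !(mul1mx, mulmx1) AB BA !addr0 -!addrA; congr (_ + _); rewrite addrC.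
Qed.

Lemma special_orthogonalM (A B : 'M[R]_m) : special_orthogonal R m A ->
  special_orthogonal R m B -> special_orthogonal R m (A *m B).
Proof.
move=> [A1 A2] [B1 B2]; split; last by rewrite det_mulmx A2 B2 mulr1.
by rewrite trmx_mul mulmxA -(mulmxA A) B1 mulmx1.
Qed.

Section Embedding.
Variables (k : nat) (io : 'I_k -> 'I_m).
Hypothesis io_inj : injective io.

Let J : 'M[R]_(k, m) := \matrix_(a, j) (io a == j)%:R.

(** [J] selects the coordinates along [io], so this acts as [M] on the chosen coordinates and
    trivially on the others. Matrix identities checked in dimension 3 are transported along it. *)
Definition mx_embed (M : 'M[R]_k) : 'M[R]_m := 1%:M + J^T *m (M - 1%:M) *m J.

Let JJ : J *m J^T = 1%:M.
Proof.
apply/matrixP => a b; rewrite !mxE (bigD1 (io a)) //= big1 => [|j ja]; rewrite !mxE.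
  by rewrite eqxx mul1r addr0 (inj_eq io_inj) eq_sym.
by rewrite eq_sym (negPf ja) mul0r.
Qed.

Lemma mx_embedM M N : mx_embed (M *m N) = mx_embed M *m mx_embed N.
Proof.
rewrite /mx_embed; set M' := M - 1%:M; set N' := N - 1%:M.
have -> : M *m N - 1%:M = M' + N' + M' *m N'.
  rewrite /M' /N' !(mulmxBl, mulmxBr, mul1mx, mulmx1).
  move: (M *m N) => X; apply/matrixP => i j; rewrite !mxE; ring.
move: M' N' => {}M {}N.
rewrite !(mulmxDl, mulmxDr) !(mul1mx, mulmx1) !mulmxA.
rewrite -(mulmxA (_ *m M) J J^T) JJ mulmx1 -!addrA; congr (_ + _).
by rewrite addrCA.
Qed.

Lemma mx_embed_delta a b : J^T *m delta_mx a b *m J = delta_mx (io a) (io b).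
Proof.
apply/matrixP => i j; rewrite !mxE (bigD1 b) //= big1 => [|c cb]; rewrite !mxE.
  rewrite (bigD1 a) //= big1 => [|c ca]; rewrite !mxE ?eqxx ?(negPf ca) ?mulr0 //.
  rewrite mulr1 !addr0 (eq_sym i) (eq_sym j).
  by case: (_ == i); case: (_ == j); rewrite ?mulr1 ?mulr0 ?mul0r.
by rewrite big1 ?mul0r // => d _; rewrite !mxE (negPf cb) andbF mulr0.
Qed.

End Embedding.
End PlaneRot.

Section EmbedRot.
Variables (R : realType) (m k : nat) (io : 'I_k -> 'I_m).
Hypothesis io_inj : injective io.

Lemma mx_embed_rot (a b : 'I_k) t : a != b ->
  mx_embed io (plane_rot k a b t) = plane_rot m (io a) (io b) t :> 'M[R]_m.
Proof.
move=> ab; rewrite !plane_rotE // ?(inj_eq io_inj) // /mx_embed.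
set A := (cos t - 1) *: _; set B := sin t *: _.
have -> : 1%:M + A + B - 1%:M = A + B.
  by move: A B => A B; rewrite addrAC [1%:M + A - _]addrAC subrr add0r.
rewrite mulmxDr mulmxDl addrA /A /B -!scalemxAr -!scalemxAl mulmxDr mulmxDl mulmxBr mulmxBl.
by rewrite !mx_embed_delta.
Qed.

End EmbedRot.

(** * Real derivation rules in pointwise form *)

Section PointwiseDerive.
Variable R : realType.
Implicit Types (f g : R -> R) (x : R).

Lemma is_derive_add f g x a b : is_derive x 1 f a -> is_derive x 1 g b ->
  is_derive x 1 (fun s => f s + g s) (a + b).
Proof. by move=> hf hg; exact: is_deriveD. Qed.

Lemma is_derive_mul f g x a b : is_derive x 1 f a -> is_derive x 1 g b ->
  is_derive x 1 (fun s => f s * g s) (f x * b + a * g x).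
Proof.
move=> hf hg; apply: (is_derive_eq (is_deriveM hf hg)).
by rewrite /GRing.scale /= [g x * a]mulrC.
Qed.

Lemma is_derive_const (c x : R) : is_derive x 1 (fun=> c) 0.
Proof. exact: is_derive_cst. Qed.

Lemma is_derive_sin_comp f x a : is_derive x 1 f a ->
  is_derive x 1 (fun s => sin (f s)) (cos (f x) * a).
Proof. by move=> hf; exact: (is_derive1_comp (is_derive_sin _) hf). Qed.

Lemma is_derive_cos_comp f x a : is_derive x 1 f a ->
  is_derive x 1 (fun s => cos (f s)) (- sin (f x) * a).
Proof. by move=> hf; exact: (is_derive1_comp (is_derive_cos _) hf). Qed.

Lemma is_derive_continuous f x a : is_derive x 1 f a -> {for x, continuous f}.
Proof.
by move=> hf; apply: differentiable_continuous; apply/derivable1_diffP; exact: ex_derive.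
Qed.

End PointwiseDerive.

(** * Euler angles for a conjugated rotation in SO(3) *)

Section Euler.
Variable R : realType.
Local Open Scope classical_set_scope.
Local Open Scope ring_scope.
Local Notation i0 := (@Ordinal 3 0 isT).
Local Notation i1 := (@Ordinal 3 1 isT).
Local Notation i2 := (@Ordinal 3 2 isT).
Local Notation rot01 := (@plane_rot R 3 i0 i1).
Local Notation rot12 := (@plane_rot R 3 i1 i2).
Local Notation rot02 := (@plane_rot R 3 i0 i2).

Lemma ord3P (i : 'I_3) : [\/ i = i0, i = i1 | i = i2].
Proof.
case: i => [[|[|[|//]]] hi]; [constructor 1|constructor 2|constructor 3]; exact: val_inj.
Qed.

Lemma mulmx3E (A B : 'M[R]_3) i j :
  (A *m B) i j = A i i0 * B i0 j + A i i1 * B i1 j + A i i2 * B i2 j.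
Proof.
rewrite mxE !big_ord_recl big_ord0 addr0 addrA.
by congr (_ + _ + _); congr (_ * _); congr (_ _ _); apply: val_inj.
Qed.

Lemma det_mx2 (A : 'M[R]_2) : \det A = A 0 0 * A 1 1 - A 0 1 * A 1 0.
Proof.
have E i j : A i j = A (inord (val i)) (inord (val j)) by rewrite !inord_val.
rewrite (expand_det_row _ 0) !big_ord_recl big_ord0 /cofactor !det_mx11 !mxE.
rewrite !(E (lift _ _)) !(E _ (lift _ _)) !(E 0) !(E 1) /= /bump /=; ring.
Qed.

Lemma det_mx3 (A : 'M[R]_3) : \det A =
  A i0 i0 * (A i1 i1 * A i2 i2 - A i1 i2 * A i2 i1) -
  A i0 i1 * (A i1 i0 * A i2 i2 - A i1 i2 * A i2 i0) +
  A i0 i2 * (A i1 i0 * A i2 i1 - A i1 i1 * A i2 i0).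
Proof.
pose f a b := A (inord a) (inord b).
have E i j : A i j = f (val i) (val j) by rewrite /f !inord_val.
rewrite (expand_det_row _ i0) !big_ord_recl big_ord0 /cofactor !det_mx2 !mxE !E /= /bump /=.
ring.
Qed.

(** Orthogonality also clears the last row, leaving a plane rotation; since its cosine is positive,
    [asin] recovers the angle from the sine. *)
Lemma SO3_fix_rot (W : 'M[R]_3) : special_orthogonal R 3 W ->
  W i0 i2 = 0 -> W i1 i2 = 0 -> W i2 i2 = 1 -> 0 < W i0 i0 ->
  W = rot01 (asin (W i1 i0)).
Proof.
move=> [WW dW] h02 h12 h22 W00.
have E i j : W i i0 * W j i0 + W i i1 * W j i1 + W i i2 * W j i2 = (i == j)%:R.
  by have /matrixP/(_ i j) := WW; rewrite mulmx3E !mxE.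
have dE : W i0 i0 * W i1 i1 - W i0 i1 * W i1 i0 = 1.
  by rewrite -dW det_mx3 h02 h12 h22; ring.
have := E i2 i2; rewrite h22 mul1r eqxx => e22.
have /andP[/eqP h20 /eqP h21] : (W i2 i0 == 0) && (W i2 i1 == 0).
  rewrite -(sqrf_eq0 (W i2 i0)) -(sqrf_eq0 (W i2 i1)) -paddr_eq0 ?sqr_ge0 //; apply/eqP.
  by apply: (addIr 1); rewrite add0r -[RHS]e22; ring.
have := E i0 i0; have := E i0 i1; have := E i1 i1; rewrite h02 h12 !mul0r !addr0 !eqxx /= ?mulr1n.
move=> e11 e01 e00.
have h11 : W i1 i1 = W i0 i0.
  have : W i0 i0 * (W i0 i0 * W i1 i1 - W i0 i1 * W i1 i0) = W i0 i0 by rewrite dE mulr1.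
  move=> <-; transitivity ((W i0 i0 * W i0 i0 + W i0 i1 * W i0 i1) * W i1 i1).
    by rewrite e00 mul1r.
  transitivity (W i0 i0 * W i0 i0 * W i1 i1 + W i0 i1 * (W i0 i1 * W i1 i1)); first ring.
  have -> : W i0 i1 * W i1 i1 = - (W i0 i0 * W i1 i0) by apply/eqP; rewrite -addr_eq0 addrC e01.
  ring.
have h01 : W i0 i1 = - W i1 i0.
  have : W i0 i1 * (W i0 i0 * W i1 i1 - W i0 i1 * W i1 i0) = W i0 i1 by rewrite dE mulr1.
  move=> <-; transitivity (W i0 i0 * (W i0 i1 * W i1 i1) - W i0 i1 * W i0 i1 * W i1 i0); first ring.
  have -> : W i0 i1 * W i1 i1 = - (W i0 i0 * W i1 i0) by apply/eqP; rewrite -addr_eq0 addrC e01.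
  by rewrite -[in RHS](mul1r (W i1 i0)) -e00; ring.
have b10 : -1 <= W i1 i0 <= 1 by apply/andP; split; nra.
have c10 : cos (asin (W i1 i0)) = W i0 i0.
  rewrite cos_asin // -[X in Num.sqrt X](_ : W i0 i0 ^+ 2 = _); last by rewrite -e11 h11; ring.
  by rewrite sqrtr_sqr gtr0_norm.
apply/matrixP => i j; rewrite mxE c10 asinK //.
by case: (ord3P i) => ->; case: (ord3P j) => -> /=; rewrite ?mulr1n ?mulr0n.
Qed.

Variable t : R.
Let G s := rot01 t *m rot12 s *m rot01 (- t).
(** The third column of [G s] is (sin t sin s, - cos t sin s, cos s). Rotating by [- u s] clears its
    second entry and then by [- v s] its first, so that [W s] fixes the third axis. *)
Let u s := atan (cos t * tan s).
Let v s := asin (- sin t * sin s).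
Let W s := rot02 (- v s) *m (rot12 (- u s) *m G s).

Let GE s : [/\ G s i0 i0 = cos t ^+ 2 + sin t ^+ 2 * cos s,
  G s i1 i0 = sin t * cos t * (1 - cos s) & G s i2 i0 = - (sin t * sin s)] /\
  [/\ G s i0 i2 = sin t * sin s, G s i1 i2 = - (cos t * sin s) & G s i2 i2 = cos s].
Proof. by split; split; rewrite /G !mulmx3E !mxE /= ?(cosN, sinN); ring. Qed.

Let W00 s : W s i0 i0 = cos (v s) * (cos t ^+ 2 + sin t ^+ 2 * cos s) +
  sin (v s) * (- sin (u s) * (sin t * cos t * (1 - cos s)) + cos (u s) * (- (sin t * sin s))).
Proof.
by have [[e1 e2 e3] _] := GE s; rewrite /W (mulmx3E (rot02 _)) !(mulmx3E (rot12 (- u s)) (G s))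
    e1 e2 e3 !mxE /= ?(cosN, sinN); ring.
Qed.

Let W10 s : W s i1 i0 = cos (u s) * (sin t * cos t * (1 - cos s)) +
  sin (u s) * (- (sin t * sin s)).
Proof.
by have [[e1 e2 e3] _] := GE s; rewrite /W (mulmx3E (rot02 _)) !(mulmx3E (rot12 (- u s)) (G s))
    e1 e2 e3 !mxE /= ?(cosN, sinN); ring.
Qed.

Let WSO s : special_orthogonal R 3 (W s).
Proof. by do !apply: special_orthogonalM; apply: plane_rot_SO. Qed.

Let u0 : u 0 = 0. Proof. by rewrite /u tan0 mulr0 atan0. Qed.
Let v0 : v 0 = 0.
Proof. by rewrite /v sin0 mulr0 -[X in asin X](sin0 R) sinK // in_itv /= oppr_le0 !divr_ge0 ?pi_ge0. Qed.

Let du : is_derive (0 : R) 1 u (cos t).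
Proof.
have h1 : is_derive (0 : R) 1 (fun s => cos t * tan s) (cos t).
  apply: (is_derive_eq (is_derive_mul (is_derive_const _ _) (is_derive_tan _))).
    by rewrite cos0 oner_neq0.
  by rewrite cos0 expr1n invr1 mulr1 mul0r addr0.
apply: (is_derive_eq (is_derive1_comp (is_derive1_atan _) h1)).
by rewrite tan0 mulr0 expr0n addr0 invr1 mul1r.
Qed.

Let dv : is_derive (0 : R) 1 v (- sin t).
Proof.
have h1 : is_derive (0 : R) 1 (fun s => - sin t * sin s) (- sin t).
  apply: (is_derive_eq (is_derive_mul (is_derive_const _ _) (is_derive_sin _))).
  by rewrite cos0 mulr1 mul0r addr0.
have h2 : is_derive (- sin t * sin 0) 1 (@asin R) 1.
  rewrite sin0 mulr0; apply: (is_derive_eq (is_derive1_asin _)).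
    by rewrite ltrN10 ltr01.
  by rewrite expr0n subr0 sqrtr1 invr1.
by apply: (is_derive_eq (is_derive1_comp (x := 0) (g := fun s => - sin t * sin s) h2 h1)); rewrite mul1r.
Qed.

(** Differentiated at s = 0 under [rho], this yields the adjoint action: a conjugate of a plane
    rotation becomes a product of plane rotations with the known speeds cos t, - sin t and 0. *)
Lemma conj_rot_euler : exists u v w : R -> R,
  [/\ is_derive (0 : R) 1 u (cos t), is_derive (0 : R) 1 v (- sin t),
      is_derive (0 : R) 1 w 0, [/\ u 0 = 0, v 0 = 0 & w 0 = 0] &
      \forall s \near (0 : R),
        rot01 t *m rot12 s *m rot01 (- t) =
        rot12 (u s) *m rot02 (v s) *m rot01 (w s)].
Proof.
have dcu := is_derive_cos_comp du; have dsu := is_derive_sin_comp du.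
have dcv := is_derive_cos_comp dv; have dsv := is_derive_sin_comp dv.
have dc := is_derive_cos (0 : R); have ds := is_derive_sin (0 : R).
have dk c : is_derive (0 : R) 1 (fun=> c) 0 := is_derive_const c 0.
have dW10 : is_derive (0 : R) 1 (fun s => W s i1 i0) 0.
  rewrite (_ : (fun s => _) = (fun s => cos (u s) * (sin t * cos t * (1 + (-1) * cos s)) +
    sin (u s) * ((- sin t) * sin s))); last by apply/funext => s; rewrite W10; ring.
  apply: (is_derive_eq (is_derive_add
     (is_derive_mul dcu (is_derive_mul (dk _) (is_derive_add (dk _) (is_derive_mul (dk _) dc))))
     (is_derive_mul dsu (is_derive_mul (dk _) ds)))).
  by rewrite u0 sin0 cos0; ring.
have dW00 : exists a, is_derive (0 : R) 1 (fun s => W s i0 i0) a.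
  rewrite (_ : (fun s => _) = (fun s => cos (v s) * (cos t ^+ 2 + sin t ^+ 2 * cos s) +
    sin (v s) * ((-1) * sin (u s) * (sin t * cos t * (1 + (-1) * cos s)) +
    cos (u s) * ((- sin t) * sin s)))); last by apply/funext => s; rewrite W00; ring.
  eexists; apply: is_derive_add; apply: is_derive_mul => //; apply: is_derive_add => //;
  apply: is_derive_mul => //; apply: is_derive_mul => //; apply: is_derive_add => //;
  apply: is_derive_mul => //.
exists u, v, (fun s => asin (W s i1 i0)).
have W100 : W 0 i1 i0 = 0 by rewrite W10 u0 sin0 cos0; ring.
have a0 : asin 0 = 0 :> R.
  by rewrite -[X in asin X](sin0 R) sinK // in_itv /= oppr_le0 !divr_ge0 ?pi_ge0.
split => //.
- have h2 : is_derive (W 0 i1 i0) 1 (@asin R) 1.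
    rewrite W100; apply: (is_derive_eq (is_derive1_asin _)).
      by rewrite ltrN10 ltr01.
    by rewrite expr0n subr0 sqrtr1 invr1.
  by apply: (is_derive_eq (is_derive1_comp (x := 0) (g := fun s => W s i1 i0) h2 dW10)); rewrite mulr0.
- by rewrite W100.
have [a /is_derive_continuous cW00] := dW00.
have n1 : \forall s \near (0 : R), 0 < W s i0 i0.
  apply: (cvgr_gt _ cW00); rewrite W00 u0 v0 sin0 cos0 mul0r addr0 mul1r mulr1.
  by rewrite cos2Dsin2 ltr01.
have n2 : \forall s \near (0 : R), 0 < cos s.
  by apply: (cvgr_gt _ (@continuous_cos R 0)); rewrite cos0 ltr01.
near=> s.
have W00s : 0 < W s i0 i0 by near: s.
have coss : 0 < cos s by near: s.
have cosu : 0 < cos (u s).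
  by apply: cos_gt0_pihalf; rewrite atan_gtNpi2 atan_ltpi2.
(* The defining relation of [u], freed from denominators. *)
have tanu : sin (u s) * cos s = cos (u s) * (cos t * sin s).
  have : tan (u s) = cos t * tan s by rewrite atanK.
  rewrite /tan => /(congr1 (fun z => z * (cos (u s) * cos s))).
  move=> h; transitivity (sin (u s) / cos (u s) * (cos (u s) * cos s)).
    by field; rewrite gt_eqF.
  by rewrite h; field; rewrite gt_eqF.
have b1 : -1 <= - sin t * sin s <= 1.
  rewrite -ler_norml normrM normrN mulr_ile1 ?normr_ge0 ?sin_max //.
have sinv : sin (v s) = - sin t * sin s by rewrite asinK.
have cosv : 0 <= cos (v s).
  by rewrite cos_asin // sqrtr_ge0.
(* [Z] is the third entry of the third column after the first rotation. It is positive and its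
   square is 1 - sin(v s)^2, so it equals cos(v s). *)
pose Z := sin (u s) * (cos t * sin s) + cos (u s) * cos s.
have Zcos : Z * cos (u s) = cos s.
  rewrite /Z mulrDl -mulrA [_ * cos (u s)]mulrC mulrA [cos (u s) * _ * _]mulrAC -!mulrA.
  have := cos2Dsin2 (u s); have := tanu; move: (sin (u s)) (cos (u s)) => x y e1 e2.
  transitivity (x * (y * (cos t * sin s)) + y ^+ 2 * cos s); first ring.
  by rewrite -e1; transitivity ((y ^+ 2 + x ^+ 2) * cos s); [ring|rewrite e2 mul1r].
have Z0 : 0 < Z by rewrite -(pmulr_lgt0 _ cosu) Zcos.
have ZE : Z = cos (v s).
  apply/eqP; rewrite -(eqrXn2 (n := 2)) ?(ltW Z0) //; apply/eqP.
  rewrite cos2sin2 sinv.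
  have e1 := cos2Dsin2 (u s); have e2 := cos2Dsin2 s; have e3 := cos2Dsin2 t.
  have e4 := tanu; rewrite /Z.
  move: (sin (u s)) (cos (u s)) (sin s) (cos s) (sin t) (cos t) e1 e2 e3 e4.
  move=> x y a' b c d e1 e2 e3 e4.
  transitivity ((y ^+ 2 + x ^+ 2) * ((d * a') ^+ 2 + b ^+ 2) - (x * b - y * (d * a')) ^+ 2).
    by ring.
  rewrite e1 e4 subrr expr0n subr0 mul1r.
  have -> : b ^+ 2 = 1 - a' ^+ 2 by rewrite -e2; ring.
  have -> : (- c * a') ^+ 2 = (1 - d ^+ 2) * a' ^+ 2 by rewrite -e3; ring.
  by ring.
have hW : W s = rot01 (asin (W s i1 i0)).
  apply: SO3_fix_rot => //; have [_ [e1 e2 e3]] := GE s.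
  - rewrite /W (mulmx3E (rot02 _)) !(mulmx3E (rot12 (- u s)) (G s))
    e1 e2 e3 !mxE /= ?(cosN, sinN) sinv -ZE /Z; ring.
  - rewrite /W (mulmx3E (rot02 _)) !(mulmx3E (rot12 (- u s)) (G s))
    e1 e2 e3 !mxE /= ?(cosN, sinN).
    transitivity (sin (u s) * cos s - cos (u s) * (cos t * sin s)); first ring.
    by rewrite tanu subrr.
  - rewrite /W (mulmx3E (rot02 _)) !(mulmx3E (rot12 (- u s)) (G s))
    e1 e2 e3 !mxE /= ?(cosN, sinN).
    transitivity (- sin (v s) * (sin t * sin s) + cos (v s) * Z); first by rewrite /Z; ring.
    by rewrite ZE -(cos2Dsin2 (v s)) sinv; ring.
rewrite -hW /W !mulmxA -(mulmxA (rot12 _)) -plane_rotD // subrr plane_rot0 // mulmx1.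
by rewrite -plane_rotD // subrr plane_rot0 // mul1mx.
Unshelve. all: by end_near.
Qed.

End Euler.

(** * Differentiability of a representation along plane rotations *)

Section RepRot.
Variables (R : realType) (m d : nat) (rho : 'M[R]_m -> 'M[R[i]]_d).
Hypothesis hrho : SO_representation rho.
Local Open Scope classical_set_scope.
Local Open Scope ring_scope.
Local Open Scope complex_scope.
Local Notation C := R[i].
Local Notation rot p q t := (@plane_rot R m (p : 'I_m) (q : 'I_m) t).
Implicit Types (p q r u v : 'I_m) (s t : R).

Let rho1 : rho 1%:M = 1%:M. Proof. by case: hrho. Qed.

Lemma rep_rotM p q u v s t : p != q -> u != v ->
  rho (rot p q s *m rot u v t) = rho (rot p q s) *m rho (rot u v t).
Proof. by move=> pq uv; case: hrho => _ rhoM _; apply: rhoM; exact: plane_rot_SO. Qed.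

Lemma rep_rotD p q s t : p != q -> rho (rot p q (s + t)) = rho (rot p q s) *m rho (rot p q t).
Proof. by move=> pq; rewrite /= plane_rotD // rep_rotM. Qed.

Lemma rep_rot0 p q : p != q -> rho (rot p q 0) = 1%:M.
Proof. by move=> pq; rewrite /= plane_rot0. Qed.

Lemma rep_rotV p q t : p != q -> rho (rot p q t) *m rho (rot p q (- t)) = 1%:M.
Proof. by move=> pq; rewrite -rep_rotD // subrr rep_rot0. Qed.

(** Neighbourhoods of a matrix are given entrywise, so the continuity of finitely many entries
    suffices. *)
Lemma plane_rot_cvg p q s : plane_rot m p q x @[x --> s] --> plane_rot m p q s.
Proof.
move=> A [P hP sPA]; rewrite /nbhs /=.
have H i j : \forall x \near s, P i j (rot p q x i j).
  have : (fun x => rot p q x i j) @ s --> rot p q s i j.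
    rewrite (_ : (fun x => _) = fun x =>
      if (i == p :> nat) && (j == p :> nat) then cos x
      else if (i == q :> nat) && (j == q :> nat) then cos x
      else if (i == p :> nat) && (j == q :> nat) then - sin x
      else if (i == q :> nat) && (j == p :> nat) then sin x
      else (i == j)%:R); last by apply/funext => x; rewrite mxE.
    rewrite mxE; case: ifP => _; first exact: continuous_cos.
    case: ifP => _; first exact: continuous_cos.
    case: ifP => _; first by apply: cvgN; exact: continuous_sin.
    by case: ifP => _; [exact: continuous_sin|exact: cvg_cst].
  by apply; exact: hP.
have H1 i : \forall x \near s, forall j, P i j (rot p q x i j).
  by apply: (@filter_forall _ _ (fun j x => P i j (rot p q x i j)) (nbhs s) (nbhs_filter s)); exact: H.
have H2 : \forall x \near s, forall i j, P i j (rot p q x i j).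
  by apply: (@filter_forall _ _ (fun i x => forall j, P i j (rot p q x i j)) (nbhs s) (nbhs_filter s)); exact: H1.
by apply: filterS H2 => x hx; apply: sPA => i j; exact: hx.
Qed.

(** Continuity of [rho] is assumed within SO(m), and the curve of rotations stays inside it. *)
Lemma rep_rot_ccont p q i j : p != q -> ccont (fun s => rho (rot p q s) i j).
Proof.
move=> pq; case: hrho => _ _ /(_ i j)[c1 c2].
have H (f : 'M[R]_m -> R) : {within special_orthogonal R m, continuous f} ->
    continuous (fun s => f (rot p q s)).
  move=> /subspace_continuousP cf s.
  apply: (cvg_comp _ _ _ (cf _ (plane_rot_SO s pq))).
  move=> A; rewrite /within /= => hA.
  have hB : nbhs s [set x | special_orthogonal R m (rot p q x) -> A (rot p q x)] :=
    @plane_rot_cvg p q s _ hA.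
  apply: filterS hB => x /=; apply.
  exact: plane_rot_SO.
by split; [exact: (H (fun A => complex.Re (rho A i j)))|exact: (H (fun A => complex.Im (rho A i j)))].
Qed.

(** Continuity turns into smoothness here: a plane rotation group is a circle, so rho restricted to
    it is conjugate to a diagonal matrix of exponentials. The value 0 for p = q lets later sums run
    over all pairs. *)
Lemma rep_rot_gen p q : exists X : 'M[C]_d, (p = q -> X = 0) /\
  (p != q -> forall (f : R -> R) (x df : R), is_derive x 1 f df ->
     mderiv (fun s => rho (rot p q (f s))) x (df%:C *: (X *m rho (rot p q (f x))))).
Proof.
have [->|pq] := eqVneq p q; first by exists 0.
have [||i|i a b|P Pu [mu hmu]] := @torus_diag R 1 d (fun y : 'I_1 -> R => rho (rot p q (y ord0))).
- by move=> y y'; rewrite rep_rotD.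
- by rewrite rep_rot0.
- rewrite /= (ord1 i) eqxx plane_rotE // mulr_natl cos2pi sin2pi subrr !scale0r !addr0.
  exact: rho1.
- by rewrite (ord1 i) eqxx; exact: rep_rot_ccont.
have E s : rho (rot p q s) =
    invmx P *m diag_mx (\row_a expi ((mu a ord0)%:~R * s)) *m P.
  rewrite -mulmxA; have := hmu (fun=> s) => /= h.
  rewrite -[LHS](mulKmx Pu) h; congr (_ *m (diag_mx _ *m _)).
  by apply/rowP => a; rewrite !mxE big_ord1.
exists (invmx P *m diag_mx (\row_a ('i * ((mu a ord0)%:~R)%:C)) *m P); split.
  by move=> pq'; rewrite pq' eqxx in pq.
move=> _ f x df hf.
rewrite (_ : (fun s => _) = (fun s =>
    invmx P *m diag_mx (\row_a expi ((mu a ord0)%:~R * f s)) *m P)); last first.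
  by apply/funext => s; rewrite E.
have := mderivMr P (mderivMl (invmx P) (mderiv_diag (fun a => (mu a ord0)%:~R) hf)).
by rewrite E !mulmxA mulmxK // -scalemxAr -scalemxAl !mulmxA.
Qed.

End RepRot.

(** * Generation of SO(m) by plane rotations *)

Section SOGeneration.
Variables (R : realType) (m : nat).
Local Notation rot p q t := (@plane_rot R m (p : 'I_m) (q : 'I_m) t).

Lemma circle_angle (a b : R) : a ^+ 2 + b ^+ 2 = 1 -> exists t, cos t = a /\ sin t = b.
Proof.
move=> ab.
have a1 : -1 <= a <= 1.
  by rewrite -ler_norml -(ler_pXn2r (n := 2)) ?nnegrE ?normr_ge0 ?ler01 // expr1n real_normK
    ?num_real // -ab lerDl sqr_ge0.
have sE : sin (acos a) = `|b| by rewrite sin_acos // -ab addrAC subrr add0r sqrtr_sqr.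
have [b0|b0] := leP 0 b.
  by exists (acos a); rewrite acosK // sE ger0_norm.
by exists (- acos a); rewrite cosN sinN acosK // sE ltr0_norm // opprK.
Qed.

Lemma plane_rot_mul_row (p q : 'I_m) t (A : 'M[R]_m) i j : p != q ->
  (rot p q t *m A) i j = if i == p then cos t * A p j - sin t * A q j
    else if i == q then sin t * A p j + cos t * A q j else A i j.
Proof.
move=> pq; have qp : q != p by rewrite eq_sym.
have D (a b c : 'I_m) : (delta_mx a b *m A) c j = (c == a)%:R * A b j.
  rewrite mxE (bigD1 b) //= big1 => [|k kb]; rewrite !mxE ?eqxx ?andbT ?addr0 //.
  by rewrite (negPf kb) andbF mul0r.
rewrite /= plane_rotE // mulmxDl mulmxDl mul1mx -!scalemxAl mulmxDl mulmxBl.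
have E (X Y Z U V : 'M[R]_m) x y :
    (X + x *: (Y + Z) + y *: (U - V)) i j = X i j + x * (Y i j + Z i j) + y * (U i j - V i j).
  by rewrite !mxE.
rewrite E !D; have [->|ip] := eqVneq i p; first by rewrite (negPf pq) /= ?mulr1n ?mulr0n; ring.
by have [->|iq] := eqVneq i q; rewrite /= ?mulr1n ?mulr0n; ring.
Qed.

Lemma plane_rotK (p q : 'I_m) t (A : 'M[R]_m) : p != q ->
  rot p q (- t) *m (rot p q t *m A) = A.
Proof. by move=> pq; rewrite mulmxA /= -plane_rotD // addNr plane_rot0 // mul1mx. Qed.

Variable Pd : 'M[R]_m -> Prop.
Hypothesis Pd1 : Pd 1%:M.
Hypothesis PdM : forall (p q : 'I_m) t A, p != q -> special_orthogonal R m A -> Pd A ->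
  Pd (rot p q t *m A).

Let PdMV (p q : 'I_m) t A : p != q -> special_orthogonal R m A ->
  Pd (rot p q t *m A) -> Pd A.
Proof.
move=> pq hA h; rewrite -(plane_rotK t A pq); apply: PdM => //.
by apply: special_orthogonalM => //; exact: plane_rot_SO.
Qed.

(** Elimination by plane rotations. The outer induction counts the columns not yet made equal to
    those of the identity, the inner one the nonzero entries below the pivot. *)
Lemma SO_plane_rot_ind A : special_orthogonal R m A -> Pd A.
Proof.
suff H k (B : 'M[R]_m) : (k <= m)%N -> special_orthogonal R m B ->
    (forall i j : 'I_m, (j < m - k)%N -> B i j = (i == j)%:R) -> Pd B.
  by move=> hA; apply: (H m) => // i j; rewrite subnn.
elim: k B => [|k IH] B km hB hcol.
  suff -> : B = 1%:M by [].
  by apply/matrixP => i j; rewrite hcol ?subn0 // mxE.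
have cm : (m - k.+1 < m)%N by rewrite ltn_subrL (leq_trans _ km).
pose c := Ordinal cm.
(* Orthogonality to the finished columns clears the entries above the pivot. *)
have col_lt (B' : 'M[R]_m) : special_orthogonal R m B' ->
    (forall i j : 'I_m, (j < c)%N -> B' i j = (i == j)%:R) ->
    forall j : 'I_m, (j < c)%N -> B' j c = 0.
  move=> [hB1 _] hc j jc; have /matrixP/(_ j c) := mulmx1C hB1.
  rewrite !mxE (bigD1 j) //= big1 => [|i ij].
    rewrite addr0 mxE hc // eqxx mul1r => ->.
    by rewrite -val_eqE /= ltn_eqF.
  by rewrite mxE hc // (negPf ij) mul0r.
pose N (B' : 'M[R]_m) := #|[pred r : 'I_m | (c < r)%N && (B' r c != 0)]|.
have [n] := ubnP (N B); elim: n B hB hcol => // n IHn B hB hcol.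
have hcol' : forall i j : 'I_m, (j < c)%N -> B i j = (i == j)%:R by [].
have step (B' : 'M[R]_m) : special_orthogonal R m B' ->
    (forall i j : 'I_m, (j < c)%N -> B' i j = (i == j)%:R) ->
    (forall r : 'I_m, (c < r)%N -> B' r c = 0) -> B' c c = 1 -> Pd B'.
  move=> hB' hc' h1 h2; apply: IH => [||i j hj] //; first exact: ltnW.
  have [jc|cj|jc] := ltngtP j c; first exact: hc'.
    by move: hj; rewrite -[(m - k)%N]subSS subSn // ltnS leqNgt cj.
  have -> : j = c by exact: val_inj.
  have [ic|ci|ic] := ltngtP i c.
  - by rewrite (col_lt _ hB' hc') // -val_eqE /= ltn_eqF.
  - by rewrite h1 // -val_eqE /= gtn_eqF.
  - by have -> : i = c by [apply: val_inj]; rewrite eqxx.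
rewrite ltnS => hN; have [/eqP N0|Npos] := posnP (N B).
  have zero (r : 'I_m) : (c < r)%N -> B r c = 0.
    move=> cr; apply/eqP/negPn/negP => Br.
    by have /card0_eq/(_ r) := eqP N0; rewrite !inE cr Br.
  have Bcc : (B c c) ^+ 2 = 1.
    have [hB1 _] := hB; have /matrixP/(_ c c) := mulmx1C hB1.
    rewrite !mxE eqxx (bigD1 c) //= big1 ?addr0 => [|i ic]; first by rewrite mxE expr2.
    rewrite mxE; have [lt|gt|e] := ltngtP i c.
    - by rewrite (col_lt _ hB hcol') // mul0r.
    - by rewrite zero // mul0r.
    - by rewrite (val_inj e) eqxx in ic.
  move/eqP: Bcc; rewrite sqrf_eq1 => /orP[/eqP Bcc|/eqP Bcc]; first exact: step.
  (* A pivot -1 in the last column would give determinant -1; elsewhere a rotation by pi in the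
     plane of the pivot and the next coordinate turns it into 1. *)
  have [lastc|notlast] := eqVneq c.+1 m.
    have [_ dB] := hB; exfalso.
    have BE : B = diag_mx (\row_j (if j == c then -1 else 1)).
      apply/matrixP => i j; rewrite !mxE; have [jc|cj|jc] := ltngtP j c.
      - have jnc : (j == c) = false by rewrite -val_eqE /= ltn_eqF.
        by rewrite hcol //; have [->|] := eqVneq i j; rewrite ?jnc ?mulr1n ?mulr0n.
      - by move: cj; rewrite ltnNge -ltnS lastc ltn_ord.
      - have -> : j = c by exact: val_inj.
        have [ic|ci|ic] := ltngtP i c.
        + have inc : (i == c) = false by rewrite -val_eqE /= ltn_eqF.
          by rewrite (col_lt _ hB hcol') // inc mulr0n.
        + by move: ci; rewrite ltnNge -ltnS lastc ltn_ord.
        + by have -> : i = c by [exact: val_inj]; rewrite eqxx Bcc mulr1n.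
    move: dB; rewrite BE det_diag (bigD1 c) //= big1 => [|i ic]; rewrite mxE ?eqxx ?(negPf ic) //.
    by rewrite mulr1; move/eqP; rewrite eq_sym -addr_eq0 -mulr2n pnatr_eq0.
  have c1m : (c.+1 < m)%N by rewrite ltn_neqAle notlast ltn_ord.
  pose r := Ordinal c1m.
  have cr : c != r by rewrite -val_eqE /= neq_ltn ltnSn.
  have rc : r != c by rewrite eq_sym.
  apply: (PdMV (p := c) (q := r) (t := pi)) => //; apply: step.
  - by apply: special_orthogonalM => //; exact: plane_rot_SO.
  - move=> i j jc; rewrite plane_rot_mul_row // cospi sinpi !hcol // !mul0r subr0 add0r.
    have jnc : (c == j) = false by rewrite -val_eqE /= gtn_eqF.
    have jnr : (r == j) = false by rewrite -val_eqE /= gtn_eqF // ltnW.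
    by case: eqP => [->|_]; [rewrite jnc mulr0|case: eqP => [->|_]; rewrite // jnr mulr0].
  - move=> i ci; have inc : (i == c) = false by rewrite -val_eqE /= gtn_eqF.
    rewrite plane_rot_mul_row // inc sinpi mul0r add0r.
    by case: eqP => [_|_]; rewrite zero ?mulr0 //=.
  - by rewrite plane_rot_mul_row // eqxx cospi sinpi mul0r subr0 Bcc mulrNN mulr1.
have /card_gt0P[r] := Npos.
rewrite inE => /andP[cr Br].
have cr' : c != r by rewrite -val_eqE /= ltn_eqF.
pose w := Num.sqrt (B c c ^+ 2 + B r c ^+ 2).
have w0 : 0 < B c c ^+ 2 + B r c ^+ 2.
  by rewrite ltr_wpDl ?sqr_ge0 // lt_def sqr_ge0 sqrf_eq0 Br.
have wn0 : w != 0 by rewrite sqrtr_eq0 -ltNge.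
have w2 : w ^+ 2 = B c c ^+ 2 + B r c ^+ 2 by rewrite sqr_sqrtr // ltW.
(* This angle makes the new entry in row [r] equal to sin t B_cc + cos t B_rc = 0. *)
have [t [ct st]] : exists t, cos t = B c c / w /\ sin t = - (B r c / w).
  by apply: circle_angle; rewrite sqrrN !exprMn -mulrDl -w2 -exprMn mulfV ?expr1n.
apply: (PdMV (p := c) (q := r) (t := t)) => //; apply: IHn.
- by apply: special_orthogonalM => //; exact: plane_rot_SO.
- move=> i j jc; rewrite plane_rot_mul_row // !hcol //.
  have jnc : (c == j) = false by rewrite -val_eqE /= gtn_eqF.
  have jnr : (r == j) = false by rewrite -val_eqE /= gtn_eqF // (ltn_trans jc).
  case: eqP => [->|_]; first by rewrite jnc jnr !mulr0 subr0.
  by case: eqP => [->|_]; rewrite // jnc jnr !mulr0 addr0.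
apply: leq_trans hN; apply: proper_card; apply/properP; split.
  apply/fintype.subsetP => i; rewrite !inE => /andP[ci]; rewrite ci plane_rot_mul_row //.
  have -> : (i == c) = false by rewrite -val_eqE /= gtn_eqF.
  by have [->|_] := eqVneq i r; rewrite ?Br.
have rc : (r == c) = false by rewrite eq_sym (negPf cr').
exists r; rewrite !inE ?cr ?Br // plane_rot_mul_row // rc eqxx.
rewrite ct st (_ : _ + _ = 0) ?eqxx //; ring.
Qed.

End SOGeneration.

(** * Infinitesimal rotations and the Casimir element *)

Section MderivMore.
Variable R : realType.
Local Notation C := R[i].
Local Open Scope classical_set_scope.
Local Open Scope ring_scope.

Lemma mderivD m n (F G : R -> 'M[C]_(m, n)) x D D' :
  mderiv F x D -> mderiv G x D' -> mderiv (fun s => F s + G s) x (D + D').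
Proof.
move=> hF hG i j; rewrite mxE.
by apply: cderiv_ext (cderivD (hF i j) (hG i j)) => s; rewrite mxE.
Qed.

Lemma mderivZ m n (f : R -> C) (A : 'M[C]_(m, n)) x c :
  cderiv f x c -> mderiv (fun s => f s *: A) x (c *: A).
Proof.
move=> hf i j; rewrite mxE; have := cderivM hf (cderiv_cst (A i j) x).
by rewrite mulr0 addr0; apply: cderiv_ext => s; rewrite mxE.
Qed.

Lemma mderiv_near m n (F G : R -> 'M[C]_(m, n)) x D :
  (\forall s \near x, F s = G s) -> mderiv F x D -> mderiv G x D.
Proof.
move=> FG hF i j; have [h1 h2] := hF i j; split.
  by apply: near_eq_is_derive h1; apply: filterS FG => s ->.
by apply: near_eq_is_derive h2; apply: filterS FG => s ->.
Qed.

Lemma mderiv_ext m n (F G : R -> 'M[C]_(m, n)) x D :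
  (forall s, F s = G s) -> mderiv F x D -> mderiv G x D.
Proof. by move=> /funext ->. Qed.

End MderivMore.

(** * Commutation rules of the infinitesimal rotations *)

Section Generators.
Variables (R : realType) (m d : nat) (rho : 'M[R]_m -> 'M[R[i]]_d).
Hypothesis hrho : SO_representation rho.
Local Open Scope complex_scope.
Local Notation C := R[i].
Local Notation rot p q t := (@plane_rot R m (p : 'I_m) (q : 'I_m) t).
Implicit Types (p q r u v : 'I_m) (s t : R).

(** [X p q] is the derivative of rho along the rotations in the plane p, q. The condition is stated
    along an arbitrary [f] because the Euler angles move with variable speed. *)
Definition infinitesimal_rotations (X : 'I_m -> 'I_m -> 'M[C]_d) :=
  (forall p, X p p = 0) /\
  (forall p q, p != q -> forall (f : R -> R) (x df : R), is_derive x 1 f df ->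
     mderiv (fun s => rho (rot p q (f s))) x (df%:C *: (X p q *m rho (rot p q (f x))))).

Lemma infinitesimal_rotations_exist : exists X, infinitesimal_rotations X.
Proof.
have /choice[X hX] := fun pq : 'I_m * 'I_m => rep_rot_gen hrho pq.1 pq.2.
exists (fun p q => X (p, q)); split => [p|p q]; first exact: (hX (p, p)).1.
exact: (hX (p, q)).2.
Qed.

Variable X : 'I_m -> 'I_m -> 'M[C]_d.
Hypothesis hX : infinitesimal_rotations X.

Lemma gen_pp p : X p p = 0. Proof. exact: hX.1. Qed.

Lemma gen_deriv0 p q (f : R -> R) (df : R) : p != q -> f 0 = 0 ->
  is_derive (0 : R) 1 f df -> mderiv (fun s => rho (rot p q (f s))) 0 (df%:C *: X p q).
Proof.
by move=> pq f0 /(hX.2 _ _ pq); rewrite f0 plane_rot0 //; case: hrho => -> _ _; rewrite mulmx1.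
Qed.

Lemma gen_deriv p q : p != q -> mderiv (fun s => rho (rot p q s)) 0 (X p q).
Proof.
by move=> pq; have := gen_deriv0 pq (erefl : id 0 = 0) (is_derive_id _ _); rewrite scale1r.
Qed.

Lemma gen_sym p q : X q p = - X p q.
Proof.
have [->|pq] := eqVneq p q; first by rewrite gen_pp oppr0.
apply: (mderiv_unique (F := fun s => rho (rot q p s)) (x := 0)).
  by apply: gen_deriv; rewrite eq_sym.
rewrite (_ : (fun s => _) = (fun s => rho (rot p q (- s)))); last first.
  by apply/funext => s; rewrite plane_rotC.
have := gen_deriv0 pq (oppr0 R) (is_deriveNid _ _).
by rewrite rmorphN1 scaleN1r.
Qed.

(** Up to the factor [rho (rot p q t)], the two sides are the derivatives at 0 of the two
    expressions in [conj_rot_euler]; the third Euler angle has speed 0 and drops out. *)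
Lemma gen_conj p q r t : p != q -> q != r -> p != r ->
  rho (rot p q t) *m X q r = ((cos t)%:C *: X q r - (sin t)%:C *: X p r) *m rho (rot p q t).
Proof.
move=> pq qr pr.
pose io (i : 'I_3) := if val i == 0%N then p else if val i == 1%N then q else r.
have io_inj : injective io.
  move=> [[|[|[|//]]] hi] [[|[|[|//]]] hj] //= E; rewrite /io /= in E; first [exact: val_inj |
    by move: pq qr pr; rewrite ?E ?eqxx].
have [u [v [w [du dv dw [u0 v0 w0] hG]]]] := conj_rot_euler t.
have dL : mderiv (fun s => rho (rot p q t) *m rho (rot q r s) *m rho (rot p q (- t))) 0
    (rho (rot p q t) *m X q r *m rho (rot p q (- t))).
  by apply: mderivMr; apply: mderivMl; exact: gen_deriv.
have dR : mderiv (fun s => rho (rot q r (u s)) *m rho (rot p r (v s)) *m rho (rot p q (w s))) 0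
    ((cos t)%:C *: X q r - (sin t)%:C *: X p r).
  have := mderivM (mderivM (gen_deriv0 qr u0 du) (gen_deriv0 pr v0 dv)) (gen_deriv0 pq w0 dw).
  rewrite u0 v0 w0 !plane_rot0 //; case: hrho => -> _ _.
  by rewrite !mulmx1 !mul1mx scale0r addr0 rmorphN scaleNr.
have E : rho (rot p q t) *m X q r *m rho (rot p q (- t)) =
    (cos t)%:C *: X q r - (sin t)%:C *: X p r.
  apply: mderiv_unique dL _; apply: (mderiv_near _ dR); apply: (@filterS _ (nbhs (0 : R)) _ _ _ _ hG) => s hs.
  have := congr1 (mx_embed io) hs; rewrite !mx_embedM // !mx_embed_rot // /io /= => hs'.
  have SO a b x : a != b -> special_orthogonal R m (rot a b x) by exact: plane_rot_SO.
  by case: hrho => _ rhoM _; rewrite -!rhoM ?hs' //; do ?apply: special_orthogonalM; exact: SO.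
rewrite -E -mulmxA; have := rep_rotV hrho (- t) pq; rewrite opprK => ->.
by rewrite mulmx1.
Qed.

(** This is the derivative of [gen_conj] at t = 0. *)
Lemma gen_bracket p q r : p != q -> q != r -> p != r ->
  X p q *m X q r - X q r *m X p q = - X p r.
Proof.
move=> pq qr pr.
have dL : mderiv (fun s => rho (rot p q s) *m X q r) 0 (X p q *m X q r).
  by apply: mderivMr; exact: gen_deriv.
have dR : mderiv (fun s => ((cos s)%:C *: X q r + (- sin s)%:C *: X p r) *m rho (rot p q s)) 0
    (- X p r + X q r *m X p q).
  have dc : is_derive (0 : R) 1 (@cos R) 0.
    by apply: (is_derive_eq (is_derive_cos _)); rewrite sin0 oppr0.
  have ds : is_derive (0 : R) 1 (fun s : R => - sin s) (- 1).
    by apply: (is_derive_eq (is_deriveN (is_derive_sin _))); rewrite cos0.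
  have := mderivM (mderivD (mderivZ (X q r) (cderiv_real dc)) (mderivZ (X p r) (cderiv_real ds)))
    (gen_deriv pq).
  rewrite sin0 cos0 oppr0 !(scale0r, scale1r, add0r, addr0) plane_rot0 //; case: hrho => -> _ _.
  by rewrite mulmx1 rmorphN1 scaleN1r.
have : X p q *m X q r = - X p r + X q r *m X p q.
  apply: mderiv_unique dL _; apply: (mderiv_ext _ dR) => s.
  by rewrite gen_conj // rmorphN scaleNr.
by move=> ->; rewrite addrK.
Qed.

Lemma gen_comm p q u v t : p != q -> u != v -> p != u -> p != v -> q != u -> q != v ->
  rho (rot p q t) *m X u v = X u v *m rho (rot p q t).
Proof.
move=> pq uv pu pv qu qv.
have dL := mderivMl (rho (rot p q t)) (gen_deriv uv).
have dR := mderivMr (rho (rot p q t)) (gen_deriv uv).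
apply: mderiv_unique dL _; apply: (mderiv_ext _ dR) => s.
by rewrite -!(rep_rotM hrho) // plane_rot_commute // eq_sym.
Qed.

Lemma gen_comm_self p q t : rho (rot p q t) *m X p q = X p q *m rho (rot p q t).
Proof.
have [->|pq] := eqVneq p q; first by rewrite gen_pp mulmx0 mul0mx.
have dL := mderivMl (rho (rot p q t)) (gen_deriv pq).
have dR := mderivMr (rho (rot p q t)) (gen_deriv pq).
apply: mderiv_unique dL _; apply: (mderiv_ext _ dR) => s.
by rewrite -!(rep_rotM hrho) // -!plane_rotD // addrC.
Qed.

Section Rotated.
Variables (p q : 'I_m) (t : R).
Hypothesis pq : p != q.
Let qp : q != p. Proof. by rewrite eq_sym. Qed.

(** The orthogonal change of index in the plane p, q by which conjugation acts on each of the two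
    indices of [X]. *)
Definition rotated_family (Z : 'I_m -> 'M[C]_d) (u : 'I_m) : 'M[C]_d :=
  if u == p then (cos t)%:C *: Z p + (sin t)%:C *: Z q
  else if u == q then (cos t)%:C *: Z q - (sin t)%:C *: Z p else Z u.

(** The entries p and q are mixed by an orthogonal matrix, so the cross terms cancel. *)
Lemma rotated_family_sq (Z : 'I_m -> 'M[C]_d) :
  \sum_u rotated_family Z u *m rotated_family Z u = \sum_u Z u *m Z u.
Proof.
rewrite [LHS](bigD1 p) // [RHS](bigD1 p) //= [in LHS](bigD1 q) // [in RHS](bigD1 q) //=.
rewrite !addrA; congr (_ + _); last first.
  by apply: eq_bigr => u /andP[up uq]; rewrite /rotated_family (negPf up) (negPf uq).
rewrite /rotated_family eqxx (negPf qp) eqxx.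
have cs : (cos t)%:C ^+ 2 + (sin t)%:C ^+ 2 = 1 :> C by rewrite -!rmorphXn -rmorphD /= cos2Dsin2.
move: (cos t)%:C (sin t)%:C cs (Z p) (Z q) => c s cs A B.
rewrite !(mulmxDl, mulmxDr) ?(mulmxN, mulNmx) -!scalemxAl -!scalemxAr !scalerA.
move: (A *m A) (B *m B) (A *m B) (B *m A) => AA BB AB BA.
transitivity ((c ^+ 2 + s ^+ 2) *: AA + (c ^+ 2 + s ^+ 2) *: BB); last by rewrite cs !scale1r.
by apply/matrixP => i j; rewrite !mxE; ring.
Qed.

(** [X] transforms as an antisymmetric 2-tensor: both indices rotate. The cases sort each index into
    p, q and the rest. *)
Lemma gen_rotated u v : rho (rot p q t) *m X u v =
  rotated_family (fun a => rotated_family (X a) v) u *m rho (rot p q t).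
Proof.
have Hp v' : p != v' -> q != v' -> rho (rot p q t) *m X p v' =
    ((cos t)%:C *: X p v' + (sin t)%:C *: X q v') *m rho (rot p q t).
  move=> pv qv; have := @gen_conj q p v' (- t) qp pv qv.
  by rewrite plane_rotC // opprK cosN sinN rmorphN scaleNr opprK.
have Hq v' : p != v' -> q != v' -> rho (rot p q t) *m X q v' =
    ((cos t)%:C *: X q v' - (sin t)%:C *: X p v') *m rho (rot p q t).
  by move=> pv qv; exact: gen_conj.
have cs : (cos t)%:C ^+ 2 + (sin t)%:C ^+ 2 = 1 :> C by rewrite -!rmorphXn -rmorphD /= cos2Dsin2.
have pnq : (p == q) = false by exact: negPf.
have qnp : (q == p) = false by exact: negPf.
rewrite /rotated_family.
have [->|up] := eqVneq u p; [|have [->|uq] := eqVneq u q];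
  (have [->|vp] := eqVneq v p; [|have [->|vq] := eqVneq v q]).
- rewrite gen_pp mulmx0 !gen_pp (gen_sym p q) -[RHS]/(_ *m _).
  rewrite [X in X *m _](_ : _ = 0) ?mul0mx //.
  by move: (X p q) => A; apply/matrixP => i j; rewrite !mxE; ring.
- rewrite !gen_pp (gen_sym p q) gen_comm_self; congr (_ *m _).
  rewrite -[LHS]scale1r -cs; move: (X p q) => A; apply/matrixP => i j; rewrite !mxE; ring.
- by rewrite Hp // eq_sym.
- rewrite !gen_pp (gen_sym p q) mulmxN gen_comm_self -mulNmx; congr (_ *m _).
  rewrite -[LHS]scale1r -cs; move: (X p q) => A; apply/matrixP => i j; rewrite !mxE; ring.
- rewrite gen_pp mulmx0 !gen_pp (gen_sym p q).
  rewrite [X in X *m _](_ : _ = 0) ?mul0mx //.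
  by move: (X p q) => A; apply/matrixP => i j; rewrite !mxE; ring.
- by rewrite Hq // eq_sym.
- rewrite (gen_sym p u) mulmxN Hp 1?eq_sym // -mulNmx; congr (_ *m _).
  by rewrite (gen_sym q u) opprD !scalerN.
- rewrite (gen_sym q u) mulmxN Hq 1?eq_sym // -mulNmx; congr (_ *m _).
  by rewrite (gen_sym p u) opprD !scalerN.
- have [->|uv] := eqVneq u v; first by rewrite gen_pp mulmx0 mul0mx.
  by rewrite gen_comm // 1?eq_sym.
Qed.

End Rotated.

(** The sum runs over ordered pairs, so each plane is counted twice; this explains the factors 2 and
    the constant c / 2 below. *)
Definition casimir : 'M[C]_d := \sum_u \sum_v X u v *m X u v.

Lemma casimir_rot p q t : p != q ->
  rho (rot p q t) *m casimir = casimir *m rho (rot p q t).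
Proof.
move=> pq; rewrite /casimir.
have -> : \sum_u \sum_v X u v *m X u v =
    \sum_u \sum_v (rotated_family p q t (fun a => rotated_family p q t (X a) v) u *m
                   rotated_family p q t (fun a => rotated_family p q t (X a) v) u).
  rewrite [RHS]exchange_big /=.
  under [RHS]eq_bigr => v _ do rewrite (rotated_family_sq t pq (fun a => rotated_family p q t (X a) v)).
  rewrite [RHS]exchange_big /=; apply: eq_bigr => u _.
  by rewrite (rotated_family_sq t pq (X u)).
rewrite {1}(_ : \sum_u \sum_v _ = \sum_u \sum_v X u v *m X u v); last first.
  rewrite exchange_big /=.
  under eq_bigr => v _ do rewrite (rotated_family_sq t pq (fun a => rotated_family p q t (X a) v)).
  rewrite exchange_big /=; apply: eq_bigr => u _.
  by rewrite (rotated_family_sq t pq (X u)).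
rewrite mulmx_sumr mulmx_suml; apply: eq_bigr => u _.
rewrite mulmx_sumr mulmx_suml; apply: eq_bigr => v _.
by rewrite mulmxA gen_rotated // -mulmxA gen_rotated // mulmxA.
Qed.

(** Schur's lemma: by generation this element commutes with all of SO(m), so an eigenspace is a
    nonzero stable subspace and hence everything. *)
Lemma casimir_scalar : SO_irreducible rho -> exists c : C, casimir = c%:M.
Proof.
move=> [d0 irr].
have cas_comm A : special_orthogonal R m A -> rho A *m casimir = casimir *m rho A.
  move: A; apply: SO_plane_rot_ind => [|p q t A pq hA IH].
    by case: hrho => -> _ _; rewrite mul1mx mulmx1.
  case: hrho => _ rhoM _; rewrite rhoM //; last exact: plane_rot_SO.
  by rewrite -mulmxA IH !mulmxA casimir_rot.
have [c hc] : exists c, eigenvalue casimir c.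
  have : size (char_poly casimir) != 1%N by rewrite size_char_poly; case: (d) d0.
  by case/closed_rootP => c; rewrite -eigenvalue_root_char => ?; exists c.
exists c; have /irr : forall A, special_orthogonal R m A ->
    stablemx (eigenspace casimir c) (rho A).
  move=> A /cas_comm hA; case: (d) casimir (rho A) hA => [|d'] E Q hA.
    by rewrite thinmx0 sub0mx.
  by apply: comm_mx_stable_eigenspace; rewrite /comm_mx.
move=> /(_ hc) full; apply/eqP; rewrite -subr_eq0.
have /sub_kermxP : (1%:M <= eigenspace casimir c)%MS by rewrite sub1mx.
by rewrite mul1mx => ->.
Qed.

End Generators.

Section TraceLemma.
Variables (C : comPzRingType) (d : nat).

(* Cyclicity of the trace turns conjugation by [T] into a relation between the
   quadratic traces and the trace of the commutator. *)
Lemma mxtrace_rotated_pair (Y Z T : 'M[C]_d) (c s : C) :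
  T *m Y = (c *: Y + s *: Z) *m T -> T *m Z = (c *: Z - s *: Y) *m T ->
  (1 - c) * \tr ((Y *m Y + Z *m Z) *m T) = s * \tr ((Y *m Z - Z *m Y) *m T).
Proof.
move=> hY hZ.
have cyc A B : \tr (A *m B *m T) = \tr (B *m (T *m A)).
  by rewrite -mulmxA mxtrace_mulC mulmxA.
have eYY : \tr (Y *m Y *m T) = c * \tr (Y *m Y *m T) + s * \tr (Y *m Z *m T).
  rewrite {1}cyc hY mulmxDl mulmxDr -!scalemxAl -!scalemxAr linearD !linearZ /=.
  by rewrite !mulmxA.
have eZZ : \tr (Z *m Z *m T) = c * \tr (Z *m Z *m T) - s * \tr (Z *m Y *m T).
  rewrite {1}cyc hZ mulmxBl mulmxBr -!scalemxAl -!scalemxAr linearB !linearZ /=.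
  by rewrite !mulmxA.
rewrite mulmxDl mulmxBl linearD linearB /=.
rewrite mulrBl mul1r mulrDr {1}eYY {1}eZZ.
move: (\tr (Y *m Y *m T)) (\tr (Z *m Z *m T)) (\tr (Y *m Z *m T)) (\tr (Z *m Y *m T)) => a b e f.
by ring.
Qed.

End TraceLemma.

(** * The maximal torus and its coordinate planes *)

Section Torus.
Variables (R : realType) (n : nat).
Local Notation m := n.*2.+1.

(** [pl0 k] and [pl1 k] span the k-th plane of the torus; [pl2] is the axis that the torus fixes. *)
Definition pl0 (k : 'I_n) : 'I_m := inord k.*2.
Definition pl1 (k : 'I_n) : 'I_m := inord k.*2.+1.
Definition pl2 : 'I_m := ord_max.

Lemma pl0E k : pl0 k = k.*2 :> nat.
Proof. by rewrite inordK // ltnS leq_double ltnW. Qed.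

Lemma pl1E k : pl1 k = k.*2.+1 :> nat.
Proof. by rewrite inordK // ltnS ltn_double. Qed.

Lemma pl_neq k l : [/\ pl0 k != pl1 l, pl0 k != pl2 & pl1 k != pl2].
Proof.
split; rewrite -val_eqE /= ?pl0E ?pl1E.
- by apply/eqP => /(congr1 odd); rewrite /= !odd_double.
- by rewrite ltn_eqF // ltn_double.
- by apply/eqP => /(congr1 odd); rewrite /= !odd_double.
Qed.

Lemma pl0_inj : injective pl0.
Proof. by move=> k l /(congr1 (@nat_of_ord _)); rewrite !pl0E => /double_inj/val_inj. Qed.

Lemma pl1_inj : injective pl1.
Proof. by move=> k l /(congr1 (@nat_of_ord _)); rewrite !pl1E => -[] /double_inj/val_inj. Qed.

Lemma sum_planes (V : nmodType) (f : 'I_m -> V) :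
  \sum_u f u = \sum_k (f (pl0 k) + f (pl1 k)) + f pl2.
Proof.
pose g i := f (inord i).
have -> : \sum_u f u = \sum_(i < n.*2.+1) g i by apply: eq_bigr => i _; rewrite /g inord_val.
have -> : \sum_k (f (pl0 k) + f (pl1 k)) = \sum_(k < n) (g k.*2 + g k.*2.+1) by [].
have -> : f pl2 = g n.*2 by rewrite /g; congr f; apply: val_inj; rewrite /= inordK.
have H N : \sum_(i < N.*2) g i = \sum_(k < N) (g k.*2 + g k.*2.+1).
  elim: N => [|N IH]; first by rewrite !big_ord0.
  by rewrite doubleS !big_ord_recr /= IH addrA.
by rewrite big_ord_recr /= H.
Qed.

Local Notation prot k t := (@plane_rot R m (pl0 k) (pl1 k) t).

Lemma torusE (t : 'I_n -> R) : torus t = \prod_(k < n) prot k (t k).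
Proof. by apply: eq_bigr => k _; rewrite pl0E pl1E. Qed.

Lemma prot_comm k l s t : k != l -> prot k s *m prot l t = prot l t *m prot k s.
Proof.
move=> kl; have [? ? ?] := pl_neq k l; have [? ? ?] := pl_neq l k; have [? _ _] := pl_neq k k.
have [? _ _] := pl_neq l l.
by apply: plane_rot_commute; rewrite ?(inj_eq pl0_inj) ?(inj_eq pl1_inj) // eq_sym.
Qed.

Lemma torusD (s t : 'I_n -> R) : torus (fun k => s k + t k) = torus s *m torus t.
Proof.
rewrite !torusE.
have := index_enum_uniq ('I_n : finType).
elim: (index_enum _) => [_|k r IH /= /andP[kr ur]]; first by rewrite !big_nil mulmx1.
rewrite !big_cons IH // plane_rotD; last by have [] := pl_neq k k.
rewrite -[X in X = _]/(_ *m _ *m (_ *m _)) -[X in _ = X]/((_ *m _) *m (_ *m _)).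
rewrite -!mulmxA; congr (_ *m _); rewrite !mulmxA; congr (_ *m _).
rewrite big_seq; elim/big_ind: _ => [|A B hA hB|l lr]; rewrite ?mulmx1 ?mul1mx //.
  have -> : (A * B)%R = A *m B by [].
  by rewrite mulmxA hA -mulmxA hB mulmxA.
by apply: prot_comm; apply: contraNneq kr => ->.
Qed.

Definition coord_fun (k : 'I_n) (s : R) : 'I_n -> R := fun j => if j == k then s else 0.

Lemma torus_coord k s : torus (coord_fun k s) = prot k s.
Proof.
rewrite torusE.
have H l : l != k -> prot l (coord_fun k s l) = 1.
  by move=> lk; rewrite /coord_fun (negPf lk) plane_rot0 //; have [] := pl_neq l l.
have := index_enum_uniq ('I_n : finType); have := mem_index_enum k.
elim: (index_enum _) => // l r IH; rewrite inE /= => klr /andP[lr ur].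
rewrite big_cons; have [elk|lk] := eqVneq l k.
  rewrite {l}elk in klr lr *.
  rewrite big_seq big1 ?mulr1 /coord_fun ?eqxx // => j jr; apply: H.
  by apply: contraNneq lr => <-.
rewrite H // mul1r; apply: IH => //.
by move: klr; rewrite eq_sym (negPf lk).
Qed.

Lemma torus_SO (t : 'I_n -> R) : special_orthogonal R m (torus t).
Proof.
rewrite torusE; elim/big_ind: _ => [|A B|k _].
- by split; rewrite ?trmx1 ?mulmx1 // det1.
- exact: special_orthogonalM.
- by apply: plane_rot_SO; have [] := pl_neq k k.
Qed.

End Torus.

(** * Weight basis and the radial Casimir equation *)

Section QuarterTurns.
Variables (R : realType).
Local Notation j0 := (@Ordinal 3 0 isT).
Local Notation j1 := (@Ordinal 3 1 isT).
Local Notation j2 := (@Ordinal 3 2 isT).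

Section Embedded.
Variables (m : nat) (a b c : 'I_m).
Hypotheses (ab : a != b) (bc : b != c) (ac : a != c).
Local Notation rot p q t := (@plane_rot R m (p : 'I_m) (q : 'I_m) t).

Let io (i : 'I_3) := if val i == 0%N then a else if val i == 1%N then b else c.
Let io_inj : injective io.
Proof.
move=> [[|[|[|//]]] hi] [[|[|[|//]]] hj] //= E; rewrite /io /= in E; first [exact: val_inj |
  by move: ab bc ac; rewrite ?E ?eqxx].
Qed.

(** Conjugation by a quarter turn carries one coordinate plane to another, and by a half turn it
    reverses one. These identities serve to realise the Weyl group inside SO(2n+1). *)
Lemma quarter_rot_snd s : rot a b (pi / 2) *m rot b c s = rot a c (- s) *m rot a b (pi / 2).
Proof.
have E : plane_rot 3 j0 j1 (pi / 2) *m plane_rot 3 j1 j2 s =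
    plane_rot 3 j0 j2 (- s) *m plane_rot 3 j0 j1 (pi / 2) :> 'M[R]_3.
  apply/matrixP => i j; rewrite !mulmx3E !mxE cos_pihalf sin_pihalf ?(cosN, sinN).
  by case: (ord3P i) => ->; case: (ord3P j) => -> /=; rewrite ?mulr1n ?mulr0n; ring.
by have := congr1 (mx_embed io) E; rewrite !mx_embedM // !mx_embed_rot.
Qed.

Lemma quarter_rot_fst s : rot a b (pi / 2) *m rot a c s = rot b c s *m rot a b (pi / 2).
Proof.
have E : plane_rot 3 j0 j1 (pi / 2) *m plane_rot 3 j0 j2 s =
    plane_rot 3 j1 j2 s *m plane_rot 3 j0 j1 (pi / 2) :> 'M[R]_3.
  apply/matrixP => i j; rewrite !mulmx3E !mxE cos_pihalf sin_pihalf ?(cosN, sinN).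
  by case: (ord3P i) => ->; case: (ord3P j) => -> /=; rewrite ?mulr1n ?mulr0n; ring.
by have := congr1 (mx_embed io) E; rewrite !mx_embedM // !mx_embed_rot.
Qed.

Lemma half_rot s : rot a b pi *m rot a c s = rot a c (- s) *m rot a b pi.
Proof.
have E : plane_rot 3 j0 j1 pi *m plane_rot 3 j0 j2 s =
    plane_rot 3 j0 j2 (- s) *m plane_rot 3 j0 j1 pi :> 'M[R]_3.
  apply/matrixP => i j; rewrite !mulmx3E !mxE cospi sinpi ?(cosN, sinN).
  by case: (ord3P i) => ->; case: (ord3P j) => -> /=; rewrite ?mulr1n ?mulr0n; ring.
by have := congr1 (mx_embed io) E; rewrite !mx_embedM // !mx_embed_rot.
Qed.

End Embedded.
End QuarterTurns.

(** * Weights and their invariance under the Weyl group *)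

Section Weights.
Variables (R : realType) (n d : nat) (rho : 'M[R]_(n.*2.+1) -> 'M[R[i]]_d).
Hypothesis hrho : SO_representation rho.
Local Notation m := n.*2.+1.
Local Notation C := R[i].
Local Notation prot k t := (@plane_rot R m (pl0 k) (pl1 k) t).

Let pl01 k : pl0 (n := n) k != pl1 k. Proof. by have [] := pl_neq k k. Qed.

Lemma rep_torusD (s t : 'I_n -> R) :
  rho (torus (fun k => s k + t k)) = rho (torus s) *m rho (torus t).
Proof. by case: hrho => _ rhoM _; rewrite torusD rhoM //; exact: torus_SO. Qed.

Lemma weight_basis : exists2 P : 'M[C]_d, P \in unitmx &
  exists mu : 'I_d -> 'I_n -> int, forall t,
    P *m rho (torus t) = diag_mx (\row_a expi (\sum_i (mu a i)%:~R * t i)) *m P.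
Proof.
apply: (@torus_diag R n d (fun t => rho (torus t))) => [s t||i|i a b].
- exact: rep_torusD.
- rewrite torusE big1 => [|k _]; last by rewrite plane_rot0.
  by case: hrho.
- rewrite -/(coord_fun i (2 * pi)) torus_coord plane_rotE //.
  rewrite mulr_natl cos2pi sin2pi subrr !scale0r !addr0.
  by case: hrho.
- rewrite (_ : (fun s => _) = (fun s => rho (prot i s) a b)); first exact: rep_rot_ccont.
  by apply/funext => s; rewrite -/(coord_fun i s) torus_coord.
Qed.

Lemma expi_lin_inj (x y : R) : (forall s, expi (x * s) = expi (y * s)) -> x = y.
Proof.
move=> h; apply/eqP; rewrite -subr_eq0; apply: contraT => xy.
(* At this point the two exponentials differ by the factor e^{i pi} = -1. *)
have := h (pi / (x - y)).
have -> : x * (pi / (x - y)) = pi + y * (pi / (x - y)) by field.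
rewrite expiD expi_pi => /eqP; rewrite -subr_eq0 mulN1r -opprD oppr_eq0 -mulr2n.
by rewrite mulrn_eq0 (negPf (expi_neq0 _)).
Qed.

Lemma is_weightP (la : 'I_n -> int) : is_weight rho la <->
  exists2 v : 'rV[C]_d, v != 0 &
    forall k s, v *m rho (prot k s) = expi ((la k)%:~R * s) *: v.
Proof.
split=> [[v v0 hv]|[v v0 hv]]; exists v => //.
  move=> k s; rewrite -torus_coord hv cexp_i; congr (expi _ *: _).
  rewrite (bigD1 k) //= big1 => [|l lk]; rewrite /coord_fun ?eqxx ?addr0 //.
  by rewrite (negPf lk) mulr0.
move=> t; rewrite cexp_i torusE.
suff H (r : seq 'I_n) : special_orthogonal R m (\prod_(k <- r) prot k (t k)) /\
    v *m rho (\prod_(k <- r) prot k (t k)) = expi (\sum_(k <- r) (la k)%:~R * t k) *: v.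
  by have [] := H (index_enum _).
elim: r => [|k r [IH1 IH2]].
  rewrite !big_nil expi0 scale1r; split; first by split; rewrite ?trmx1 ?mulmx1 // det1.
  by case: hrho => -> _ _; rewrite mulmx1.
have SOk : special_orthogonal R m (prot k (t k)) by exact: plane_rot_SO.
rewrite !big_cons; split; first exact: special_orthogonalM.
case: hrho => _ rhoM _; rewrite [rho _]rhoM // mulmxA hv -scalemxAl IH2 scalerA expiD.
by [].
Qed.

(** [g] normalises the torus, so [v *m rho g] is again a weight vector. *)
Lemma is_weight_conj (la : 'I_n -> int) (g : 'M[R]_m) (sg : 'I_n -> 'I_n) (e : 'I_n -> int) :
  special_orthogonal R m g ->
  (forall k s, g *m prot k s = prot (sg k) ((e k)%:~R * s) *m g) ->
  is_weight rho la -> is_weight rho (fun k => e k * la (sg k)).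
Proof.
move=> hg gE /is_weightP[v v0 hv]; apply/is_weightP; case: hrho => _ rhoM _.
have SOk (k : 'I_n) (s : R) : special_orthogonal R m (prot k s).
  by apply: plane_rot_SO; exact: pl01.
have [g1 g2] := hg.
have hgT : special_orthogonal R m g^T by split; rewrite ?trmxK ?det_tr // mulmx1C.
exists (v *m rho g).
  apply: contra_neq v0 => /(congr1 (mulmx^~ (rho g^T))).
  rewrite mul0mx -mulmxA -rhoM // g1; case: hrho => -> _ _; by rewrite mulmx1.
move=> k s; rewrite -mulmxA -rhoM // gE rhoM // mulmxA hv -scalemxAl.
by congr (expi _ *: _); rewrite intrM; ring.
Qed.

(** A quarter turn on the first coordinates of the planes i and j, together with one on their second
    coordinates, exchanges the planes and keeps their orientation. *)
Lemma is_weight_tperm (la : 'I_n -> int) i j :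
  is_weight rho la -> is_weight rho (fun k => la (tperm i j k)).
Proof.
have [->|ij] := eqVneq i j.
  by move=> h; congr (is_weight rho): h; apply/funext => k; rewrite tperm1 perm1.
have [i01 i02 i12] := pl_neq i i; have [j01 j02 j12] := pl_neq j j.
have [ij01 _ _] := pl_neq i j; have [ji01 _ _] := pl_neq j i.
have ij0 : pl0 i != pl0 j by rewrite (inj_eq (@pl0_inj n)).
have ij1 : pl1 i != pl1 j by rewrite (inj_eq (@pl1_inj n)).
pose Q1 := @plane_rot R m (pl0 i) (pl0 j) (pi / 2).
pose Q2 := @plane_rot R m (pl1 i) (pl1 j) (pi / 2).
move=> h; have := @is_weight_conj la (Q1 *m Q2) (tperm i j) (fun=> 1) _ _ h.
rewrite (_ : (fun k => 1 * _) = (fun k => la (tperm i j k))); last first.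
  by apply/funext => k; rewrite mul1r.
apply; first by apply: special_orthogonalM; apply: plane_rot_SO.
move=> k s; rewrite mul1r; case: tpermP => [->|->|/eqP ki /eqP kj].
- rewrite -mulmxA.
  have -> : Q2 *m prot i s = plane_rot m (pl0 i) (pl1 j) s *m Q2.
    rewrite -[s in LHS]opprK -(plane_rotC (- s) i01) quarter_rot_fst //; try by rewrite eq_sym.
    by rewrite plane_rotC ?opprK.
  by rewrite mulmxA quarter_rot_fst // mulmxA.
- rewrite -mulmxA.
  have -> : Q2 *m prot j s = plane_rot m (pl0 j) (pl1 i) (- s) *m Q2.
    rewrite -[s in LHS]opprK -(plane_rotC (- s) j01) quarter_rot_snd //; try by rewrite eq_sym.
    by rewrite opprK plane_rotC.
  by rewrite mulmxA quarter_rot_snd // opprK mulmxA.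
- have [ik01 _ _] := pl_neq i k; have [jk01 _ _] := pl_neq j k.
  have [ki01 _ _] := pl_neq k i; have [kj01 _ _] := pl_neq k j; have [k01 _ _] := pl_neq k k.
  have H2 : Q2 *m prot k s = prot k s *m Q2.
    by apply: plane_rot_commute => //; rewrite 1?eq_sym ?(inj_eq (@pl1_inj n)) // eq_sym.
  have H1 : Q1 *m prot k s = prot k s *m Q1.
    by apply: plane_rot_commute => //; rewrite 1?eq_sym ?(inj_eq (@pl0_inj n)) // eq_sym.
  by rewrite -mulmxA H2 !mulmxA H1.
Qed.

Lemma is_weight_perm (la : 'I_n -> int) (s : 'S_n) :
  is_weight rho la -> is_weight rho (fun k => la (s k)).
Proof.
have [ts -> _] := prod_tpermP s; elim: ts la => [|[i j] ts IH] la h.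
  by congr (is_weight rho): h; apply/funext => k; rewrite big_nil perm1.
rewrite big_cons /= (_ : (fun k => _) = (fun k => la ((\prod_(t <- ts) tperm t.1 t.2)%g (tperm i j k)))).
  exact: (is_weight_tperm i j (IH _ h)).
by apply/funext => k; rewrite permM.
Qed.

(** A half turn reverses [pl1 i] and the fixed axis together: the plane i changes orientation while
    the determinant stays 1. The odd dimension provides the spare axis. *)
Lemma is_weight_flip (la : 'I_n -> int) (i : 'I_n) :
  is_weight rho la -> is_weight rho (fun k => if k == i then - la k else la k).
Proof.
have [i01 i02 i12] := pl_neq i i.
move=> h; have := @is_weight_conj la (@plane_rot R m (pl1 i) (pl2 n) pi) id
  (fun k => if k == i then -1 else 1) _ _ h.
rewrite (_ : (fun k => _ * _) = (fun k => if k == i then - la k else la k)); last first.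
  by apply/funext => k; case: eqP; rewrite ?mulN1r ?mul1r.
apply; first by apply: plane_rot_SO.
move=> k s; have [->|ki] := eqVneq k i.
  rewrite rmorphN1 mulN1r -[s in LHS]opprK -(plane_rotC (- s) i01) half_rot // 1?eq_sym //.
  by rewrite plane_rotC ?opprK.
rewrite mul1r; have [ik01 _ _] := pl_neq i k; have [ki01 k02 k12] := pl_neq k i.
have [k01 _ _] := pl_neq k k.
by apply: plane_rot_commute => //; rewrite 1?eq_sym ?(inj_eq (@pl1_inj n)) // eq_sym.
Qed.

Lemma is_weight_sign (la : 'I_n -> int) (e : 'I_n -> bool) :
  is_weight rho la -> is_weight rho (fun k => (-1) ^+ e k * la k).
Proof.
move=> h; suff H (r : seq 'I_n) : uniq r ->
    is_weight rho (fun k => (-1) ^+ (e k && (k \in r)) * la k).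
  have := H _ (index_enum_uniq _); congr (is_weight rho _); apply/funext => k.
  by rewrite mem_index_enum andbT.
elim: r => [_|i r IH /= /andP[ir ur]].
  by congr (is_weight rho _): h; apply/funext => k; rewrite andbF mul1r.
case ei : (e i); last first.
  have := IH ur; congr (is_weight rho _); apply/funext => k; rewrite inE.
  by have [->|//] := eqVneq k i; rewrite ei.
have := is_weight_flip i (IH ur); congr (is_weight rho _); apply/funext => k; rewrite inE.
by have [->|//] := eqVneq k i; rewrite ei (negPf ir) expr1 mul1r mulN1r.
Qed.

Section Basis.
Variables (P : 'M[C]_d) (mu : 'I_d -> 'I_n -> int).
Hypothesis Pu : P \in unitmx.
Hypothesis hmu : forall t,
  P *m rho (torus t) = diag_mx (\row_a expi (\sum_i (mu a i)%:~R * t i)) *m P.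

Lemma is_weight_basis a : is_weight rho (mu a).
Proof.
exists (row a P).
  apply: contraTneq Pu => r0; rewrite unitmxE unitfE negbK.
  rewrite (expand_det_row _ a) big1 // => j _.
  by have /rowP/(_ j) := r0; rewrite !mxE => ->; rewrite mul0r.
move=> t; rewrite cexp_i -row_mul hmu; apply/rowP => j.
by rewrite mxE mul_diag_mx !mxE.
Qed.

(** A nonzero coordinate of the weight vector in the basis forces the two characters of the torus to
    agree. *)
Lemma is_weight_mem_basis (la : 'I_n -> int) : is_weight rho la -> exists a, mu a = la.
Proof.
move=> [v v0 hv]; pose w := v *m invmx P.
have w0 : w != 0.
  by apply: contra_neq v0 => /(congr1 (mulmx^~ P)); rewrite mulmxKV // mul0mx.
have vE : v = w *m P by rewrite mulmxKV.
move: w w0 vE => w w0 vE.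
have [a wa] : exists a, w 0 a != 0.
  apply/existsP; apply: contra_neqT w0 => /existsPn h; apply/rowP => a.
  by rewrite [RHS]mxE; apply/eqP; have := h a; rewrite negbK.
exists a; apply/funext => k; apply: (@mulrIz R 1); first exact: oner_neq0.
apply: expi_lin_inj => s.
have E t : expi (\sum_i (mu a i)%:~R * t i) = expi (\sum_i (la i)%:~R * t i) :> C.
  have : w *m (P *m rho (torus t)) = cexp ('i%C * (\sum_(k < n) (la k)%:~R * t k)%:C) *: v.
    by rewrite mulmxA -vE.
  rewrite hmu cexp_i mulmxA vE => /(congr1 (mulmx^~ (invmx P))).
  rewrite mulmxK // -scalemxAl mulmxK // mul_mx_diag => /rowP/(_ a); rewrite !mxE mulrC.
  exact: mulIf.
have := E (coord_fun k s).
have S (f : 'I_n -> int) : \sum_i (f i)%:~R * coord_fun k s i = (f k)%:~R * s.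
  rewrite (bigD1 k) //= big1 => [|l lk]; rewrite /coord_fun ?eqxx ?addr0 //.
  by rewrite (negPf lk) mulr0.
by rewrite !S.
Qed.

End Basis.
End Weights.

(** * Traces of squared generators against the torus *)

Section Radial.
Variables (R : realType) (n d : nat) (rho : 'M[R]_(n.*2.+1) -> 'M[R[i]]_d).
Hypothesis hrho : SO_representation rho.
Local Notation m := n.*2.+1.
Local Notation C := R[i].
Local Notation prot k t := (@plane_rot R m (pl0 k) (pl1 k) t).
Variables (P : 'M[C]_d) (mu : 'I_d -> 'I_n -> int).
Hypothesis Pu : P \in unitmx.
Hypothesis hmu : forall t,
  P *m rho (torus t) = diag_mx (\row_a expi (\sum_i (mu a i)%:~R * t i)) *m P.
Variable X : 'I_m -> 'I_m -> 'M[C]_d.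
Hypothesis hX : infinitesimal_rotations rho X.
Implicit Types (k l : 'I_n) (t : 'I_n -> R).

Definition chr t : C := \sum_a expi (\sum_i (mu a i)%:~R * t i).
(** [chr1] and [chr2] are the first and second derivatives of [chr] in the k-th angle, taken term by
    term. *)
Definition chr1 k t : C :=
  \sum_a 'i * ((mu a k)%:~R)%:C * expi (\sum_i (mu a i)%:~R * t i).
Definition chr2 k t : C :=
  \sum_a - (((mu a k)%:~R) ^+ 2)%:C * expi (\sum_i (mu a i)%:~R * t i).

Let pl01 k : pl0 (n := n) k != pl1 k. Proof. by have [] := pl_neq k k. Qed.
Let pl02 k : pl0 (n := n) k != pl2 n. Proof. by have [] := pl_neq k k. Qed.
Let pl12 k : pl1 (n := n) k != pl2 n. Proof. by have [] := pl_neq k k. Qed.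
Let pl10 k : pl1 (n := n) k != pl0 k. Proof. by rewrite eq_sym. Qed.

Lemma rho_torusE t : rho (torus t) =
  invmx P *m (diag_mx (\row_a expi (\sum_i (mu a i)%:~R * t i)) *m P).
Proof. by rewrite -hmu mulKmx. Qed.

Lemma mxtrace_torus_diag (D : 'rV[C]_d) t :
  \tr (invmx P *m diag_mx D *m P *m rho (torus t)) =
  \sum_a D 0 a * expi (\sum_i (mu a i)%:~R * t i).
Proof.
rewrite rho_torusE !mulmxA mulmxK // mxtrace_mulC !mulmxA mulmxV // mul1mx mulmx_diag.
by rewrite mxtrace_diag; apply: eq_bigr => a _; rewrite !mxE.
Qed.

Lemma mxtrace_torus t : \tr (rho (torus t)) = chr t.
Proof.
have := mxtrace_torus_diag (const_mx 1) t.
rewrite diag_const_mx mulmx1 mulVmx // mul1mx => ->.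
by apply: eq_bigr => a _; rewrite mxE mul1r.
Qed.

Lemma gen_plane_diag k :
  X (pl0 k) (pl1 k) = invmx P *m diag_mx (\row_a ('i * ((mu a k)%:~R)%:C)) *m P.
Proof.
apply: (mderiv_unique (gen_deriv hrho hX (pl01 k))).
have := mderivMr P (mderivMl (invmx P)
  (mderiv_diag (fun a => (mu a k)%:~R) (is_derive_id (0 : R) 1))).
rewrite scale1r (_ : diag_mx (\row_a expi _) = 1%:M) ?mulmx1; last first.
  by apply/matrixP => a b; rewrite !mxE mulr0 expi0.
apply: mderiv_ext => s; rewrite -torus_coord rho_torusE mulmxA.
congr (_ *m diag_mx _ *m _); apply/rowP => a; rewrite !mxE; congr expi.
rewrite (bigD1 k) //= big1 => [|l lk]; rewrite /coord_fun ?eqxx ?addr0 //.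
by rewrite (negPf lk) mulr0.
Qed.

Lemma mxtrace_gen_plane k t : \tr (X (pl0 k) (pl1 k) *m rho (torus t)) = chr1 k t.
Proof.
rewrite gen_plane_diag mxtrace_torus_diag; apply: eq_bigr => a _; by rewrite mxE.
Qed.

Lemma mxtrace_gen_plane_sq k t :
  \tr (X (pl0 k) (pl1 k) *m X (pl0 k) (pl1 k) *m rho (torus t)) = chr2 k t.
Proof.
rewrite gen_plane_diag !mulmxA mulmxK // -(mulmxA (invmx P)) mulmx_diag mxtrace_torus_diag.
apply: eq_bigr => a _; rewrite !mxE mulrACA -expr2 sqr_i rmorphXn /= expr2.
by rewrite mulN1r.
Qed.

(** Each factor of the torus element is trivial or commutes with [Z]. The first alternative serves
    [drop_coord], which removes the angles that do move [Z]. *)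
Lemma torus_comm (Z : 'M[C]_d) t :
  (forall j, t j = 0 \/ forall s, rho (prot j s) *m Z = Z *m rho (prot j s)) ->
  rho (torus t) *m Z = Z *m rho (torus t).
Proof.
move=> hZ; rewrite torusE.
suff H (r : seq 'I_n) : special_orthogonal R m (\prod_(k <- r) prot k (t k)) /\
    rho (\prod_(k <- r) prot k (t k)) *m Z = Z *m rho (\prod_(k <- r) prot k (t k)).
  by have [] := H (index_enum _).
elim: r => [|k r [IH1 IH2]].
  rewrite !big_nil; split; first by split; rewrite ?trmx1 ?mulmx1 // det1.
  by case: hrho => -> _ _; rewrite mulmx1 mul1mx.
have SOk : special_orthogonal R m (prot k (t k)) by apply: plane_rot_SO; exact: pl01.
rewrite !big_cons; split; first exact: special_orthogonalM.
case: hrho => rho1 rhoM _; rewrite [rho _]rhoM // -mulmxA IH2 !mulmxA; congr (_ *m _).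
have [t0|->] := hZ k; last by [].
by rewrite t0 plane_rot0 ?rho1 ?mul1mx ?mulmx1 //; exact: pl01.
Qed.

Lemma conj_pl0 k v s : pl0 k != v -> pl1 k != v ->
  rho (prot k s) *m X (pl0 k) v =
  ((cos s)%:C *: X (pl0 k) v + (sin s)%:C *: X (pl1 k) v) *m rho (prot k s).
Proof.
move=> h0 h1; rewrite (gen_rotated hrho hX) ?pl01 // /rotated_family eqxx.
by rewrite ![v == _]eq_sym (negPf h0) (negPf h1).
Qed.

Lemma conj_pl1 k v s : pl0 k != v -> pl1 k != v ->
  rho (prot k s) *m X (pl1 k) v =
  ((cos s)%:C *: X (pl1 k) v - (sin s)%:C *: X (pl0 k) v) *m rho (prot k s).
Proof.
move=> h0 h1; rewrite (gen_rotated hrho hX) ?pl01 // /rotated_family eqxx (negPf (pl10 k)).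
by rewrite ![v == _]eq_sym (negPf h0) (negPf h1).
Qed.

Definition drop_coord k t : 'I_n -> R := fun j => if j == k then 0 else t j.

Lemma torus_split k t : rho (torus t) = rho (torus (drop_coord k t)) *m rho (prot k (t k)).
Proof.
rewrite -torus_coord -rep_torusD //; congr (rho (torus _)); apply/funext => j.
by rewrite /drop_coord /coord_fun; case: eqP => [->|_]; rewrite ?add0r ?addr0.
Qed.

Lemma prot_gen_comm j u v s : pl0 j != u -> pl0 j != v -> pl1 j != u -> pl1 j != v ->
  rho (prot j s) *m X u v = X u v *m rho (prot j s).
Proof.
have [->|uv] := eqVneq u v; first by rewrite (gen_pp hX) mulmx0 mul0mx.
by move=> *; apply: (gen_comm hrho hX) => //; exact: pl01.
Qed.

(** The torus rotates this pair by the angle t_k, since it spans the real form of the root spaces of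
    the short roots +-e_k. The commutator of the pair is the generator of the k-th plane. *)
Lemma mxtrace_short_root k t :
  (1 - cos (t k))%:C * \tr ((X (pl0 k) (pl2 n) *m X (pl0 k) (pl2 n) +
      X (pl1 k) (pl2 n) *m X (pl1 k) (pl2 n)) *m rho (torus t)) =
  (sin (t k))%:C * chr1 k t.
Proof.
have comm u : (u = pl0 k) \/ (u = pl1 k) -> rho (torus (drop_coord k t)) *m X u (pl2 n) =
    X u (pl2 n) *m rho (torus (drop_coord k t)).
  move=> hu; apply: torus_comm => j; rewrite /drop_coord.
  have [jk|jk] := eqVneq j k; [by left|right] => s.
  have [h1 h2 h3] := pl_neq j k; have [h4 h5 h6] := pl_neq k j.
  by case: hu => ->; apply: prot_gen_comm; rewrite ?(inj_eq (@pl0_inj n)) ?(inj_eq (@pl1_inj n)) // eq_sym.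
have c0 := comm _ (or_introl (erefl _)); have c1 := comm _ (or_intror (erefl _)).
rewrite rmorphB rmorph1 (mxtrace_rotated_pair (s := (sin (t k))%:C)); first last.
- rewrite (torus_split k) -mulmxA conj_pl1 // mulmxA mulmxBr -!scalemxAr c0 c1.
  by rewrite [RHS]mulmxA; congr (_ *m _); rewrite mulmxBl -!scalemxAl.
- rewrite (torus_split k) -mulmxA conj_pl0 // mulmxA mulmxDr -!scalemxAr c0 c1.
  by rewrite [RHS]mulmxA; congr (_ *m _); rewrite mulmxDl -!scalemxAl.
congr (_ * _); rewrite -mxtrace_gen_plane; congr (\tr (_ *m _)).
have := gen_bracket hrho hX (pl02 k) (_ : pl2 n != pl1 k) (pl01 k).
rewrite eq_sym => /(_ (pl12 k)); rewrite (gen_sym hrho hX (pl1 k)) mulmxN mulNmx opprK.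
by move=> /(congr1 -%R); rewrite opprD !opprK.
Qed.

Section LongRoots.
Variables (t : 'I_n -> R) (k l : 'I_n).
Hypothesis kl : k != l.
Let lk : l != k. Proof. by rewrite eq_sym. Qed.
Let k0l0 : pl0 k != pl0 l. Proof. by rewrite (inj_eq (@pl0_inj n)). Qed.
Let k1l1 : pl1 k != pl1 l. Proof. by rewrite (inj_eq (@pl1_inj n)). Qed.
Let k0l1 : pl0 k != pl1 l. Proof. by have [] := pl_neq k l. Qed.
Let k1l0 : pl1 k != pl0 l. Proof. by rewrite eq_sym; have [] := pl_neq l k. Qed.
Let x := t k.
Let y := t l.
Let T := rho (torus t).
Local Notation X00 := (X (pl0 k) (pl0 l)).
Local Notation X01 := (X (pl0 k) (pl1 l)).
Local Notation X10 := (X (pl1 k) (pl0 l)).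
Local Notation X11 := (X (pl1 k) (pl1 l)).

Let comm u v : (u = pl0 k) \/ (u = pl1 k) -> (v = pl0 l) \/ (v = pl1 l) ->
  rho (torus (drop_coord l (drop_coord k t))) *m X u v =
  X u v *m rho (torus (drop_coord l (drop_coord k t))).
Proof.
move=> hu hv; apply: torus_comm => j; rewrite /drop_coord.
have [jl|jl] := eqVneq j l; first by left.
have [jk|jk] := eqVneq j k; [by left|right] => s.
have [h1 h2 h3] := pl_neq j k; have [h4 h5 h6] := pl_neq k j.
have [h1' h2' h3'] := pl_neq j l; have [h4' h5' h6'] := pl_neq l j.
by case: hu => ->; case: hv => ->; apply: prot_gen_comm;
  rewrite ?(inj_eq (@pl0_inj n)) ?(inj_eq (@pl1_inj n)) // eq_sym.
Qed.

Let conjl0 u : u != pl0 l -> u != pl1 l -> rho (prot l y) *m X u (pl0 l) =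
  ((cos y)%:C *: X u (pl0 l) + (sin y)%:C *: X u (pl1 l)) *m rho (prot l y).
Proof.
move=> h0 h1; rewrite (gen_rotated hrho hX) ?pl01 // /rotated_family.
by rewrite (negPf h0) (negPf h1) eqxx.
Qed.

Let conjl1 u : u != pl0 l -> u != pl1 l -> rho (prot l y) *m X u (pl1 l) =
  ((cos y)%:C *: X u (pl1 l) - (sin y)%:C *: X u (pl0 l)) *m rho (prot l y).
Proof.
move=> h0 h1; rewrite (gen_rotated hrho hX) ?pl01 // /rotated_family.
by rewrite (negPf h0) (negPf h1) eqxx (negPf (pl10 l)).
Qed.

Let TE : T = rho (torus (drop_coord l (drop_coord k t))) *m rho (prot l y) *m rho (prot k x).
Proof.
rewrite /T (torus_split k) (torus_split l) /y.
by congr (_ *m rho (prot l _) *m _); rewrite /drop_coord (negPf lk).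
Qed.

Let conjT (Y Z W : 'M[C]_d) : rho (prot k x) *m Y = Z *m rho (prot k x) ->
  rho (prot l y) *m Z = W *m rho (prot l y) ->
  rho (torus (drop_coord l (drop_coord k t))) *m W =
    W *m rho (torus (drop_coord l (drop_coord k t))) -> T *m Y = W *m T.
Proof.
move=> h1 h2 h3; rewrite TE -!mulmxA h1 !(mulmxA (rho (prot l y))) h2.
by rewrite -!mulmxA !mulmxA h3.
Qed.

Let c00 := comm (or_introl (erefl _)) (or_introl (erefl _)).
Let c01 := comm (or_introl (erefl _)) (or_intror (erefl _)).
Let c10 := comm (or_intror (erefl _)) (or_introl (erefl _)).
Let c11 := comm (or_intror (erefl _)) (or_intror (erefl _)).

Let commlin (a b c e : C) :
  rho (torus (drop_coord l (drop_coord k t))) *m (a *: X00 + b *: X01 + c *: X10 + e *: X11) =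
  (a *: X00 + b *: X01 + c *: X10 + e *: X11) *m rho (torus (drop_coord l (drop_coord k t))).
Proof.
by rewrite !mulmxDr !mulmxDl -!scalemxAr -!scalemxAl c00 c01 c10 c11.
Qed.

Let cx := (cos x)%:C.
Let sx := (sin x)%:C.
Let cy := (cos y)%:C.
Let sy := (sin y)%:C.

Let lin (a b c e : C) : rho (prot l y) *m (a *: X00 + b *: X01 + c *: X10 + e *: X11) =
  ((a * cy - b * sy) *: X00 + (a * sy + b * cy) *: X01 +
   (c * cy - e * sy) *: X10 + (c * sy + e * cy) *: X11) *m rho (prot l y).
Proof.
rewrite !mulmxDr -!scalemxAr !conjl0 // !conjl1 // !scalemxAl -!mulmxDl; congr (_ *m _).
by rewrite -/cy -/sy; move: cy sy X00 X01 X10 X11 => *; apply/matrixP => i j; rewrite !mxE; ring.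
Qed.

Let lin4 (Y : 'M[C]_d) (a b c e : C) :
  rho (prot k x) *m Y = (a *: X00 + b *: X01 + c *: X10 + e *: X11) *m rho (prot k x) ->
  T *m Y = ((a * cy - b * sy) *: X00 + (a * sy + b * cy) *: X01 +
   (c * cy - e * sy) *: X10 + (c * sy + e * cy) *: X11) *m T.
Proof. by move=> h; apply: conjT h (lin _ _ _ _) (commlin _ _ _ _). Qed.

(** The torus acts on the four generators joining the planes k and l as the tensor product of the
    rotations by x and y. *)
Let T00 : T *m X00 = (cx * cy *: X00 + cx * sy *: X01 + sx * cy *: X10 + sx * sy *: X11) *m T.
Proof.
rewrite (lin4 (a := cx) (b := 0) (c := sx) (e := 0)); last by rewrite !scale0r !addr0 conj_pl0.
by congr (_ *m _); move: cx cy sx sy X00 X01 X10 X11 => *; apply/matrixP => i j; rewrite !mxE; ring.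
Qed.

Let T01 : T *m X01 =
  (- (cx * sy) *: X00 + cx * cy *: X01 - sx * sy *: X10 + sx * cy *: X11) *m T.
Proof.
rewrite (lin4 (a := 0) (b := cx) (c := 0) (e := sx)); last by rewrite !scale0r !(addr0, add0r) conj_pl0.
by congr (_ *m _); move: cx cy sx sy X00 X01 X10 X11 => *; apply/matrixP => i j; rewrite !mxE; ring.
Qed.

Let T10 : T *m X10 =
  (- (sx * cy) *: X00 - sx * sy *: X01 + cx * cy *: X10 + cx * sy *: X11) *m T.
Proof.
rewrite (lin4 (a := - sx) (b := 0) (c := cx) (e := 0)); last first.
  by rewrite !scale0r !addr0 conj_pl1 // scaleNr addrC.
by congr (_ *m _); move: cx cy sx sy X00 X01 X10 X11 => *; apply/matrixP => i j; rewrite !mxE; ring.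
Qed.

Let T11 : T *m X11 =
  (sx * sy *: X00 - sx * cy *: X01 - cx * sy *: X10 + cx * cy *: X11) *m T.
Proof.
rewrite (lin4 (a := 0) (b := - sx) (c := 0) (e := cx)); last first.
  by rewrite !scale0r !(addr0, add0r) conj_pl1 // scaleNr addrC.
by congr (_ *m _); move: cx cy sx sy X00 X01 X10 X11 => *; apply/matrixP => i j; rewrite !mxE; ring.
Qed.

Let br p q r : p != q -> q != r -> p != r -> X p r *m X q r = X p q + X q r *m X p r.
Proof.
move=> pq qr pr; have rq : r != q by rewrite eq_sym.
have := gen_bracket hrho hX pr rq pq.
rewrite (gen_sym hrho hX q r) mulmxN mulNmx opprK => /(congr1 -%R).
by rewrite opprD !opprK => <-; rewrite subrK.
Qed.

Let br_ac : X00 *m X10 = X (pl0 k) (pl1 k) + X10 *m X00.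
Proof. by rewrite br // pl01. Qed.
Let br_eb : X11 *m X01 = - X (pl0 k) (pl1 k) + X01 *m X11.
Proof. by rewrite br // -(gen_sym hrho hX (pl0 k)). Qed.
Let br_ab : X00 *m X01 = X (pl0 l) (pl1 l) + X01 *m X00.
Proof.
rewrite (gen_sym hrho hX (pl0 l) (pl0 k)) (gen_sym hrho hX (pl1 l) (pl0 k)).
by rewrite !mulNmx !mulmxN !opprK br // eq_sym.
Qed.
Let br_ec : X11 *m X10 = - X (pl0 l) (pl1 l) + X10 *m X11.
Proof.
rewrite (gen_sym hrho hX (pl0 l) (pl1 k)) (gen_sym hrho hX (pl1 l) (pl1 k)).
by rewrite !mulNmx !mulmxN !opprK br // 1?eq_sym // -(gen_sym hrho hX (pl0 l)).
Qed.

(** These combinations span the real form of the root spaces of +-(e_k - e_l): the torus rotates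
    them by x - y, and their commutator is twice the difference of the two plane generators.
    [half_sum] treats +-(e_k + e_l). *)
Let half_diff : (1 - cos (x - y))%:C *
    \tr (((X00 + X11) *m (X00 + X11) + (X10 - X01) *m (X10 - X01)) *m T) =
  (sin (x - y))%:C * (2 * (chr1 k t - chr1 l t)).
Proof.
rewrite rmorphB rmorph1 (mxtrace_rotated_pair (s := (sin (x - y))%:C)); first last.
- rewrite mulmxBr T10 T01 -mulmxBl; congr (_ *m _).
  rewrite cosB sinB rmorphB rmorphD !rmorphM /= -/cx -/cy -/sx -/sy.
  by move: cx cy sx sy => *; apply/matrixP => i j; rewrite !mxE; ring.
- rewrite mulmxDr T00 T11 -mulmxDl; congr (_ *m _).
  rewrite cosB sinB rmorphB rmorphD !rmorphM /= -/cx -/cy -/sx -/sy.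
  by move: cx cy sx sy => *; apply/matrixP => i j; rewrite !mxE; ring.
congr (_ * _); rewrite mulrBr -!mxtrace_gen_plane -!(mxtraceZ 2) !scalemxAl -linearB /= -mulmxBl.
congr (\tr (_ *m _)); rewrite !(mulmxDl, mulmxDr) ?(mulmxN, mulNmx) br_ac br_eb br_ab br_ec.
move: (X10 *m X00) (X01 *m X11) (X01 *m X00) (X10 *m X11) => *.
by apply/matrixP => i j; rewrite !mxE; ring.
Qed.

Let half_sum : (1 - cos (x + y))%:C *
    \tr (((X00 - X11) *m (X00 - X11) + (X10 + X01) *m (X10 + X01)) *m T) =
  (sin (x + y))%:C * (2 * (chr1 k t + chr1 l t)).
Proof.
rewrite rmorphB rmorph1 (mxtrace_rotated_pair (s := (sin (x + y))%:C)); first last.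
- rewrite mulmxDr T10 T01 -mulmxDl; congr (_ *m _).
  rewrite cosD sinD rmorphB rmorphD !rmorphM /= -/cx -/cy -/sx -/sy.
  by move: cx cy sx sy => *; apply/matrixP => i j; rewrite !mxE; ring.
- rewrite mulmxBr T00 T11 -mulmxBl; congr (_ *m _).
  rewrite cosD sinD rmorphB rmorphD !rmorphM /= -/cx -/cy -/sx -/sy.
  by move: cx cy sx sy => *; apply/matrixP => i j; rewrite !mxE; ring.
congr (_ * _); rewrite mulrDr -!mxtrace_gen_plane -!(mxtraceZ 2) !scalemxAl -linearD /= -mulmxDl.
congr (\tr (_ *m _)); rewrite !(mulmxDl, mulmxDr) ?(mulmxN, mulNmx) br_ac br_eb br_ab br_ec.
move: (X10 *m X00) (X01 *m X11) (X01 *m X00) (X10 *m X11) => *.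
by apply/matrixP => i j; rewrite !mxE; ring.
Qed.

Lemma mxtrace_long_root : cos x != cos y ->
  (cos y - cos x)%:C * \tr ((X00 *m X00 + X01 *m X01 + X10 *m X10 + X11 *m X11) *m T) =
  2 * ((sin x)%:C * chr1 k t - (sin y)%:C * chr1 l t).
Proof.
(* In half angles cos y - cos x = 2 sin al sin be, so the hypothesis makes both sines nonzero, and a
   factor 2 sin can be cancelled in each of the two relations. *)
move=> cxy; pose al := (x - y) / 2; pose be := (x + y) / 2.
have xE : x = al + be by rewrite /al /be; field.
have yE : y = be - al by rewrite /al /be; field.
have cE : cos y - cos x = 2 * sin al * sin be by rewrite xE yE cosB cosD; ring.
have : cos y - cos x != 0 by rewrite subr_eq0 eq_sym.
rewrite cE !mulf_eq0 pnatr_eq0 /= negb_or => /andP[al0 be0].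
have := half_diff; have := half_sum.
have -> : x - y = al + al by rewrite /al; field.
have -> : x + y = be + be by rewrite /be; field.
have c2 z : 1 - cos (z + z) = 2 * sin z * sin z :> R.
  by rewrite cosD -[X in X - _](cos2Dsin2 z); ring.
have s2 z : sin (z + z) = 2 * sin z * cos z :> R by rewrite sinD; ring.
rewrite !c2 !s2.
set U := \tr _; set V := \tr _ => hU hV.
have UV : 2 * \tr ((X00 *m X00 + X01 *m X01 + X10 *m X10 + X11 *m X11) *m T) = U + V.
  rewrite /U /V -linearD /= -mulmxDl -mxtraceZ scalemxAl; congr (\tr (_ *m _)).
  rewrite !(mulmxDl, mulmxDr) ?(mulmxN, mulNmx).
  move: (X00 *m X00) (X01 *m X01) (X10 *m X10) (X11 *m X11) => ? ? ? ?.
  move: (X00 *m X11) (X11 *m X00) (X10 *m X01) (X01 *m X10) => *.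
  by apply/matrixP => i j; rewrite !mxE; ring.
have nz z : z != 0 -> (2 * z)%:C != 0 :> C.
  by move=> z0; rewrite eq_complex /= eqxx andbT mulf_neq0 // pnatr_eq0.
have {}hU : (sin be)%:C * U = (cos be)%:C * (2 * (chr1 k t + chr1 l t)).
  by apply: (mulfI (nz _ be0)); rewrite !mulrA -!rmorphM /= hU rmorphM; ring.
have {}hV : (sin al)%:C * V = (cos al)%:C * (2 * (chr1 k t - chr1 l t)).
  by apply: (mulfI (nz _ al0)); rewrite !mulrA -!rmorphM /= hV rmorphM; ring.
rewrite !rmorphM rmorph_nat /=.
have -> : sin x = sin al * cos be + cos al * sin be by rewrite {1}xE sinD.
have -> : sin y = sin be * cos al - cos be * sin al by rewrite {1}yE sinB.
rewrite rmorphB rmorphD !rmorphM /=.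
move: (sin al)%:C (sin be)%:C (cos al)%:C (cos be)%:C UV hU hV => sa sb ca cb.
set S := \tr _ => UV hU hV; move: U V S UV hU hV => U V S UV hU hV.
transitivity (sa * sb * (2 * S)); first by ring.
rewrite UV; transitivity (sa * (sb * U) + sb * (sa * V)); first by ring.
by rewrite hU hV; ring.
Qed.

End LongRoots.

End Radial.

(** * Assembly of the radial equation *)

Section RadialEquation.
Variables (R : realType) (n d : nat) (rho : 'M[R]_(n.*2.+1) -> 'M[R[i]]_d).
Hypothesis hrho : SO_representation rho.
Local Notation m := n.*2.+1.
Local Notation C := R[i].
Variables (P : 'M[C]_d) (mu : 'I_d -> 'I_n -> int).
Hypothesis Pu : P \in unitmx.
Hypothesis hmu : forall t,
  P *m rho (torus t) = diag_mx (\row_a expi (\sum_i (mu a i)%:~R * t i)) *m P.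
Variable X : 'I_m -> 'I_m -> 'M[C]_d.
Hypothesis hX : infinitesimal_rotations rho X.
Variable c : C.
Hypothesis hc : casimir X = c%:M.

(* The radial part of the Casimir operator on the maximal torus. *)
Lemma casimir_radial (t : 'I_n -> R) :
  (forall k, sin (t k / 2) != 0) ->
  (forall k l, k != l -> cos (t k) != cos (t l)) ->
  c * chr mu t = \sum_k (2 * chr2 mu k t +
    (2 * (cos (t k / 2) / sin (t k / 2)) +
     4 * \sum_(l | l != k) sin (t k) / (cos (t l) - cos (t k)))%:C * chr1 mu k t).
Proof.
move=> hs hcos.
pose q u v := \tr (X u v *m X u v *m rho (torus t)).
have qs u v : q u v = q v u by rewrite /q (gen_sym hrho hX v u) mulmxN !mulNmx opprK.
have q0 u : q u u = 0 by rewrite /q (gen_pp hX) !mul0mx linear0.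
pose D k := chr1 mu k t.
pose f k l := (2 * (sin (t k) / (cos (t l) - cos (t k))))%:C * D k.
have cs k l : k != l -> (cos (t l) - cos (t k))%:C != 0 :> C.
  by move=> kl; rewrite eq_complex /= eqxx andbT subr_eq0 eq_sym hcos.
(* The four generators joining planes k and l carry the long roots; dividing by cos t_l - cos t_k
   splits their trace into a k part and an l part. *)
have S kl : kl.1 != kl.2 -> q (pl0 kl.1) (pl0 kl.2) + q (pl0 kl.1) (pl1 kl.2) +
    q (pl1 kl.1) (pl0 kl.2) + q (pl1 kl.1) (pl1 kl.2) = f kl.1 kl.2 + f kl.2 kl.1.
  case: kl => k l /= kl; have lk : l != k by rewrite eq_sym.
  have := mxtrace_long_root hrho Pu hmu hX kl (hcos _ _ kl).
  rewrite !(mulmxDl _ _ (rho _)) !linearD /= -/(q _ _) -/(q _ _) -/(q _ _) -/(q _ _) => h.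
  apply: (mulfI (cs _ _ kl)); rewrite h /f -/(D k) -/(D l).
  have e1 := cs _ _ kl; have e2 := cs _ _ lk.
  rewrite !rmorphM !fmorphV !rmorphB /= in e1 e2 *.
  by move: e1 e2; move: (cos (t k))%:C (cos (t l))%:C => a b e1 e2; rewrite rmorph_nat; field; rewrite e1 e2.
(* For k = l only the generator of the plane itself remains, and it occurs twice. *)
have S0 k : q (pl0 k) (pl0 k) + q (pl0 k) (pl1 k) + q (pl1 k) (pl0 k) + q (pl1 k) (pl1 k) =
    2 * chr2 mu k t.
  rewrite !q0 (qs (pl1 k)) add0r addr0 {1 2}/q (mxtrace_gen_plane_sq hrho Pu hmu hX).
  by ring.
have S2 k : q (pl0 k) (pl2 n) + q (pl1 k) (pl2 n) = (cos (t k / 2) / sin (t k / 2))%:C * D k.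
  have := mxtrace_short_root hrho Pu hmu hX k t.
  rewrite mulmxDl linearD /= -/(q _ _) -/(q _ _).
  have {1 2}-> : t k = t k / 2 + t k / 2 by field.
  have -> : 1 - cos (t k / 2 + t k / 2) = 2 * sin (t k / 2) * sin (t k / 2).
    by rewrite cosD -[X in X - _](cos2Dsin2 (t k / 2)); ring.
  have -> : sin (t k / 2 + t k / 2) = 2 * sin (t k / 2) * cos (t k / 2) by rewrite sinD; ring.
  have s0 : (sin (t k / 2))%:C != 0 :> C by rewrite eq_complex /= eqxx andbT hs.
  have -> : (cos (t k / 2) / sin (t k / 2))%:C = (cos (t k / 2))%:C / (sin (t k / 2))%:C :> C.
    by rewrite rmorphM fmorphV.
  rewrite !rmorphM /= rmorph_nat -/(D k).
  move: s0; move: (sin _)%:C (cos _)%:C => s co s0 h.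
  have s20 : 2 * s * s != 0 by rewrite !mulf_neq0 // pnatr_eq0.
  by apply: (mulfI s20); rewrite h; field.
have -> : c * chr mu t = \sum_u \sum_v q u v.
  rewrite -(mxtrace_torus Pu hmu) -mxtraceZ -mul_scalar_mx -hc /casimir mulmx_suml linear_sum /=.
  by apply: eq_bigr => u _; rewrite mulmx_suml linear_sum.
clearbody q.
rewrite sum_planes.
transitivity (\sum_k \sum_l (q (pl0 k) (pl0 l) + q (pl0 k) (pl1 l) +
    q (pl1 k) (pl0 l) + q (pl1 k) (pl1 l)) +
    \sum_k 2 * (q (pl0 k) (pl2 n) + q (pl1 k) (pl2 n))).
  rewrite [X in _ + X](_ : _ = \sum_k (q (pl0 k) (pl2 n) + q (pl1 k) (pl2 n))); last first.
    rewrite sum_planes q0 addr0; apply: eq_bigr => k _.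
    by rewrite (qs (pl2 n)) (qs (pl2 n) (pl1 k)).
  rewrite -!big_split /=; apply: eq_bigr => k _; rewrite !sum_planes.
  transitivity (\sum_l (q (pl0 k) (pl0 l) + q (pl0 k) (pl1 l)) +
     \sum_l (q (pl1 k) (pl0 l) + q (pl1 k) (pl1 l)) + 2 * (q (pl0 k) (pl2 n) + q (pl1 k) (pl2 n))).
    by ring.
  by rewrite -big_split /=; congr (_ + _); apply: eq_bigr => l _; rewrite addrA.
have -> : \sum_k \sum_l (q (pl0 k) (pl0 l) + q (pl0 k) (pl1 l) +
    q (pl1 k) (pl0 l) + q (pl1 k) (pl1 l)) =
    \sum_k (2 * chr2 mu k t + \sum_(l | l != k) (f k l + f k l)).
  (* Exchanging the roles of k and l in the double sum replaces [f l k] by [f k l]. *)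
  transitivity (\sum_k (2 * chr2 mu k t + \sum_(l | l != k) (f k l + f l k))).
    apply: eq_bigr => k _; rewrite (bigD1 k) //= S0; congr (_ + _).
    by apply: eq_bigr => l lk; rewrite (S (k, l)) // eq_sym.
  rewrite !big_split /=; congr (_ + _).
  under eq_bigr => k _ do rewrite big_split /=.
  under [RHS]eq_bigr => k _ do rewrite big_split /=.
  rewrite !big_split /=; congr (_ + _).
  rewrite (exchange_big_dep xpredT) //=; apply: eq_bigr => k _.
  by apply: eq_bigl => l; rewrite eq_sym.
rewrite -big_split /=; apply: eq_bigr => k _; rewrite S2 -addrA; congr (_ + _).
set S' := \sum_(l | _) (sin _ / _).
have -> : (2 * (cos (t k / 2) / sin (t k / 2)) + 4 * S')%:C =
    2 * (cos (t k / 2) / sin (t k / 2))%:C + 4 * S'%:C :> C.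
  by rewrite rmorphD /=; congr (_ + _); rewrite rmorphM rmorph_nat.
rewrite [RHS]mulrDl [LHS]addrC; congr (_ + _); first by rewrite mulrA.
rewrite /S' rmorph_sum /=. rewrite mulrAC mulr_sumr.
apply: eq_bigr => l lk; rewrite /f rmorphM /= rmorph_nat -/(D k).
by ring.
Qed.

End RadialEquation.

(** * The Weyl denominator and the support of its product with the character *)

Section WeylDenominator.
Variables (R : realType) (n : nat).
Local Notation C := R[i].
Local Open Scope classical_set_scope.
Local Open Scope ring_scope.
Local Open Scope complex_scope.
Implicit Types (t : 'I_n -> R) (k l : 'I_n).

(** The coordinates of the Weyl vector, half the sum of the positive roots of B_n, in increasing
    order. *)
Definition halfodd (i : nat) : R := i%:R + 2^-1.

Definition weyl_den t : R := \det (\matrix_(i < n, j < n) sin (halfodd j * t i)).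

(** The Weyl group of type B_n, as permutations with signs. *)
Definition weyl_index : finType := ('S_n * {ffun 'I_n -> bool})%type.
Definition weyl_sign (x : weyl_index) : C := (-1) ^+ x.1 * \prod_k (-1) ^+ x.2 k.
Definition weyl_exp (x : weyl_index) k : R := (-1) ^+ x.2 k * halfodd (x.1 k).

Definition weyl_sum t : C :=
  \sum_x weyl_sign x * expi (\sum_k weyl_exp x k * t k).
Definition weyl_sum1 l t : C :=
  \sum_x weyl_sign x * ('i * (weyl_exp x l)%:C * expi (\sum_k weyl_exp x k * t k)).

Lemma weyl_sign_neq0 x : weyl_sign x != 0.
Proof.
by rewrite /weyl_sign mulf_neq0 ?signr_eq0 //; apply/prodf_neq0 => k _; rewrite signr_eq0.
Qed.


(** Leibniz expansion: each sine is a difference of two exponentials over 2i, and distributing the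
    product chooses the signs. *)
Lemma weyl_sumE t : weyl_sum t = (2 * 'i) ^+ n * (weyl_den t)%:C.
Proof.
rewrite /weyl_den /determinant rmorph_sum mulr_sumr /=.
transitivity (\sum_(s : 'S_n) \sum_(e : {ffun 'I_n -> bool})
    weyl_sign (s, e) * expi (\sum_k weyl_exp (s, e) k * t k)).
  by rewrite pair_bigA /=; apply: eq_bigr => -[].
apply: eq_bigr => s _.
have -> : (2 * 'i) ^+ n = \prod_(k < n) (2 * 'i) :> C by rewrite big_const_ord iter_mulr_1.
rewrite rmorphM rmorph_prod rmorph_sign /= mulrCA -big_split /=.
have E k : 2 * 'i * ((\matrix_(i, j) sin (halfodd j * t i)) k (s k))%:C =
    \sum_(b : bool) (-1) ^+ b * expi ((-1) ^+ b * halfodd (s k) * t k) :> C.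
  rewrite mxE -expi_sin big_bool /= expr0 expr1 !mul1r !mulN1r mulNr addrC.
  by [].
under [X in _ = _ * X]eq_bigr => k _ do rewrite E.
rewrite bigA_distr_bigA mulr_sumr; apply: eq_bigr => e _.
rewrite /weyl_sign /= -mulrA; congr (_ * _).
by rewrite expi_sum -big_split.
Qed.

(** Chebyshev polynomials of the fourth kind: sin((j + 1/2) x) / sin(x / 2) as a polynomial of
    degree j in cos x. *)
Fixpoint cheb (j : nat) : {poly R} :=
  match j with
  | 0 => 1
  | 1 => 2%:P * 'X + 1
  | (j'.+1 as j1).+1 => 2%:P * 'X * cheb j1 - cheb j'
  end.

Lemma chebE j x : sin (halfodd j * x) = sin (x / 2) * (cheb j).[cos x].
Proof.
have e0 : sin (halfodd 0 * x) = sin (x / 2) * (cheb 0).[cos x].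
  by rewrite /halfodd add0r hornerE mulr1 mulrC.
have e1 : sin (halfodd 1 * x) = sin (x / 2) * (cheb 1).[cos x].
  rewrite /halfodd !hornerE mulrDl mul1r [_ * x]mulrC.
  have hx : x = x / 2 + x / 2 by field.
  rewrite {1}hx -addrA [cos x](_ : _ = cos (x / 2 + x / 2)); last by rewrite -hx.
  rewrite !sinD !cosD; have := cos2Dsin2 (x / 2).
  move: (sin (x / 2)) (cos (x / 2)) => s c cs.
  transitivity (s * (2 * (c * c - s * s) + (c ^+ 2 + s ^+ 2))); first by ring.
  by rewrite cs.
suff H : sin (halfodd j * x) = sin (x / 2) * (cheb j).[cos x] /\
    sin (halfodd j.+1 * x) = sin (x / 2) * (cheb j.+1).[cos x] by case: H.
elim: j => [//|j [IH1 IH2]]; split=> //.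
have -> : sin (halfodd j.+2 * x) = 2 * cos x * sin (halfodd j.+1 * x) - sin (halfodd j * x).
  have -> : halfodd j.+2 * x = halfodd j.+1 * x + x.
    by rewrite /halfodd -[j.+2%:R]natr1; ring.
  have -> : halfodd j * x = halfodd j.+1 * x - x.
    by rewrite /halfodd -[j.+1%:R]natr1; ring.
  by rewrite sinD sinB; ring.
rewrite IH1 IH2 [cheb j.+2]/= hornerD hornerN !hornerM hornerX hornerC; ring.
Qed.

Lemma size_cheb j : size (cheb j) = j.+1 /\ size (cheb j.+1) = j.+2.
Proof.
elim: j => [|j [IH1 IH2]].
  rewrite size_poly1; split=> //=.
  by rewrite size_MXaddC polyC_eq0 pnatr_eq0 /= size_polyC pnatr_eq0.
split=> //; rewrite [cheb j.+2]/= size_polyDl.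
  by rewrite -mulrA size_Cmul ?pnatr_eq0 // mulrC size_mulX ?IH2 // -size_poly_gt0 IH2.
rewrite size_polyN IH1 -mulrA size_Cmul ?pnatr_eq0 // mulrC size_mulX ?IH2 //.
by rewrite -size_poly_gt0 IH2.
Qed.

Definition weyl_const : R := \prod_(j < n) lead_coef (cheb j).

Lemma weyl_const_neq0 : weyl_const != 0.
Proof.
by apply/prodf_neq0 => j _; rewrite lead_coef_eq0 -size_poly_gt0 (size_cheb j).1.
Qed.

(** After sin(t_i / 2) is taken out of row i, the entries are polynomials in cos t_i whose degree
    grows by one per column, so a triangular matrix reduces the determinant to that of
    Vandermonde. *)
Lemma weyl_den_prod t : weyl_den t = weyl_const * \prod_k sin (t k / 2) *
  \prod_(i < n) \prod_(j < n | (i < j)%N) (cos (t j) - cos (t i)).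
Proof.
rewrite /weyl_den.
pose S := diag_mx (\row_(i < n) sin (t i / 2)).
pose U := \matrix_(k < n, j < n) (cheb j)`_k.
pose V := (Vandermonde n (\row_(j < n) cos (t j)))^T.
have -> : \matrix_(i < n, j < n) sin (halfodd j * t i) = S *m (V *m U).
  apply/matrixP => i j; rewrite mul_diag_mx !mxE chebE; congr (_ * _).
  rewrite (@horner_coef_wide _ n) ?(size_cheb j).1 //.
  by apply: eq_bigr => k _; rewrite !mxE mulrC.
have dU : \det U = weyl_const.
  rewrite -det_tr det_trig.
    by apply: eq_bigr => j _; rewrite !mxE lead_coefE (size_cheb j).1.
  apply/is_trig_mxP => j k jk; rewrite !mxE nth_default // (size_cheb j).1 //.
rewrite !det_mulmx det_diag dU det_tr det_Vandermonde.
rewrite (eq_bigr (fun k => sin (t k / 2))); last by move=> k _; rewrite mxE.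
rewrite [_ * weyl_const]mulrC mulrCA mulrA; congr (_ * _).
by apply: eq_bigr => i _; apply: eq_bigr => j _; rewrite !mxE.
Qed.

(** The logarithmic form of the product rule, whence the nonvanishing hypothesis. *)
Lemma is_derive_prod (I : Type) (r : seq I) (Q : pred I) (F : I -> R -> R) (D : I -> R) (x : R) :
  (forall i, Q i -> is_derive x 1 (F i) (D i)) -> (forall i, Q i -> F i x != 0) ->
  is_derive x 1 (fun s => \prod_(i <- r | Q i) F i s)
    (\prod_(i <- r | Q i) F i x * \sum_(i <- r | Q i) D i / F i x).
Proof.
move=> hF h0; elim: r => [|a r IH].
  rewrite !big_nil mulr0 (_ : (fun _ => _) = cst 1); first exact: is_derive_cst.
  by apply/funext=> s; rewrite big_nil.
case Qa : (Q a); last first.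
  rewrite (_ : (fun _ => _) = (fun s => \prod_(i <- r | Q i) F i s)).
    by rewrite !big_cons Qa.
  by apply/funext=> s; rewrite big_cons Qa.
rewrite (_ : (fun _ => _) = (fun s => F a s * \prod_(i <- r | Q i) F i s)); last first.
  by apply/funext=> s; rewrite big_cons Qa.
apply: (is_derive_eq (is_derive_mul (hF a Qa) IH)); rewrite !big_cons Qa.
by have hn0 := h0 a Qa; field.
Qed.

Definition update (t : 'I_n -> R) k (s : R) : 'I_n -> R := fun j => if j == k then s else t j.

Lemma update_id t k : update t k (t k) = t.
Proof. by apply/funext => j; rewrite /update; case: eqP => [->|]. Qed.

Definition generic t := (forall k, sin (t k / 2) != 0) /\
  (forall k l, k != l -> cos (t k) != cos (t l)).

(** The logarithmic derivative of the denominator in t_k. It is a quarter of the first order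
    coefficient in [casimir_radial], and this is why multiplying by the denominator removes the
    first order part. *)
Definition log_den t k : R := 2^-1 * (cos (t k / 2) / sin (t k / 2)) +
  \sum_(l | l != k) sin (t k) / (cos (t l) - cos (t k)).

Lemma weyl_den_derive t k : generic t ->
  is_derive (t k) 1 (fun s => weyl_den (update t k s)) (weyl_den t * log_den t k).
Proof.
move=> [g1 g2].
rewrite (_ : (fun s => _) = (fun s => weyl_const * ((\prod_j sin (update t k s j / 2)) *
  \prod_(i < n) \prod_(j < n | (i < j)%N) (cos (update t k s j) - cos (update t k s i))))); last first.
  by apply/funext => s; rewrite weyl_den_prod mulrA.
have du j : is_derive (t k) 1 (fun s => update t k s j) (j == k)%:R.
  rewrite /update; case: eqP => _; [exact: is_derive_id|exact: is_derive_cst].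
have d1 : is_derive (t k) 1 (fun s => \prod_j sin (update t k s j / 2))
    (\prod_j sin (t j / 2) * (2^-1 * (cos (t k / 2) / sin (t k / 2)))).
  have h j : is_derive (t k) 1 (fun s => sin (update t k s j / 2))
      (cos (t j / 2) * ((j == k)%:R / 2)).
    have hj : is_derive (t k) 1 (fun s => update t k s j / 2) ((j == k)%:R / 2).
      by apply: (is_derive_eq (is_derive_mul (du j) (is_derive_const _ _))); rewrite mulr0 add0r.
    by apply: (is_derive_eq (is_derive_sin_comp hj)); rewrite update_id.
  have h0 j : true -> sin (update t k (t k) j / 2) != 0 by rewrite update_id.
  apply: (is_derive_eq (is_derive_prod (index_enum _) (fun j _ => h j) h0)).
  rewrite update_id; congr (_ * _); rewrite (bigD1 k) //= big1 => [|j jk].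
    by rewrite eqxx /= mulr1n addr0; have := g1 k; move: (sin _) (cos _) => z w z0; field.
  by rewrite (negPf jk) mul0r mulr0 mul0r.
have d2 (i : 'I_n) : is_derive (t k) 1
    (fun s => \prod_(j < n | (i < j)%N) (cos (update t k s j) - cos (update t k s i)))
    (\prod_(j < n | (i < j)%N) (cos (t j) - cos (t i)) *
     \sum_(j < n | (i < j)%N) (- sin (t j) * (j == k)%:R + sin (t i) * (i == k)%:R) /
        (cos (t j) - cos (t i))).
  have h j : is_derive (t k) 1 (fun s => cos (update t k s j) - cos (update t k s i))
      (- sin (t j) * (j == k)%:R + sin (t i) * (i == k)%:R).
    have -> : (fun s => cos (update t k s j) - cos (update t k s i)) =
        (fun s => cos (update t k s j) + (-1) * cos (update t k s i)).
      by apply/funext => s; rewrite mulN1r.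
    apply: (is_derive_eq (is_derive_add (is_derive_cos_comp (du j))
      (is_derive_mul (is_derive_const _ _) (is_derive_cos_comp (du i))))).
    by rewrite update_id; ring.
  have h0 (j : 'I_n) : (i < j)%N -> cos (update t k (t k) j) - cos (update t k (t k) i) != 0.
    by move=> ij; rewrite update_id subr_eq0 g2 // -val_eqE /= gtn_eqF.
  apply: (is_derive_eq (is_derive_prod (index_enum _) (fun j _ => h j) h0)).
  by rewrite update_id.
have h0 (i : 'I_n) : true -> \prod_(j < n | (i < j)%N)
    (cos (update t k (t k) j) - cos (update t k (t k) i)) != 0.
  move=> _; apply/prodf_neq0 => j ij; rewrite update_id subr_eq0 g2 // -val_eqE /= gtn_eqF //.
have d3 := is_derive_prod (F := fun (i : 'I_n) s => \prod_(j < n | (i < j)%N)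
  (cos (update t k s j) - cos (update t k s i))) (index_enum 'I_n) (fun i _ => d2 i) h0.
(* A factor involves t_k only if one of its two indices is k; the cases i < k and k < j combine into
   the sum over all l other than k. *)
have S1E : \sum_(i < n) (\prod_(j < n | (i < j)%N) (cos (t j) - cos (t i)) *
     \sum_(j < n | (i < j)%N) (- sin (t j) * (j == k)%:R + sin (t i) * (i == k)%:R) /
     (cos (t j) - cos (t i))) / \prod_(j < n | (i < j)%N) (cos (t j) - cos (t i)) =
   \sum_(l | l != k) sin (t k) / (cos (t l) - cos (t k)).
  have nz (i : 'I_n) : \prod_(j < n | (i < j)%N) (cos (t j) - cos (t i)) != 0.
    by have := h0 i isT; rewrite update_id.
  rewrite [LHS](eq_bigr (fun i : 'I_n => \sum_(j < n | (i < j)%N)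
     (- sin (t j) * (j == k)%:R + sin (t i) * (i == k)%:R) / (cos (t j) - cos (t i)))); last first.
    by move=> i _; rewrite mulrC mulKf.
  symmetry; transitivity (\sum_(i < n | (i < k)%N) - sin (t k) / (cos (t k) - cos (t i)) +
     \sum_(j < n | (k < j)%N) sin (t k) / (cos (t j) - cos (t k))); last first.
    under [RHS]eq_bigr => i _ do under eq_bigr => j _ do rewrite mulrDl.
    under [RHS]eq_bigr => i _ do rewrite big_split /=.
    rewrite big_split /=; congr (_ + _); last first.
      rewrite [RHS](bigD1 k) //= [X in _ + X]big1 ?addr0 => [|i ik].
        by apply: eq_bigr => j _; rewrite eqxx mulr1.
      by rewrite big1 // => j _; rewrite (negPf ik) mulr0 mul0r.
    rewrite (exchange_big_dep xpredT) //= [RHS](bigD1 k) //= [X in _ + X]big1 ?addr0 => [|j jk].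
      by apply: eq_bigr => j _; rewrite eqxx mulr1.
    by rewrite big1 // => i _; rewrite (negPf jk) mulr0 mul0r.
  rewrite (bigID (fun l : 'I_n => (l < k)%N)) /=; congr (_ + _).
    apply: eq_big => [l|l /andP[lk _]]; last first.
      by rewrite -[cos (t l) - _]opprB invrN mulrN mulNr.
    by rewrite andbC; case: ltngtP => //= e; rewrite -val_eqE /= ?e // ltn_eqF // ?e.
  apply: eq_bigl => l; rewrite -leqNgt -val_eqE /=.
  by case: ltngtP.
apply: (is_derive_eq (is_derive_mul (is_derive_const _ _) (is_derive_mul d1 d3))).
rewrite update_id S1E mul0r addr0 weyl_den_prod /log_den.
by move: (\sum_(l | _) _) (\prod_j sin _) (\prod_(i < n) _) (2^-1 * _) => *; ring.
Qed.

(** Both sides are the derivative of the alternating sum in t_k, computed term by term and through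
    the product formula. *)
Lemma weyl_sum1E t k : generic t -> weyl_sum1 k t = weyl_sum t * (log_den t k)%:C.
Proof.
move=> ht.
have h1 : cderiv (fun s => weyl_sum (update t k s)) (t k) (weyl_sum1 k t).
  apply: cderiv_sum => x _.
  have hs (s : R) : \sum_j weyl_exp x j * update t k s j =
      \sum_(j | j != k) weyl_exp x j * t j + weyl_exp x k * s.
    rewrite (bigD1 k) //= /update eqxx addrC; congr (_ + _).
    by apply: eq_bigr => j /negPf ->.
  have hd : is_derive (t k) 1 (fun s => \sum_j weyl_exp x j * update t k s j) (weyl_exp x k).
    rewrite (_ : (fun s => _) = (fun s => \sum_(j | j != k) weyl_exp x j * t j + weyl_exp x k * s)).
      by apply: (is_derive_eq (is_derive_add (is_derive_const _ _) (is_derive_lin _ _))); rewrite add0r.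
    by apply/funext => s; exact: hs.
  apply: cderiv_eq (cderivM (cderiv_cst _ _) (cderiv_expi hd)) _.
  by rewrite mul0r add0r update_id.
have h2 : cderiv (fun s => weyl_sum (update t k s)) (t k) (weyl_sum t * (log_den t k)%:C).
  rewrite (_ : (fun s => _) = (fun s => (2 * 'i) ^+ n * (weyl_den (update t k s))%:C)).
    apply: cderiv_eq (cderivM (cderiv_cst _ _) (cderiv_real (weyl_den_derive k ht))) _.
    by rewrite mul0r add0r weyl_sumE rmorphM mulrA.
  by apply/funext => s; exact: weyl_sumE.
exact: cderiv_unique h1 h2.
Qed.

Definition rho_norm : R := \sum_(j < n) halfodd j ^+ 2.

(** Signed permutations preserve the norm, which makes the alternating sum an eigenfunction of the
    Laplacian. *)
Lemma weyl_exp_norm x : \sum_k weyl_exp x k ^+ 2 = rho_norm.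
Proof.
rewrite /rho_norm [RHS](reindex_inj (@perm_inj _ x.1)) /=; apply: eq_bigr => k _.
by rewrite /weyl_exp exprMn sqrr_sign mul1r.
Qed.

(** If sin a = 0 then cos a is nonzero and sin(a + b s) = cos a sin(b s), which near 0 vanishes only
    at s = 0. *)
Lemma sin_affine_neq0 (a b : R) : b != 0 -> \forall s \near 0^', sin (a + b * s) != 0.
Proof.
move=> b0; have [sa|sa] := eqVneq (sin a) 0; last first.
  have cs : continuous (fun s : R => sin (a + b * s)).
    by move=> x; apply: continuous_comp; [exact: continuous_affine|exact: continuous_sin].
  have c : sin (a + b * s) @[s --> (0 : R)^'] --> sin a.
    apply: cvg_within_filter; have := cs 0.
    by rewrite /continuous_at mulr0 addr0.
  exact: (cvgr_neq0 _ c).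
have pb : 0 < pi / `|b| by rewrite divr_gt0 ?pi_gt0 ?normr_gt0.
have n1 : \forall s \near (0 : R)^', `|s| < pi / `|b| by exact: dnbhs0_lt.
have n2 : \forall s \near (0 : R)^', s != 0 by exact: nbhs_dnbhs_neq.
near=> s.
rewrite sinD sa mul0r add0r mulf_neq0 //.
  apply: contra_eq_neq (cos2Dsin2 a) => ->; rewrite sa.
  by rewrite expr2 mulr0 addr0 eq_sym oner_neq0.
have s0 : s != 0 by near: s.
have : `|b * s| < pi by rewrite normrM mulrC -ltr_pdivlMr ?normr_gt0 //; near: s.
have : b * s != 0 by rewrite mulf_neq0.
move: (b * s) => y y0; case: (ltgtP y 0) => // hy.
  rewrite ltr0_norm // => yp; rewrite -[y]opprK sinN oppr_eq0 gt_eqF //.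
  by rewrite sin_gt0_pi // oppr_gt0 hy.
  by rewrite gtr0_norm // => yp; rewrite gt_eqF // sin_gt0_pi // hy.
by rewrite hy eqxx in y0.
Unshelve. all: by end_near.
Qed.

Lemma cos_neq (x y : R) : sin ((x + y) / 2) != 0 -> sin ((y - x) / 2) != 0 -> cos x != cos y.
Proof.
move=> h1 h2; rewrite -subr_eq0.
have -> : cos x - cos y = 2 * sin ((x + y) / 2) * sin ((y - x) / 2).
  have hx : x = (x + y) / 2 - (y - x) / 2 by field.
  have hy : y = (x + y) / 2 + (y - x) / 2 by field.
  by move: ((x + y) / 2) ((y - x) / 2) hx hy => p q -> ->; rewrite cosB cosD; ring.
by rewrite !mulf_neq0 // pnatr_eq0.
Qed.

(** The direction (1, 2, ..., n) has positive and pairwise distinct coordinates, so it is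
    transversal to every wall through t. *)
Lemma generic_near t : \forall s \near (0 : R)^', generic (fun k => t k + k.+1%:R * s).
Proof.
have n1 : \forall s \near (0 : R)^', forall k, sin ((t k + k.+1%:R * s) / 2) != 0.
  apply: filter_forall => k.
  have h : (k.+1%:R / 2 : R) != 0 by rewrite mulf_neq0 ?invr_eq0 ?pnatr_eq0.
  by apply: filterS (sin_affine_neq0 (t k / 2) h) => s; congr (sin _ != 0); ring.
have n2 : \forall s \near (0 : R)^', forall kl : 'I_n * 'I_n, kl.1 != kl.2 ->
    cos (t kl.1 + kl.1.+1%:R * s) != cos (t kl.2 + kl.2.+1%:R * s).
  apply: filter_forall => -[k l] /=.
  have [->|kl] := eqVneq k l; first by apply: filterE.
  have h1 : ((k.+1%:R + l.+1%:R) / 2 : R) != 0.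
    by rewrite -natrD mulf_neq0 ?invr_eq0 ?pnatr_eq0.
  have h2 : ((l.+1%:R - k.+1%:R) / 2 : R) != 0.
    rewrite mulf_neq0 ?invr_eq0 ?pnatr_eq0 // subr_eq0 eqr_nat eqSS.
    by rewrite eq_sym val_eqE.
  have := sin_affine_neq0 ((t k + t l) / 2) h1; have := sin_affine_neq0 ((t l - t k) / 2) h2.
  apply: filterS2 => s e1 e2 _; apply: cos_neq.
    by move: e2; congr (sin _ != 0); ring.
  by move: e1; congr (sin _ != 0); ring.
by apply: filterS2 n1 n2 => s e1 e2; split=> // k l; exact: (e2 (k, l)).
Qed.

End WeylDenominator.

(** * Linear independence of exponentials *)

Section ExponentialIndependence.
Variables (R : realType) (n : nat).
Local Notation C := R[i].
Local Notation freq := {ffun 'I_n -> R}.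

Definition ecos (v : freq) (t : 'I_n -> R) : C := expi (\sum_k v k * t k).

Lemma ecosD v s t : ecos v (fun k => s k + t k) = ecos v s * ecos v t.
Proof.
by rewrite /ecos -expiD -big_split; congr expi; apply: eq_bigr => k _; rewrite mulrDr.
Qed.

Lemma ecos_neq (v w : freq) : v != w -> exists t, ecos v t != ecos w t.
Proof.
move=> vw; have [k hk] : exists k, v k != w k.
  by apply/existsP; apply: contraNT vw => /existsPn h; apply/eqP/ffunP => k;
     apply/eqP; have := h k; rewrite negbK.
pose t (x : R) j := if j == k then x else 0.
have E (u : freq) x : ecos u (t x) = expi (u k * x).
  rewrite /ecos (bigD1 k) //= /t eqxx big1 ?addr0 // => j /negPf ->.
  by rewrite mulr0.
have vw0 : v k - w k != 0 by rewrite subr_eq0.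
exists (t (pi / (v k - w k))); rewrite !E.
have -> : v k * (pi / (v k - w k)) = pi + w k * (pi / (v k - w k)) by field.
rewrite expiD expi_pi mulN1r -subr_eq0 -opprD oppr_eq0 -mulr2n mulrn_eq0 /=.
exact: expi_neq0.
Qed.

(** Translation by a [tau] that separates v from v0, followed by subtraction, eliminates v0 and
    multiplies the coefficient of v by a nonzero number. *)
Lemma ecos_independent (F : seq freq) (S : freq -> C) : uniq F ->
  (forall t, \sum_(v <- F) S v * ecos v t = 0) -> forall v, v \in F -> S v = 0.
Proof.
elim: F S => // v0 F IH S /= /andP[v0F uF] hS.
have S0 v : v \in F -> S v = 0.
  move=> vF; have [|tau ne] := @ecos_neq v v0; first by apply: contraNneq v0F => <-.
  have := IH (fun v => S v * (ecos v tau - ecos v0 tau)) uF _ v vF.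
  move=> /(_ _)/eqP; rewrite mulf_eq0 subr_eq0 (negPf ne) orbF => h; apply/eqP/h => t.
  have h1 := hS (fun k => t k + tau k); have h2 := hS t.
  transitivity (\sum_(v <- v0 :: F) S v * ecos v (fun k => t k + tau k) -
     ecos v0 tau * \sum_(v <- v0 :: F) S v * ecos v t); last by rewrite h1 h2 mulr0 subr0.
  rewrite mulr_sumr -sumrB big_cons ecosD.
  rewrite [X in X + _](_ : _ = 0) ?add0r; last by ring.
  by apply: eq_bigr => w _; rewrite ecosD; ring.
move=> v; rewrite inE => /orP[/eqP->|/S0 //].
have := hS (fun=> 0); rewrite big_cons big_seq big1 ?addr0 => [|w wF]; last by rewrite S0 ?mul0r.
rewrite /ecos big1 ?expi0 ?mulr1 // => k _; exact: mulr0.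
Qed.

Lemma ecos_group (I : finType) (nu : I -> freq) (b : I -> C) t :
  \sum_i b i * ecos (nu i) t =
  \sum_(v <- undup [seq nu i | i <- enum I]) (\sum_(i | nu i == v) b i) * ecos v t.
Proof.
under [RHS]eq_bigr => w _ do rewrite mulr_suml.
rewrite [RHS](exchange_big_dep xpredT) //=; apply: eq_bigr => i _.
rewrite [RHS]big_mkcond (bigD1_seq (nu i)) ?undup_uniq //=; last first.
  by rewrite mem_undup; apply/mapP; exists i; rewrite ?mem_enum.
rewrite eqxx big1 ?addr0 // => w wi.
by rewrite eq_sym (negPf wi).
Qed.

(** Different pairs of a Weyl exponent and a weight can have the same sum; grouping them first makes
    [ecos_independent] applicable. *)
Lemma ecos_independent_fin (I : finType) (nu : I -> freq) (b : I -> C) :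
  (forall t, \sum_i b i * ecos (nu i) t = 0) -> forall v, \sum_(i | nu i == v) b i = 0.
Proof.
move=> h v; have [vF|vF] := boolP (v \in undup [seq nu i | i <- enum I]); last first.
  apply: big1 => i /eqP hi; move: vF; rewrite mem_undup => /negP[].
  by apply/mapP; exists i; rewrite ?mem_enum.
apply: (@ecos_independent _ (fun w => \sum_(i | nu i == w) b i) (undup_uniq _) _ _ vF) => t.
by rewrite -ecos_group h.
Qed.

End ExponentialIndependence.

(** * Dominance and signed permutations *)

Section Dominance.
Variables (R : realType) (n : nat).
Implicit Types (f g u : 'I_n -> R) (k : 'I_n).

Definition partial_sum f k : R := \sum_(i < n | (i <= k)%N) f i.

Lemma partial_sumD f g k :
  partial_sum (fun i => f i + g i) k = partial_sum f k + partial_sum g k.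
Proof. by rewrite /partial_sum big_split. Qed.

Lemma partial_sum_inj f g : partial_sum f =1 partial_sum g -> f =1 g.
Proof.
move=> h k; have [m] := ubnP k; elim: m k => // m IH k; rewrite ltnS => km.
have := h k; rewrite /partial_sum [LHS](bigD1 k) // [RHS](bigD1 k) //=.
rewrite (eq_bigr g); first exact: addIr.
move=> i /andP[ik neq]; apply: IH; apply: leq_trans km.
by rewrite ltn_neqAle ik andbT.
Qed.

Definition half_sum k : R := halfodd R (rev_ord k).

(** With c = [half_sum k], the sum over i <= k of f_i - c is at most the sum over all i of max(|f_i|
    - c, 0). The latter is the same for every signed permutation, and the decreasing order attains
    equality. *)
Lemma partial_sum_half_max f (p : 'S_n) k : (forall i, `|f i| = halfodd R (p i)) ->
  partial_sum f k <= partial_sum half_sum k.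
Proof.
move=> hf; pose c := half_sum k.
rewrite -(lerD2r (- \sum_(i < n | (i <= k)%N) c)) -!sumrB.
apply: (@le_trans _ _ (\sum_(i < n | (i <= k)%N) Num.max (`|f i| - c) 0)).
  by apply: ler_sum => i _; rewrite le_max lerD2r ler_norm.
apply: (@le_trans _ _ (\sum_(i < n) Num.max (`|f i| - c) 0)).
  rewrite [leRHS](bigID (fun i : 'I_n => (i <= k)%N)) /= lerDl sumr_ge0 // => i _.
  by rewrite le_max lexx orbT.
rewrite (eq_bigr (fun i => Num.max (halfodd R (p i) - c) 0)) => [|i _]; last by rewrite hf.
rewrite -(reindex_inj (@perm_inj _ p) (P := xpredT)
   (F := fun j : 'I_n => Num.max (halfodd R j - c) 0)) /=.
rewrite (reindex_inj rev_ord_inj) /= (bigID (fun i : 'I_n => (i <= k)%N)) /=.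
have hm (i j : 'I_n) : (half_sum i <= half_sum j) = (j <= i)%N.
  by rewrite /half_sum /halfodd lerD2r ler_nat /= leq_sub2lE ?ltn_ord // ltnS.
rewrite [X in _ + X]big1 ?addr0 => [|i ik].
  apply: ler_sum => i ik; rewrite -/(half_sum i) max_l // subr_ge0 hm //.
by rewrite -/(half_sum i) max_r // subr_le0 hm ltnW // ltnNge.
Qed.

(** Every simple root has partial sums 0 or 1. *)
Lemma partial_sum_weight_le (m la : 'I_n -> int) k : weight_le m la ->
  partial_sum (fun i => (m i)%:~R) k <= partial_sum (fun i => (la i)%:~R) k.
Proof.
move=> [c hc]; rewrite -subr_ge0 -sumrB.
rewrite (eq_bigr (fun i => (la i - m i)%:~R)) => [|i _]; last by rewrite intrB.
rewrite -[0]/(0%:~R) -(rmorph_sum (intmul 1)) ler_int.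
rewrite (eq_bigr _ (fun i _ => hc i)) (exchange_big_dep xpredT) //=.
apply: sumr_ge0 => j _; rewrite -mulr_sumr mulr_ge0 //.
rewrite /simple_root sumrB subr_ge0.
have [jk|kj] := leqP j k; last first.
  rewrite big1 => [|i /andP[ik _]]; first by apply: sumr_ge0.
  by have -> : (i == j.+1 :> nat) = false by rewrite ltn_eqF // ltnS (leq_trans ik) // ltnW.
rewrite [leRHS](bigD1 j) ?jk //= eqxx [X in _ + X]big1 ?addr0 => [|i /andP[_ /negPf->] //].
have [hj|hj] := ltnP j.+1 n; last first.
  rewrite big1 // => i _.
  by have -> : (i == j.+1 :> nat) = false by rewrite ltn_eqF // (leq_trans (ltn_ord i)).
rewrite big_mkcond (bigD1 (Ordinal hj)) //= eqxx [X in _ + X]big1 ?addr0.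
  by case: ifP.
by move=> i hi; case: ifP => // _; rewrite -(inj_eq val_inj) /= in hi; rewrite (negPf hi).
Qed.

(** Summation by parts; past the last index [g] is taken to be 0. *)
Lemma abel_summation u g : \sum_k u k * g k =
  \sum_(j < n) (g j - (if insub j.+1 is Some j' then g j' else 0)) * partial_sum u j.
Proof.
pose G i : R := if insub i is Some k then g k else 0.
have GE k : G k = g k.
  by rewrite /G; case: insubP => [k' _ /val_inj->//|]; rewrite ltn_ord.
have tel (k : 'I_n) : g k = \sum_(j < n | (k <= j)%N) (G j - G j.+1).
  have Gn : G n = 0 by rewrite /G insubF // ltnn.
  rewrite -GE -[LHS]subr0 -[X in _ - X = _]Gn.
  rewrite -opprB -telescope_sumr; last exact/ltnW/ltn_ord.
  rewrite -sumrN big_geq_mkord /=; by apply: eq_big => [j|j _]; rewrite ?andbT ?opprB.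
under eq_bigr => k _ do rewrite tel mulr_sumr.
rewrite (exchange_big_dep xpredT) //=; apply: eq_bigr => j _.
by rewrite -mulr_suml GE mulrC.
Qed.

(** The difference of the squared norms is the sum of (f - g)(f + g). Summation by parts writes it
    with positive weights, from the strict decrease of f + g, and nonnegative partial sums of f - g,
    so all these partial sums vanish. *)
Lemma dominant_eq (f g : 'I_n -> R) :
  (forall k, 0 < f k) -> (forall k l : 'I_n, (k < l)%N -> f l < f k) ->
  (forall k, 0 <= g k) -> (forall k l : 'I_n, (k <= l)%N -> g l <= g k) ->
  (forall k, partial_sum g k <= partial_sum f k) ->
  \sum_k g k ^+ 2 = \sum_k f k ^+ 2 -> g =1 f.
Proof.
move=> f0 fd g0 gd ps e; apply: partial_sum_inj => k; apply/eqP; rewrite eq_le ps /=.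
have : \sum_k (f k - g k) * (f k + g k) = 0.
  rewrite -[RHS](subrr (\sum_k f k ^+ 2)) -{2}e -sumrB.
  by apply: eq_bigr => i _; ring.
rewrite abel_summation.
have psD j : partial_sum (fun i => f i - g i) j = partial_sum f j - partial_sum g j.
  by rewrite /partial_sum sumrB.
have pos (j : 'I_n) : 0 < f j + g j - (if insub j.+1 is Some j' then f j' + g j' else 0).
  rewrite subr_gt0; case: insubP => [j' _ hj'|_]; last by rewrite ltr_wpDr.
  by apply: ltr_leD; [apply: fd|apply: gd]; rewrite hj'.
move=> /eqP; rewrite psumr_eq0 => [/allP/(_ k)|j _]; last first.
  by rewrite mulr_ge0 ?(ltW (pos j)) // psD subr_ge0.
rewrite mem_index_enum => /(_ isT) /=.
by rewrite mulf_eq0 gt_eqF ?pos //= psD subr_eq0 => /eqP ->.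
Qed.

(** Sorting the absolute values moves any vector into the dominant chamber. *)
Lemma sort_dominant (v : 'I_n -> R) : exists (s : 'S_n) (e : 'I_n -> bool),
  (forall k, 0 <= (-1) ^+ e k * v (s k)) /\
  (forall k l : 'I_n, (k <= l)%N -> (-1) ^+ e l * v (s l) <= (-1) ^+ e k * v (s k)).
Proof.
pose w := [tuple `|v i| | i < n].
have /tuple_permP[s hs] : perm_eq (sort >=%O w) w by rewrite perm_sort.
exists s, (fun k => v (s k) < 0).
have E k : (-1) ^+ (v (s k) < 0)%R * v (s k) = `|v (s k)|.
  by case: ltP => h; rewrite ?expr1 ?expr0 ?mulN1r ?mul1r ?(ltr0_norm h) ?(ger0_norm h).
split=> [k|k l kl]; rewrite !E //.
have srt : sorted >=%O (sort >=%O w) by apply: sort_sorted; exact: ge_total.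
have sz : size (sort >=%O w) = n by rewrite size_sort size_tuple.
have nE (j : 'I_n) : nth 0 (sort >=%O w) j = `|v (s j)|.
  by rewrite hs -tnth_nth !tnth_mktuple.
rewrite -!nE; apply: (sorted_leq_nth _ _ 0 srt) => //.
- by move=> x y z /= h1 h2; exact: le_trans h2 h1.
- by move=> x /=.
- by rewrite inE sz.
- by rewrite inE sz.
Qed.

End Dominance.

(** * Frequencies of the denominator times the character *)

Section WeylSupport.
Variables (R : realType) (n d : nat) (rho : 'M[R]_(n.*2.+1) -> 'M[R[i]]_d).
Hypothesis hrho : SO_representation rho.
Local Notation m := n.*2.+1.
Local Notation C := R[i].
Local Open Scope classical_set_scope.
Local Open Scope ring_scope.
Local Open Scope complex_scope.
Variables (P : 'M[C]_d) (mu : 'I_d -> 'I_n -> int).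
Hypothesis Pu : P \in unitmx.
Hypothesis hmu : forall t,
  P *m rho (torus t) = diag_mx (\row_a expi (\sum_i (mu a i)%:~R * t i)) *m P.
Variable X : 'I_m -> 'I_m -> 'M[C]_d.
Hypothesis hX : infinitesimal_rotations rho X.
Variable c : C.
Hypothesis hc : casimir X = c%:M.
Variable la : 'I_n -> int.
Hypothesis hla : is_highest_weight rho la.
Hypothesis la_ge0 : forall k, 0 <= la k.
Hypothesis la_dec : forall k l : 'I_n, (k <= l)%N -> la l <= la k.

Local Notation W := (weyl_index n).
Local Notation freq := {ffun 'I_n -> R}.

Definition shifted_freq (xa : W * 'I_d) : freq :=
  [ffun k => weyl_exp R xa.1 k + (mu xa.2 k)%:~R].

Lemma ecos_shifted xa t : ecos (shifted_freq xa) t =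
  expi (\sum_k weyl_exp R xa.1 k * t k) * expi (\sum_k (mu xa.2 k)%:~R * t k).
Proof.
rewrite -expiD -big_split /= /ecos; congr expi; apply: eq_bigr => k _.
by rewrite ffunE mulrDl.
Qed.

Lemma weyl_sum_chr t : weyl_sum t * chr mu t =
  \sum_(xa : W * 'I_d) weyl_sign R xa.1 * ecos (shifted_freq xa) t.
Proof.
rewrite /weyl_sum /chr mulr_suml.
under [LHS]eq_bigr => x _ do rewrite mulr_sumr.
rewrite pair_bigA /=; apply: eq_bigr => -[x a] _ /=.
by rewrite ecos_shifted mulrA.
Qed.

(** The eigenvalue of minus the Laplacian on delta * chi: the squared norm of the Weyl vector comes
    from delta, and only half of the Casimir scalar appears because [casimir] counts planes
    twice. *)
Let K : C := (rho_norm R n)%:C - c / 2.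
Let sqn (v : freq) : C := (\sum_k v k ^+ 2)%:C.

Let E t : C := \sum_(xa : W * 'I_d)
  weyl_sign R xa.1 * (K - sqn (shifted_freq xa)) * ecos (shifted_freq xa) t.

(** The Leibniz rule for the Laplacian of delta * chi produces twice the sum of the products of
    first derivatives. By [weyl_sum1E] this is delta times half the first order part of the radial
    equation, so only c / 2 times delta * chi is left. *)
Let E_generic t : generic t -> E t = 0.
Proof.
move=> gt; have [g1 g2] := gt.
have H1 : \sum_(xa : W * 'I_d) weyl_sign R xa.1 * sqn (shifted_freq xa) *
      ecos (shifted_freq xa) t =
    (rho_norm R n)%:C * (weyl_sum t * chr mu t) - weyl_sum t * (\sum_k chr2 mu k t) -
    2 * \sum_k weyl_sum1 k t * chr1 mu k t.
  rewrite weyl_sum_chr.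
  have -> : weyl_sum t * (\sum_k chr2 mu k t) = \sum_(xa : W * 'I_d) \sum_k
      - (((mu xa.2 k)%:~R) ^+ 2)%:C * (weyl_sign R xa.1 * ecos (shifted_freq xa) t).
    rewrite [RHS]exchange_big /= [LHS]mulr_sumr; apply: eq_bigr => k _.
    rewrite /weyl_sum /chr2 mulr_suml.
    under [LHS]eq_bigr => x _ do rewrite mulr_sumr.
    rewrite pair_bigA /=; apply: eq_bigr => -[x a] _ /=.
    by rewrite ecos_shifted /=; ring.
  have -> : \sum_k weyl_sum1 k t * chr1 mu k t = \sum_(xa : W * 'I_d) \sum_k
      - (weyl_exp R xa.1 k * (mu xa.2 k)%:~R)%:C * (weyl_sign R xa.1 * ecos (shifted_freq xa) t).
    rewrite [RHS]exchange_big /=; apply: eq_bigr => k _.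
    rewrite /weyl_sum1 /chr1 mulr_suml.
    under [LHS]eq_bigr => x _ do rewrite mulr_sumr.
    rewrite pair_bigA /=; apply: eq_bigr => -[x a] _ /=.
    rewrite ecos_shifted /= (rmorphM _ (weyl_exp R x k)) /=.
    have i2 : 'i * 'i = -1 :> C := sqr_i R.
    transitivity ('i * 'i * (weyl_exp R x k)%:C * ((mu a k)%:~R)%:C * (weyl_sign R x *
      (expi (\sum_k0 weyl_exp R x k0 * t k0) * expi (\sum_i (mu a i)%:~R * t i)))); first by ring.
    by rewrite i2; ring.
  rewrite !mulr_sumr -!sumrB; apply: eq_bigr => -[x a] _ /=.
  have key : sqn (shifted_freq (x, a)) = (rho_norm R n)%:C -
      \sum_k - (((mu a k)%:~R) ^+ 2)%:C - 2 * \sum_k - (weyl_exp R x k * (mu a k)%:~R)%:C.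
    rewrite /sqn -(weyl_exp_norm R x) !rmorph_sum /= mulr_sumr -!sumrB; apply: eq_bigr => k _.
    rewrite ffunE /=; move: (weyl_exp R x k) ((mu a k)%:~R) => y z.
    by rewrite !rmorphXn rmorphD (rmorphM _ y) /=; ring.
  by rewrite key -!mulr_suml; move: (\sum_k _) (\sum_k _) => *; ring.
have H2 := casimir_radial hrho Pu hmu hX hc g1 g2.
have H3 : 2 * \sum_k weyl_sum1 k t * chr1 mu k t + weyl_sum t * (\sum_k chr2 mu k t) =
    weyl_sum t * (c / 2 * chr mu t).
  have -> : c / 2 * chr mu t = 2^-1 * (c * chr mu t) by ring.
  rewrite H2 !mulr_sumr -big_split /=; apply: eq_bigr => k _.
  rewrite weyl_sum1E // /log_den.
  set S := \sum_(l | _) _; set q := cos _ / _.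
  have -> : (2 * q + 4 * S)%:C = 4 * (2^-1 * q + S)%:C :> C.
    rewrite (_ : 2 * q + 4 * S = 4 * (2^-1 * q + S)); last by field.
    by rewrite rmorphM rmorph_nat.
  by field.
rewrite /E; under eq_bigr => xa _ do rewrite mulrBr mulrBl.
rewrite sumrB H1; under eq_bigr => xa _ do rewrite -mulrA mulrCA.
rewrite -mulr_sumr -weyl_sum_chr /K.
transitivity (2 * \sum_k weyl_sum1 k t * chr1 mu k t + weyl_sum t * (\sum_k chr2 mu k t) -
   weyl_sum t * (c / 2 * chr mu t)); first by ring.
by rewrite H3 subrr.
Qed.

Let E0 t : E t = 0.
Proof.
have cE : ccont (fun s : R => E (fun k => t k + k.+1%:R * s)).
  apply: ccont_sum => xa; apply: ccontM; first exact: ccont_cst.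
  rewrite (_ : (fun s => _) = (fun s : R => expi (\sum_k shifted_freq xa k * t k +
     (\sum_k shifted_freq xa k * k.+1%:R) * s))).
    by apply: ccont_expi; exact: continuous_affine.
  apply/funext => s; rewrite /ecos mulr_suml -big_split /=; congr expi.
  by apply: eq_bigr => k _; rewrite mulrDr mulrA.
have := ccont_eq0 cE (a := 0).
have -> : (fun k : 'I_n => t k + k.+1%:R * 0) = t by apply/funext => k; rewrite mulr0 addr0.
by apply; apply: filterS (generic_near t) => s; exact: E_generic.
Qed.

Definition weyl_coef (v : freq) : C :=
  \sum_(xa : W * 'I_d | shifted_freq xa == v) weyl_sign R xa.1.

(** By independence of exponentials, a frequency that really occurs has squared norm [K]. *)
Lemma weyl_coef_norm v : (K - sqn v) * weyl_coef v = 0.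
Proof.
rewrite -(ecos_independent_fin E0 v) /weyl_coef mulr_sumr; apply: eq_bigr => xa /eqP ->.
by rewrite mulrC.
Qed.

(** The sum of the highest weight and the Weyl vector, in decreasing order. *)
Definition top_freq : 'I_n -> R := fun k => (la k)%:~R + half_sum R k.

Let mu_weight a : is_weight rho (mu a). Proof. by apply: (is_weight_basis Pu hmu). Qed.

Let halfodd_gt0 i : 0 < halfodd R i.
Proof. by rewrite /halfodd ltr_wpDl ?ler0n // invr_gt0 ltr0n. Qed.

Let weyl_exp_abs (x : W) k : `|weyl_exp R x k| = halfodd R (x.1 k).
Proof. by rewrite /weyl_exp normrM normr_sign mul1r gtr0_norm. Qed.

(** The Weyl group element whose exponent is the Weyl vector in decreasing order; as [halfodd]
    increases, the indices are reversed. *)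
Let x0 : W := (perm (@rev_ord_inj n), [ffun=> false]).

(** The partial sums of a Weyl exponent are bounded by those of the Weyl vector, and those of a
    weight by those of [la]. If the total attains the bound, both summands do. *)
Let top_unique (xa : W * 'I_d) : (shifted_freq xa =1 top_freq) -> xa.1 = x0 /\ mu xa.2 = la.
Proof.
move=> htop.
have p1 k := partial_sum_half_max k (weyl_exp_abs xa.1).
have p2 k := partial_sum_weight_le R k (hla.2 _ (mu_weight xa.2)).
have p3 k : partial_sum (weyl_exp R xa.1) k + partial_sum (fun i => (mu xa.2 i)%:~R) k =
    partial_sum (half_sum R (n := n)) k + partial_sum (fun i => (la i)%:~R : R) k.
  rewrite -!partial_sumD; apply: eq_bigr => i _.
  by have := htop i; rewrite ffunE => ->; rewrite /top_freq addrC.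
have e1 : weyl_exp R xa.1 =1 half_sum R (n := n).
  apply: partial_sum_inj => k; apply/eqP; rewrite eq_le p1 /=.
  by rewrite -(lerD2r (partial_sum (fun i => (mu xa.2 i)%:~R) k)) p3 lerD2l.
have e2 : mu xa.2 = la.
  apply/funext => k; have := htop k; rewrite ffunE /top_freq e1 addrC => /addIr.
  by move=> /intr_inj.
split=> //; case: (xa.1) e1 => s e e1; rewrite /x0.
have hs k : s k = rev_ord k.
  have := congr1 Num.norm (e1 k); rewrite (weyl_exp_abs (s, e)) /= /half_sum gtr0_norm //.
  by move=> /addIr/eqP; rewrite eqr_nat => /eqP/val_inj.
congr (_, _); first by apply/permP => k; rewrite permE hs.
apply/ffunP => k; rewrite ffunE; have := e1 k; rewrite /weyl_exp /half_sum /= hs.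
case: (e k) => //= /eqP; rewrite expr1 mulN1r eq_sym -addr_eq0 -mulr2n mulrn_eq0 /=.
by rewrite gt_eqF.
Qed.

(** By [top_unique] all contributions carry the sign of [x0], so the coefficient is that sign times
    the multiplicity of [la], which is positive. *)
Lemma weyl_coef_top : weyl_coef [ffun k => top_freq k] != 0.
Proof.
have -> : weyl_coef [ffun k => top_freq k] =
    weyl_sign R x0 *+ #|[pred xa : W * 'I_d | shifted_freq xa == [ffun k => top_freq k]]|.
  rewrite /weyl_coef -sumr_const; apply: eq_bigr => xa /eqP/ffunP h.
  have [|-> //] := @top_unique xa; move=> k; by rewrite h ffunE.
rewrite mulrn_eq0 negb_or weyl_sign_neq0 andbT -lt0n; apply/card_gt0P.
have [a ha] := is_weight_mem_basis Pu hmu hla.1.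
exists (x0, a); rewrite inE; apply/eqP/ffunP => k; rewrite !ffunE /= ha /top_freq addrC.
by rewrite /weyl_exp /x0 /= ffunE expr0 mul1r permE.
Qed.

(** A signed permutation makes v dominant. Its partial sums are then bounded by those of [top_freq],
    separately for the Weyl exponent and for the weight, and the norms are equal, so [dominant_eq]
    applies. *)
Lemma weyl_coef_support v : weyl_coef v != 0 -> forall k0, exists k, `|v k0| = top_freq k.
Proof.
move=> hv.
(* Since the top frequency occurs, its norm identifies the Casimir scalar. *)
have Ktop : K = sqn [ffun k => top_freq k].
  have /eqP := weyl_coef_norm [ffun k => top_freq k].
  by rewrite mulf_eq0 (negPf weyl_coef_top) orbF subr_eq0 => /eqP.
have : sqn v = sqn [ffun k => top_freq k].
  have /eqP := weyl_coef_norm v.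
  by rewrite mulf_eq0 (negPf hv) orbF subr_eq0 Ktop => /eqP.
move=> /complexI hn.
have [xa /eqP hxa] : exists xa, shifted_freq xa == v.
  by apply/existsP; apply: contraNT hv => /existsPn h; rewrite /weyl_coef big1 // => xa; rewrite (negPf (h xa)).
have [s [e [g0 gd]]] := sort_dominant v.
pose g k := (-1) ^+ e k * v (s k).
have gE : g =1 top_freq.
  apply: dominant_eq => //.
  - by move=> k; apply: ltr_wpDl; [rewrite ler0z|exact: halfodd_gt0].
  - move=> k l kl; rewrite ler_ltD // ?ler_int ?la_dec ?(ltnW kl) //.
    rewrite /half_sum /halfodd ltrD2r ltr_nat /=; apply: ltn_sub2l => //.
    exact: leq_ltn_trans kl (ltn_ord l).
  - move=> k.
    have -> : partial_sum g k = partial_sum (fun i => (-1) ^+ e i * weyl_exp R xa.1 (s i)) k +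
        partial_sum (fun i => ((-1) ^+ e i * mu xa.2 (s i))%:~R) k.
      rewrite -partial_sumD; apply: eq_bigr => i _.
      by rewrite /g -hxa ffunE mulrDr intrM rmorph_sign.
    rewrite [partial_sum top_freq k](_ : _ = partial_sum (half_sum R (n := n)) k +
       partial_sum (fun i => (la i)%:~R) k); last first.
      by rewrite -partial_sumD; apply: eq_bigr => i _; rewrite /top_freq addrC.
    apply: lerD.
      apply: (@partial_sum_half_max _ _ _ (s * xa.1.1)%g) => i.
      by rewrite normrM normr_sign mul1r weyl_exp_abs permM.
    apply: partial_sum_weight_le; apply: hla.2.
    exact: (is_weight_sign hrho e (is_weight_perm hrho s (mu_weight xa.2))).
  transitivity (\sum_k v k ^+ 2).
    rewrite [RHS](reindex_inj (@perm_inj _ s)) /=; apply: eq_bigr => k _.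
    by rewrite /g exprMn sqrr_sign mul1r.
  by rewrite hn; apply: eq_bigr => k _; rewrite ffunE.
move=> k0; exists (s^-1%g k0); rewrite -gE /g permKV.
have := g0 (s^-1%g k0); rewrite permKV => h.
by rewrite -(ger0_norm h) normrM normr_sign mul1r.
Qed.

End WeylSupport.

(** * The character at a rotation in one plane *)

Section Moments.
Variable R : realType.
Local Notation C := R[i].
Local Open Scope complex_scope.

Lemma cos_expi (x : R) : 2 * (cos x)%:C = expi x + expi (- x).
Proof.
rewrite /expi cosN sinN; apply/eqP; rewrite eq_complex /=; apply/andP.
split; apply/eqP; ring.
Qed.

(** The moments are the derivatives at 0 of an exponential sum divisible by sin(x / 2)^N. The
    induction differentiates once: the cofactor remains an exponential sum, with frequencies shifted
    by +-1/2. *)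
Lemma moments_sin_pow (N : nat) (J I : finType) (B : J -> C) (om : J -> R) (b : I -> C) (w : I -> R) :
  (forall x, \sum_j B j * expi (om j * x) =
     (sin (x / 2) ^+ N)%:C * \sum_i b i * expi (w i * x)) ->
  (forall m, (m < N)%N -> \sum_j B j * ('i * (om j)%:C) ^+ m = 0) /\
  \sum_j B j * ('i * (om j)%:C) ^+ N = (N`!%:R / 2 ^+ N)%:C * \sum_i b i.
Proof.
elim: N J I B om b w => [|N IH] J I B om b w h.
  split=> //; rewrite fact0 expr0 divr1 mul1r; have := h 0; rewrite expr0 mul1r.
  rewrite (eq_bigr B) => [|j _]; last by rewrite mulr0 expi0 mulr1.
  rewrite (eq_bigr b) => [<-|i _]; last by rewrite mulr0 expi0 mulr1.
  by apply: eq_bigr => j _; rewrite expr0 mulr1.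
pose B' j := B j * ('i * (om j)%:C).
pose I' : finType := (I * bool)%type.
(* These are the coefficients of (N + 1)/2 cos(x/2) Q + sin(x/2) Q', with Q the old cofactor and
   both half-angle functions written as exponentials. *)
pose b' (ib : I') := b ib.1 * ((N.+1%:R / 4)%:C + (-1) ^+ ib.2 * (w ib.1 / 2)%:C).
pose w' (ib : I') := w ib.1 + (-1) ^+ ib.2 * 2^-1.
have h' x : \sum_j B' j * expi (om j * x) =
     (sin (x / 2) ^+ N)%:C * \sum_ib b' ib * expi (w' ib * x).
  have d1 : cderiv (fun x => \sum_j B j * expi (om j * x)) x (\sum_j B' j * expi (om j * x)).
    apply: cderiv_sum => j _.
    apply: cderiv_eq (cderivM (cderiv_cst _ _) (cderiv_expi_lin _ _)) _.
    by rewrite mul0r add0r /B' mulrA.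
  have ds : is_derive x 1 (fun x : R => sin (x / 2)) (cos (x / 2) / 2).
    have hx : is_derive x 1 (fun x : R => x / 2) 2^-1.
      by apply: (is_derive_eq (is_derive_mul (is_derive_id x 1) (is_derive_const _ _)));
        rewrite mulr0 add0r mul1r.
    exact: (is_derive_sin_comp hx).
  have dsN : is_derive x 1 (fun x : R => sin (x / 2) ^+ N.+1)
      (N.+1%:R * sin (x / 2) ^+ N * (cos (x / 2) / 2)).
    have hX : is_derive (sin (x / 2)) 1 (fun y : R => y ^+ N.+1) (N.+1%:R * sin (x / 2) ^+ N).
      have hy := @is_deriveX _ _ id N.+1 (sin (x / 2)) 1 1 (is_derive_id _ _).
      rewrite (_ : (fun y : R => _) = id ^+ N.+1); last by apply/funext => y; rewrite exprfctE.
      by apply: (is_derive_eq hy); rewrite /GRing.scale /= mulr1 mulr_natl.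
    exact: (is_derive1_comp (g := fun x : R => sin (x / 2)) hX ds).
  have dQ : cderiv (fun x => \sum_i b i * expi (w i * x)) x
      (\sum_i b i * ('i * (w i)%:C * expi (w i * x))).
    apply: cderiv_sum => i _.
    apply: cderiv_eq (cderivM (cderiv_cst _ _) (cderiv_expi_lin _ _)) _.
    by rewrite mul0r add0r.
  have d2 := cderivM (cderiv_real dsN) dQ.
  have E := cderiv_unique d1 (cderiv_ext (fun x => esym (h x)) d2).
  have eA : (N.+1%:R * sin (x / 2) ^+ N * (cos (x / 2) / 2))%:C =
      N.+1%:R * (sin (x / 2) ^+ N)%:C * (cos (x / 2) / 2)%:C :> C.
    by rewrite !rmorphM rmorph_nat.
  have eB : (sin (x / 2) ^+ N.+1)%:C = (sin (x / 2))%:C * (sin (x / 2) ^+ N)%:C :> C.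
    by rewrite exprS rmorphM.
  rewrite E eA eB {E eA eB}.
  move: ((sin (x / 2) ^+ N)%:C) => S.
  have -> : \sum_ib b' ib * expi (w' ib * x) =
      \sum_i \sum_(c : bool) b' (i, c) * expi (w' (i, c) * x).
    by rewrite pair_bigA /=; apply: eq_bigr => -[].
  rewrite !mulr_sumr -big_split /=; apply: eq_bigr => i _.
  rewrite big_bool /b' /w' /=.
  have -> : (w i + (-1) ^+ true * 2^-1) * x = w i * x + - (x / 2) by rewrite expr1; field.
  have -> : (w i + (-1) ^+ false * 2^-1) * x = w i * x + x / 2 by rewrite expr0; field.
  rewrite !expiD expr1 expr0 mulN1r mul1r.
  have := cos_expi (x / 2).
  have : expi (x / 2) - expi (- (x / 2)) = 2 * 'i * (sin (x / 2))%:C := expi_sin (x / 2).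
  move: (expi (x / 2)) (expi (- (x / 2))) (expi (w i * x)) => e e' f hs hc.
  have i2 : 'i * 'i = -1 :> C := sqr_i R.
  have sE : (sin (x / 2))%:C = - ('i / 2 * (e - e')).
    rewrite hs; transitivity (- ('i * 'i) * (sin (x / 2))%:C); first by rewrite i2 opprK mul1r.
    by field.
  have cE : (cos (x / 2) / 2)%:C = (e + e') / 4.
    by rewrite rmorphM fmorphV rmorph_nat -hc /=; field.
  have wE : (w i / 2)%:C = (w i)%:C / 2 by rewrite rmorphM fmorphV rmorph_nat.
  have nE : (N.+1%:R / 4)%:C = N.+1%:R / 4 :> C by rewrite rmorphM fmorphV !rmorph_nat.
  rewrite sE cE wE nE.
  transitivity (S * f * b i * (N.+1%:R * ((e + e') / 4) - ('i * 'i) * ((w i)%:C / 2 * (e - e')))).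
    by ring.
  by rewrite i2; ring.
have [h1 h2] := IH J I' B' om b' w' h'; split.
  case=> [_|m]; last first.
    rewrite ltnS => /h1 e; rewrite -[RHS]e; apply: eq_bigr => j _; rewrite /B' exprS; ring.
  have := h 0; rewrite mul0r sin0 expr0n mul0r.
  by rewrite (eq_bigr (fun j => B j * ('i * (om j)%:C) ^+ 0)) // => j _; rewrite mulr0 expi0 expr0.
transitivity (\sum_j B' j * ('i * (om j)%:C) ^+ N).
  by apply: eq_bigr => j _; rewrite /B' exprS mulrA.
rewrite h2.
have -> : \sum_ib b' ib = (N.+1%:R / 2)%:C * \sum_i b i.
  transitivity (\sum_i \sum_(c : bool) b' (i, c)).
    by rewrite pair_bigA /=; apply: eq_bigr => -[].
  rewrite mulr_sumr; apply: eq_bigr => i _; rewrite big_bool /b' /= expr1 expr0.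
  have -> : (N.+1%:R / 2)%:C = (N.+1%:R / 4)%:C + (N.+1%:R / 4)%:C :> C.
    by rewrite -rmorphD; congr (_%:C); field.
  by ring.
rewrite mulrA -rmorphM; congr (_%:C * _).
rewrite factS natrM exprS; field.
by rewrite expf_neq0 ?pnatr_eq0.
Qed.

(** The moments are applied to the monic polynomial of degree #|J| - 1 that vanishes at every node
    except [om j0]. *)
Lemma lagrange_coef (J : finType) (B : J -> C) (om : J -> C) (M : C) :
  (forall m, (m < #|J|.-1)%N -> \sum_j B j * om j ^+ m = 0) ->
  \sum_j B j * om j ^+ #|J|.-1 = M ->
  forall j0, B j0 * \prod_(j | j != j0) (om j0 - om j) = M.
Proof.
move=> h0 hM j0; pose q := \prod_(j <- enum [pred j | j != j0]) ('X - (om j)%:P).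
have J0 : (0 < #|J|)%N by apply/card_gt0P; exists j0.
have sq : size q = #|J|.
  rewrite /q size_prod_XsubC -cardE -(prednK J0); congr _.+1.
  by rewrite -(cardC1 j0); apply: eq_card => j; rewrite !inE.
have qE x : q.[x] = \prod_(j | j != j0) (x - om j).
  by rewrite /q big_enum /= horner_prod; apply: eq_bigr => j _; rewrite !hornerE.
transitivity (\sum_j B j * q.[om j]).
  rewrite [RHS](bigD1 j0) //= [X in _ + X]big1 ?addr0 ?qE // => j jj0.
  by rewrite qE (bigD1 j) //= subrr mul0r mulr0.
under eq_bigr => j _ do rewrite horner_coef sq mulr_sumr.
rewrite exchange_big /=.
have lt : (#|J|.-1 < #|J|)%N by rewrite prednK.
rewrite (bigD1 (Ordinal lt)) //= [X in _ + X]big1 ?addr0 => [|m hm].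
  have q1 : q`_(#|J|.-1) = 1.
    by rewrite -sq -lead_coefE; apply/monicP; exact: monic_prod_XsubC.
  by rewrite -hM; apply: eq_bigr => j _; rewrite q1 mul1r.
transitivity (q`_m * \sum_j B j * om j ^+ m).
  by rewrite mulr_sumr; apply: eq_bigr => j _; ring.
rewrite h0 ?mulr0 // ltn_neqAle -ltnS prednK // ltn_ord andbT.
by move: hm; rewrite -(inj_eq val_inj).
Qed.

Lemma expi_neq (x y : R) : x != y -> `|x - y| < 2 * pi -> expi x != expi y.
Proof.
wlog xy : x y / y <= x.
  move=> H ne lt; have [yx|/ltW xy] := leP y x; first exact: H.
  by rewrite eq_sym; apply: H => //; [rewrite eq_sym|rewrite distrC].
move=> ne; rewrite ger0_norm ?subr_ge0 // => lt; apply: contra_neq ne => e.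
apply/eqP; rewrite -subr_eq0; apply/eqP/expi_eq1; first by rewrite subr_ge0 xy.
by rewrite expiD e -expiV mulfV // expi_neq0.
Qed.

(* Sampling at equidistant points recovers an exponential sum with given
   frequencies: this makes the span of the exponentials closed under pointwise
   limits. *)
Lemma expi_interpolation (J : finType) (om : J -> R) : injective om ->
  exists (h : R) (K : J -> 'I_#|J| -> C), forall (B : J -> C) (x : R),
    \sum_j B j * expi (om j * x) =
    \sum_j (\sum_r K j r * \sum_i B i * expi (om i * (r%:R * h))) * expi (om j * x).
Proof.
(* The step [h] keeps all differences of phases below 2 pi, so the nodes e^{i om_j h} are distinct
   and their Vandermonde matrix is invertible. *)
move=> om_inj; pose S := \sum_j `|om j|; pose h := (1 + S)^-1.
have S0 : 0 <= S by apply: sumr_ge0.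
have h0 : 0 < h by rewrite invr_gt0 ltr_wpDr.
have bnd j : `|om j| <= S by rewrite /S (bigD1 j) //= lerDl sumr_ge0.
pose z j : C := expi (om j * h).
have z_inj : injective z.
  move=> i j /eqP; apply: contraTeq => ij; apply: expi_neq.
    by rewrite (inj_eq (mulIf _)) ?(inj_eq om_inj) // gt_eqF.
  rewrite -mulrBl normrM [`|h|]gtr0_norm // /h ltr_pdivrMr ?ltr_wpDr //.
  apply: (@le_lt_trans _ _ (2 * S)).
    by rewrite (le_trans (ler_normB _ _)) // mulr_natl mulr2n lerD.
  have pi1 : 2 * S <= 2 * pi * S.
    by rewrite ler_wpM2r // ler_peMr // (le_trans _ (pi_ge2 R)) // ler1n.
  apply: (le_lt_trans pi1); rewrite (mulrDr (2 * pi)) mulr1 ltrDr mulr_gt0 ?pi_gt0 //.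
pose V : 'M[C]_#|J| := (Vandermonde #|J| (\row_j z (enum_val j)))%R.
have Vu : V \in unitmx.
  rewrite unitmxE unitfE det_Vandermonde; apply/prodf_neq0 => i _; apply/prodf_neq0 => j ij.
  rewrite !mxE subr_eq0 (inj_eq z_inj) (inj_eq enum_val_inj).
  by rewrite -val_eqE /= gtn_eqF.
exists h, (fun j r => invmx V (enum_rank j) r) => B x.
apply: eq_bigr => j _; congr (_ * _).
pose Bc : 'cV[C]_#|J| := \col_i B (enum_val i).
have VB r : (V *m Bc) r 0 = \sum_i B i * expi (om i * (r%:R * h)).
  rewrite mxE (reindex_onto enum_rank enum_val) /=; last by move=> i _; exact: enum_valK.
  apply: eq_big => [i|i _]; first by rewrite enum_rankK eqxx.
  rewrite !mxE enum_rankK mulrC; congr (_ * _).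
  by rewrite /z -expiMn; congr expi; rewrite -mulr_natl; ring.
have : Bc = invmx V *m (V *m Bc) by rewrite mulKmx.
move=> /colP/(_ (enum_rank j)); rewrite mxE enum_rankK => ->.
by rewrite mxE; apply: eq_bigr => r _; rewrite VB.
Qed.

End Moments.

(** * Letting all angles but the first tend to zero *)

Section FirstCoordinate.
Variables (R : realType) (n' d : nat).
Local Notation n := n'.+1.
Variable (rho : 'M[R]_(n.*2.+1) -> 'M[R[i]]_d).
Hypothesis hrho : SO_representation rho.
Local Notation m := n.*2.+1.
Local Notation C := R[i].
Local Open Scope classical_set_scope.
Local Open Scope ring_scope.
Local Open Scope complex_scope.
Variables (P : 'M[C]_d) (mu : 'I_d -> 'I_n -> int).
Hypothesis Pu : P \in unitmx.
Hypothesis hmu : forall t,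
  P *m rho (torus t) = diag_mx (\row_a expi (\sum_i (mu a i)%:~R * t i)) *m P.
Variable X : 'I_m -> 'I_m -> 'M[C]_d.
Hypothesis hX : infinitesimal_rotations rho X.
Variable c : C.
Hypothesis hc : casimir X = c%:M.
Variable la : 'I_n -> int.
Hypothesis hla : is_highest_weight rho la.
Hypothesis la_ge0 : forall k, 0 <= la k.
Hypothesis la_dec : forall k l : 'I_n, (k <= l)%N -> la l <= la k.

Local Notation top := (top_freq R la).
Local Notation J := ('I_n * bool)%type.

Lemma top_freq_gt0 k : 0 < top k.
Proof.
by rewrite /top_freq ltr_wpDl ?ler0z // /half_sum /halfodd ltr_wpDl ?ler0n.
Qed.

Lemma top_freq_lt (k l : 'I_n) : (k < l)%N -> top l < top k.
Proof.
move=> kl; rewrite ler_ltD // ?ler_int ?la_dec ?(ltnW kl) //.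
rewrite /half_sum /halfodd ltrD2r ltr_nat /=; apply: ltn_sub2l => //.
exact: leq_ltn_trans kl (ltn_ord l).
Qed.

Lemma top_freq_inj : injective top.
Proof.
move=> k l e; have [kl|lk|/val_inj//] := ltngtP k l.
  by have := top_freq_lt kl; rewrite e ltxx.
by have := top_freq_lt lk; rewrite e ltxx.
Qed.

Definition signed_top (j : J) : R := (-1) ^+ j.2 * top j.1.

Lemma signed_top_inj : injective signed_top.
Proof.
move=> [k b] [l b'] e; have := congr1 Num.norm e.
rewrite /signed_top !normrM !normr_sign !mul1r !gtr0_norm ?top_freq_gt0 //= => /top_freq_inj kl.
rewrite {}kl in e *; congr (_, _); move: e; rewrite /signed_top /=.
move=> /(mulIf (negbT (gt_eqF (top_freq_gt0 l)))).
exact: signr_inj.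
Qed.

Let inV (g : R -> C) := exists B : J -> C, forall x, g x = \sum_j B j * expi (signed_top j * x).

Let inV0 : inV (fun=> 0).
Proof. by exists (fun=> 0) => x; rewrite big1 // => j _; rewrite mul0r. Qed.

Let inVD g1 g2 : inV g1 -> inV g2 -> inV (fun x => g1 x + g2 x).
Proof.
move=> [B1 h1] [B2 h2]; exists (fun j => B1 j + B2 j) => x.
by rewrite h1 h2 -big_split; apply: eq_bigr => j _; rewrite mulrDl.
Qed.

Let inVZ a g : inV g -> inV (fun x => a * g x).
Proof.
move=> [B h]; exists (fun j => a * B j) => x.
by rewrite h mulr_sumr; apply: eq_bigr => j _; rewrite mulrA.
Qed.

Let inV_sum (I : eqType) (r : seq I) (g : I -> R -> C) :
  (forall i, inV (g i)) -> inV (fun x => \sum_(i <- r) g i x).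
Proof.
move=> h; elim: r => [|i r IH].
  by rewrite (_ : (fun x => _) = fun=> 0) //; apply/funext => x; rewrite big_nil.
rewrite (_ : (fun x => _) = fun x => g i x + \sum_(i <- r) g i x); first exact: inVD.
by apply/funext => x; rewrite big_cons.
Qed.

Let inV_expi j : inV (fun x => expi (signed_top j * x)).
Proof.
exists (fun i => (i == j)%:R) => x; rewrite (bigD1 j) //= eqxx mul1r big1 ?addr0 // => i /negPf ->.
by rewrite mul0r.
Qed.

(** The other angles are distinct nonzero multiples of s, so that for small nonzero s the part of
    the denominator free of x does not vanish. *)
Let curve (x s : R) : 'I_n -> R := fun k => if k == ord0 then x else k%:R * s.

(** In the first coordinate every frequency of delta * chi is, up to sign, a coordinate of
    [top_freq]; the other coordinates contribute constants in x. *)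
Let inV_weyl s : inV (fun x => weyl_sum (curve x s) * chr mu (curve x s)).
Proof.
rewrite (_ : (fun x => _) = (fun x =>
   \sum_(v <- undup [seq shifted_freq R mu i | i <- enum {: weyl_index n * 'I_d}])
   (\sum_(i | shifted_freq R mu i == v) weyl_sign R i.1) * ecos v (curve x s))); last first.
  by apply/funext => x; rewrite weyl_sum_chr (ecos_group (shifted_freq R mu)).
apply: inV_sum => v /=.
have [v0|v0] := eqVneq (weyl_coef mu v) 0.
  rewrite (_ : (fun x => _) = fun=> 0); first exact: inV0; apply/funext => x.
  by rewrite -/(weyl_coef mu v) v0 mul0r.
have [k hk] := weyl_coef_support hrho Pu hmu hX hc hla la_ge0 la_dec v0 ord0.
have [j hj] : exists j, v ord0 = signed_top j.
  exists (k, v ord0 < 0); rewrite /signed_top /= -hk.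
  by case: ltP => h; rewrite ?expr1 ?expr0 ?mulN1r ?mul1r ?(ltr0_norm h) ?(ger0_norm h) ?opprK.
have E x : ecos v (curve x s) = expi (\sum_(i < n') v (lift ord0 i) * (i.+1%:R * s)) *
    expi (signed_top j * x).
  by rewrite /ecos big_ord_recl hj -expiD addrC; congr (expi (_ + _)).
under eq_fun do rewrite E mulrA.
by apply: inVZ; exact: inV_expi.
Qed.

(** Along [curve] the denominator splits into [A s], which is free of x and may vanish at s = 0, and
    [g0], whose value at s = 0 is a multiple of sin(x / 2)^(2n-1). *)
Let g0 (x s : R) : R := sin (x / 2) * \prod_(j < n') (cos (j.+1%:R * s) - cos x).
Let A (s : R) : R := weyl_const R n * \prod_(k < n') sin (k.+1%:R * s / 2) *
  \prod_(i < n') \prod_(j < n' | (i < j)%N) (cos (j.+1%:R * s) - cos (i.+1%:R * s)).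

Let weyl_den_curve x s : weyl_den (curve x s) = A s * g0 x s.
Proof.
rewrite weyl_den_prod 2!big_ord_recl /A /g0.
have e0 : curve x s ord0 = x by [].
have e1 i : curve x s (lift ord0 i) = i.+1%:R * s by [].
rewrite e0; under eq_bigr => i _ do rewrite e1.
rewrite [X in _ * (X * _)](_ : _ = \prod_(j < n') (cos (j.+1%:R * s) - cos x)); last first.
  rewrite big_mkcond big_ord_recl /= mul1r; apply: eq_bigr => j _; by rewrite e1.
rewrite [X in _ * (_ * X)](_ : _ = \prod_(i < n') \prod_(j < n' | (i < j)%N)
    (cos (j.+1%:R * s) - cos (i.+1%:R * s))); last first.
  apply: eq_bigr => i _; rewrite big_mkcond big_ord_recl /= mul1r.
  rewrite [RHS]big_mkcond; apply: eq_bigr => j _; by rewrite /bump /= !add1n ltnS e1.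
by move: (\prod_(j < n') _) (\prod_(j < n') _) (\prod_(j < n') _) => *; ring.
Qed.

Let A_near : \forall s \near (0 : R)^', A s != 0.
Proof.
have n1 : \forall s \near (0 : R)^', forall k : 'I_n', sin (k.+1%:R * s / 2) != 0.
  apply: filter_forall => k.
  have h : (k.+1%:R / 2 : R) != 0 by rewrite mulf_neq0 ?invr_eq0 ?pnatr_eq0.
  by apply: filterS (sin_affine_neq0 0 h) => s; congr (sin _ != 0); ring.
have n2 : \forall s \near (0 : R)^', forall kl : 'I_n' * 'I_n', kl.1 != kl.2 ->
    cos (kl.1.+1%:R * s) != cos (kl.2.+1%:R * s).
  apply: filter_forall => -[k l] /=.
  have [->|kl] := eqVneq k l; first by apply: filterE.
  have h1 : ((k.+1%:R + l.+1%:R) / 2 : R) != 0.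
    by rewrite -natrD mulf_neq0 ?invr_eq0 ?pnatr_eq0.
  have h2 : ((l.+1%:R - k.+1%:R) / 2 : R) != 0.
    rewrite mulf_neq0 ?invr_eq0 ?pnatr_eq0 // subr_eq0 eqr_nat eqSS.
    by rewrite eq_sym val_eqE.
  have := sin_affine_neq0 0 h1; have := sin_affine_neq0 0 h2.
  apply: filterS2 => s e1 e2 _; apply: cos_neq.
    by move: e2; congr (sin _ != 0); ring.
  by move: e1; congr (sin _ != 0); ring.
apply: filterS2 n1 n2 => s e1 e2; rewrite /A !mulf_neq0 ?weyl_const_neq0 //.
  by apply/prodf_neq0 => k _.
apply/prodf_neq0 => i _; apply/prodf_neq0 => j ij; rewrite subr_eq0.
by apply: (e2 (j, i)); rewrite /= -val_eqE /= gtn_eqF.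
Qed.

Let G x s : C := (g0 x s)%:C * chr mu (curve x s).

Let inV_G s : A s != 0 -> inV (fun x => G x s).
Proof.
move=> A0; have [B hB] := inV_weyl s.
have nz : (2 * 'i) ^+ n * (A s)%:C != 0 :> C.
  rewrite mulf_neq0 ?expf_neq0 //.
    by rewrite mulf_neq0 ?pnatr_eq0 // eq_complex /= oner_eq0 andbF.
  by rewrite eq_complex /= eqxx andbT.
exists (fun j => ((2 * 'i) ^+ n * (A s)%:C)^-1 * B j) => x.
apply: (mulfI nz); rewrite mulr_sumr.
under eq_bigr => j _ do rewrite mulrA mulVKf //.
by rewrite -hB weyl_sumE weyl_den_curve (rmorphM _ (A s) (g0 x s)) /G !mulrA.
Qed.

Let ccont_G x : ccont (G x).
Proof.
have cc (a : R) : continuous (fun s : R => a * s).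
  by move=> y; have := @continuous_affine R 0 a y; rewrite (_ : (fun s => 0 + a * s) = (fun s => a * s)) //;
    apply/funext => s; rewrite add0r.
apply: ccontM.
  rewrite (_ : (fun s => _) = (fun s => (sin (x / 2))%:C *
     \prod_(j < n') ((cos (j.+1%:R * s))%:C + (- cos x)%:C))); last first.
    apply/funext => s; rewrite /g0 rmorphM rmorph_prod; congr (_ * _).
    by apply: eq_bigr => j _; rewrite rmorphB rmorphN.
  apply: ccontM; first exact: ccont_cst.
  apply: ccont_prod => j; apply: ccontD; last exact: ccont_cst.
  apply: ccontR => y; apply: continuous_comp; [exact: cc|exact: continuous_cos].
apply: ccont_sum => a; rewrite (_ : (fun s => _) = (fun s => expi ((mu a ord0)%:~R * x +
    (\sum_(i < n') (mu a (lift ord0 i))%:~R * i.+1%:R) * s))).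
  by apply: ccont_expi; exact: continuous_affine.
apply/funext => s; rewrite big_ord_recl mulr_suml; congr (expi (_ + _)).
by apply: eq_bigr => i _; rewrite -mulrA.
Qed.

Let G0 x : G x 0 = (2 ^+ n')%:C * ((sin (x / 2) ^+ n'.*2.+1)%:C * chr mu (coord_fun ord0 x)).
Proof.
have -> : G x 0 = (g0 x 0)%:C * chr mu (coord_fun ord0 x).
  rewrite /G; congr (_ * chr mu _); apply/funext => k; rewrite /curve /coord_fun.
  by case: eqP; rewrite ?mulr0.
rewrite mulrA -rmorphM; congr (_%:C * _); rewrite /g0.
have -> : \prod_(j < n') (cos (j.+1%:R * 0) - cos x) = (2 * sin (x / 2) ^+ 2) ^+ n'.
  rewrite -[n' in RHS]card_ord -prodr_const; apply: eq_bigr => j _; rewrite mulr0 cos0.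
  have {1}-> : x = x / 2 + x / 2 by field.
  by rewrite cosD -[X in X - _](cos2Dsin2 (x / 2)); ring.
by rewrite exprMn -exprM mul2n exprS; ring.
Qed.

(** For s near 0 but nonzero, [G x s] lies in the span of the exponentials. The interpolation
    identity involves finitely many values of [G], so it passes to s = 0 by continuity. *)
Lemma chr_in_span : exists B : J -> C, forall x,
  \sum_j B j * expi (signed_top j * x) =
  (sin (x / 2) ^+ n'.*2.+1)%:C * \sum_a 1 * expi ((mu a ord0)%:~R * x).
Proof.
have [h [K hK]] := expi_interpolation signed_top_inj.
have E x : G x 0 = \sum_j (\sum_r K j r * G (r%:R * h) 0) * expi (signed_top j * x).
  pose D s := G x s + (-1) * \sum_j (\sum_r K j r * G (r%:R * h) s) * expi (signed_top j * x).
  suff : D 0 = 0 by rewrite /D mulN1r => /eqP; rewrite subr_eq0 => /eqP.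
  apply: ccont_eq0.
    apply: ccontD; first exact: ccont_G.
    apply: ccontM; first exact: ccont_cst.
    apply: ccont_sum => j; apply: ccontM; last exact: ccont_cst.
    by apply: ccont_sum => r; apply: ccontM; [exact: ccont_cst|exact: ccont_G].
  apply: filterS A_near => s /inV_G[B hB]; rewrite /D hB hK mulN1r.
  apply/eqP; rewrite subr_eq0; apply/eqP; apply: eq_bigr => j _; congr (_ * _).
  by apply: eq_bigr => r _; rewrite hB.
have nz : (2 ^+ n')%:C != 0 :> C.
  by rewrite eq_complex /= eqxx andbT expf_neq0 ?pnatr_eq0.
exists (fun j => ((2 ^+ n')%:C)^-1 * \sum_r K j r * G (r%:R * h) 0) => x.
apply: (mulfI nz); rewrite [LHS]mulr_sumr.
under [LHS]eq_bigr => j _ do rewrite mulrA mulVKf //.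
rewrite -E G0; congr (_ * (_ * _)); apply: eq_bigr => a _; rewrite mul1r; congr expi.
rewrite (bigD1 ord0) //= big1 ?addr0 => [|l lk]; rewrite /coord_fun ?eqxx //.
by rewrite (negPf lk) mulr0.
Qed.

(** The factor of opposite sign gives 2 [signed_top j0], and the others pair into differences of
    squares. The sign in i^(2n-2) reverses the order of these n - 1 differences. *)
Lemma prod_signed_top (j0 : J) : \prod_(j | j != j0) ('i * (signed_top j0)%:C - 'i * (signed_top j)%:C) =
  'i * (2 * signed_top j0 * \prod_(l | l != j0.1) (top l ^+ 2 - top j0.1 ^+ 2))%:C.
Proof.
have i2 : 'i * 'i = -1 :> C := sqr_i R.
have -> : \prod_(j | j != j0) ('i * (signed_top j0)%:C - 'i * (signed_top j)%:C) =
    'i ^+ n'.*2.+1 * (\prod_(j | j != j0) (signed_top j0 - signed_top j))%:C.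
  rewrite rmorph_prod (eq_bigr (fun j => 'i * (signed_top j0 - signed_top j)%:C)); last first.
    by move=> j _; rewrite rmorphB mulrBr.
  rewrite big_split /= prodr_const; congr ('i ^+ _ * _).
  by rewrite cardC1 card_prod card_bool card_ord muln2.
case: j0 => k b /=.
have -> : \prod_(j | j != (k, b)) (signed_top (k, b) - signed_top j) =
    2 * signed_top (k, b) * \prod_(l | l != k) (top k ^+ 2 - top l ^+ 2).
  rewrite (bigD1 (k, ~~ b)) /=; last by rewrite xpair_eqE eqxx; case: (b).
  congr (_ * _); first by rewrite /signed_top /=; case: (b); rewrite ?expr1 ?expr0; ring.
  rewrite (eq_bigl (fun j : J => (j.1 != k) && true)); last first.
    by move=> [l b'] /=; rewrite !xpair_eqE andbT; case: (l == k) => //=; case: (b); case: (b').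
  rewrite -(pair_big (fun l => l != k) xpredT (fun l b' => signed_top (k, b) - signed_top (l, b'))) /=.
  apply: eq_bigr => l _; rewrite big_bool /signed_top /=.
  by case: (b); rewrite ?expr1 ?expr0; ring.
have -> : \prod_(l | l != k) (top k ^+ 2 - top l ^+ 2) =
    (-1) ^+ n' * \prod_(l | l != k) (top l ^+ 2 - top k ^+ 2).
  rewrite (eq_bigr (fun l => (-1) * (top l ^+ 2 - top k ^+ 2))); last by move=> l _; ring.
  by rewrite big_split /= prodr_const cardC1 card_ord.
have -> : 'i ^+ n'.*2.+1 = 'i * ((-1) ^+ n')%:C :> C.
  by rewrite exprS -mul2n exprM expr2 i2 rmorphXn rmorphN1.
rewrite -mulrA -rmorphM; congr ('i * _%:C).
by rewrite mulrCA [_ * (_ * \prod_(l | _) _)]mulrA -signr_odd mulrCA !mulrA -expr2 sqrr_sign mul1r.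
Qed.

Lemma prod_top_neq0 k : \prod_(l | l != k) (top l ^+ 2 - top k ^+ 2) != 0.
Proof.
apply/prodf_neq0 => l lk; rewrite subr_eq0 eqrXn2 ?ltW ?top_freq_gt0 //.
by rewrite (inj_eq top_freq_inj).
Qed.

(** Lagrange coefficients at opposite frequencies are opposite, so each pair of exponentials becomes
    a sine. The factor d is the sum of the coefficients 1 in [chr_in_span], one for each basis
    weight. *)
Lemma chr_first_coord x :
  (sin (x / 2) ^+ n'.*2.+1)%:C * chr mu (coord_fun ord0 x) =
  ((n'.*2.+1)`!%:R / 2 ^+ n'.*2.+1 * d%:R *
   \sum_k sin (top k * x) / (top k * \prod_(l | l != k) (top l ^+ 2 - top k ^+ 2)))%:C.
Proof.
have i0 : 'i != 0 :> C by rewrite eq_complex /= oner_eq0 andbF.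
have [B hB] := chr_in_span.
have [h1 h2] := moments_sin_pow hB.
have cJ : #|{: J}|.-1 = n'.*2.+1.
  by rewrite card_prod card_bool card_ord muln2.
have BE M := @lagrange_coef R _ B (fun j => 'i * (signed_top j)%:C) M.
rewrite cJ in BE; have {}BE := BE _ h1 h2.
have -> : chr mu (coord_fun ord0 x) = \sum_a 1 * expi ((mu a ord0)%:~R * x).
  apply: eq_bigr => a _; rewrite mul1r; congr expi.
  rewrite (bigD1 ord0) //= big1 ?addr0 => [|l lk]; rewrite /coord_fun ?eqxx //.
  by rewrite (negPf lk) mulr0.
rewrite -hB.
have -> : \sum_j B j * expi (signed_top j * x) =
    \sum_k \sum_b B (k, b) * expi (signed_top (k, b) * x).
  by rewrite pair_bigA /=; apply: eq_bigr => -[].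
rewrite [in RHS]mulr_sumr rmorph_sum; apply: eq_bigr => k _.
have Q0 := prod_top_neq0 k; have t0 := lt0r_neq0 (top_freq_gt0 k).
have BkE b : B (k, b) = ((n'.*2.+1)`!%:R / 2 ^+ n'.*2.+1)%:C * d%:R /
    ('i * (2 * signed_top (k, b) * \prod_(l | l != k) (top l ^+ 2 - top k ^+ 2))%:C).
  have := BE (k, b); rewrite prod_signed_top sumr_const card_ord /= => <-.
  rewrite mulfK // mulf_neq0 // fmorph_eq0 !mulf_neq0 ?pnatr_eq0 //.
  by rewrite /signed_top /= signr_eq0.
rewrite big_bool /= !BkE /signed_top /=.
move: (\prod_(l | l != k) _) Q0 => Q Q0.
rewrite expr1 expr0 mul1r mulN1r mulNr.
move: (top k) t0 => t t0.
have xE (y : R) : expi y = (cos y)%:C + 'i * (sin y)%:C.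
  by apply: eqC; rewrite /= !(mul0r, mulr0, mul1r, subr0, addr0, add0r).
rewrite !xE cosN sinN.
rewrite !(rmorphM, rmorphN, fmorphV, rmorph_nat, rmorphXn).
have Q0' : Q%:C != 0 by rewrite fmorph_eq0.
have t0' : t%:C != 0 by rewrite fmorph_eq0.
have p0' : (2 ^+ n'.*2.+1) != 0 :> C by rewrite expf_neq0 ?pnatr_eq0.
move: (2 ^+ n'.*2.+1) p0' => p p0'.
field.
by rewrite i0 Q0' t0' p0' ?pnatr_eq0.
Qed.

End FirstCoordinate.

(** * The Fourier integral *)

Section IntegralValues.
Variable R : realType.
Local Open Scope classical_set_scope.
Local Open Scope ring_scope.
Local Notation mu := (@lebesgue_measure R).
Implicit Types (D : set (measurableTypeR R)) (f g : R -> R).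

(** Integrability and value are carried together, because linearity of the integral needs both. *)
Definition has_integral (D : set (measurableTypeR R)) f v :=
  mu.-integrable D (EFin \o f) /\ (\int[mu]_(x in D) (f x)%:E)%E = v%:E.

Lemma has_integral_Rintegral D f v : has_integral D f v -> \int[mu]_(x in D) f x = v.
Proof. by move=> [_ e]; rewrite /Rintegral e. Qed.

Lemma has_integral_eq D f g v : measurable D -> (forall x, D x -> f x = g x) ->
  has_integral D f v -> has_integral D g v.
Proof.
move=> mD e [h1 h2]; split.
  by move: h1; apply: eq_integrable => // x; rewrite inE /= => /e ->.
by rewrite -h2; apply: eq_integral => x; rewrite inE => /e ->.
Qed.

Lemma has_integralZ D f v k : measurable D ->
  has_integral D f v -> has_integral D (fun x => k * f x) (k * v).
Proof.
move=> mD [h1 h2]; split.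
  rewrite (_ : EFin \o _ = (fun x => k%:E * (EFin \o f) x)%E); first exact: integrableZl.
  by apply/funext => x; rewrite /= EFinM.
under eq_integral do rewrite EFinM.
by rewrite integralZl // h2 EFinM.
Qed.

Lemma has_integralD D f g u v : measurable D ->
  has_integral D f u -> has_integral D g v -> has_integral D (fun x => f x + g x) (u + v).
Proof.
move=> mD [h1 h2] [h3 h4]; split.
  rewrite (_ : EFin \o _ = (EFin \o f) \+ (EFin \o g))%E; first exact: integrableD.
  by apply/funext => x; rewrite /= EFinD.
under eq_integral do rewrite EFinD.
by rewrite (integralD mD h1 h3) h2 h4 EFinD.
Qed.

Lemma has_integral0 D : has_integral D (fun=> 0) 0.
Proof. by split; [exact: integrable0|exact: integral0]. Qed.

Lemma has_integral_sum D (I : Type) (r : seq I) (F : I -> R -> R) v : measurable D ->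
  (forall i, has_integral D (F i) (v i)) ->
  has_integral D (fun x => \sum_(i <- r) F i x) (\sum_(i <- r) v i).
Proof.
move=> mD h; elim: r => [|i r IH].
  by rewrite big_nil; apply: has_integral_eq (has_integral0 D) => // x _; rewrite big_nil.
rewrite big_cons; apply: has_integral_eq (has_integralD mD (h i) IH) => // x _.
by rewrite big_cons.
Qed.

Lemma is_derive_expR_comp f (x a : R) : is_derive x 1 f a ->
  is_derive x 1 (fun s => expR (f s)) (expR (f x) * a).
Proof. by move=> hf; exact: (is_derive1_comp (is_derive_expR _) hf). Qed.

Lemma cvg_expRN (a : R) : 0 < a -> expR (- a * y) @[y --> +oo] --> 0.
Proof.
move=> a0.
rewrite (_ : (fun y => _) = (fun z => expR (- z)) \o (fun z => a * z)); last first.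
  by apply/funext => y; rewrite /= mulNr.
apply: (@cvg_comp _ _ _ _ _ _ (pinfty_nbhs R)); last exact: cvgr_expR.
exact: gt0_cvgMry.
Qed.

Local Notation D0 := (`[0%R, +oo[%classic : set (measurableTypeR R)).
Let mD0 : measurable D0. Proof. exact: measurable_itv. Qed.

Lemma cosD1_ge0 (x : R) : 0 <= 1 + cos x.
Proof. by have /ler_normlP[h _] := cos_max x; rewrite -lerBlDl sub0r lerNl. Qed.

(** Adding 1 makes the integrand nonnegative, as the fundamental theorem on a half-line used here
    requires. The extra exponential is subtracted in [has_integral_exp_cos]. *)
Lemma integral_exp_cos1 (a v c : R) : 0 < a ->
  (\int[mu]_(y in D0) (expR (- a * y) * (1 + cos (v * y + c)))%:E)%E =
  (a^-1 + (a * cos c - v * sin c) / (a ^+ 2 + v ^+ 2))%:E.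
Proof.
move=> a0; have av0 : a ^+ 2 + v ^+ 2 != 0 by rewrite gt_eqF // ltr_pwDl ?exprn_gt0 ?sqr_ge0.
pose F y := expR (- a * y) *
  (- a^-1 + (a ^+ 2 + v ^+ 2)^-1 * (v * sin (v * y + c) + (- a) * cos (v * y + c))).
have dlin k e (y : R) : is_derive y 1 (fun s => k * s + e) k.
  rewrite -[X in is_derive _ _ _ X]addr0.
  exact: is_derive_add (is_derive_lin k y) (is_derive_const e y).
have dexp (y : R) : is_derive y 1 (fun s => expR (- a * s)) (expR (- a * y) * - a).
  exact: is_derive_expR_comp (is_derive_lin _ _).
have dF (y : R) : is_derive y 1 F (expR (- a * y) * (1 + cos (v * y + c))).
  apply: (is_derive_eq (is_derive_mul (dexp y) (is_derive_add (is_derive_const _ y)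
    (is_derive_mul (is_derive_const _ y) (is_derive_add
      (is_derive_mul (is_derive_const v y) (is_derive_sin_comp (dlin v c y)))
      (is_derive_mul (is_derive_const (- a) y) (is_derive_cos_comp (dlin v c y)))))))).
  by rewrite /=; field; rewrite av0 gt_eqF.
have cf : continuous (fun y => expR (- a * y) * (1 + cos (v * y + c))).
  move=> y; apply: (is_derive_continuous (is_derive_mul (dexp y)
    (is_derive_add (is_derive_const 1 y) (is_derive_cos_comp (dlin v c y))))).
rewrite (@ge0_continuous_FTC2y R _ F 0 0).
- rewrite -EFinD; congr EFin; rewrite /F !mulr0 expR0 !add0r mul1r.
  by field; rewrite av0 gt_eqF.
- by move=> y _; apply: mulr_ge0; [exact: expR_ge0|exact: cosD1_ge0].
- exact: continuous_subspaceT.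
- have K0 : 0 <= a^-1 + (a ^+ 2 + v ^+ 2)^-1 * (`|v| + a).
    by rewrite addr_ge0 ?mulr_ge0 ?invr_ge0 ?addr_ge0 ?sqr_ge0 ?(ltW a0).
  apply/norm_cvg0P; apply: (@squeeze_cvgr _ _ _ _ (fun=> 0)
      (fun y => expR (- a * y) * (a^-1 + (a ^+ 2 + v ^+ 2)^-1 * (`|v| + a)))).
  + apply: nearW => y; rewrite normr_ge0 /= normrM ger0_norm ?expR_ge0 //.
    apply: ler_wpM2l; first exact: expR_ge0.
    apply: le_trans (ler_normD _ _) _.
    rewrite normrN gtr0_norm ?invr_gt0 // lerD2l normrM ger0_norm; last first.
      by rewrite invr_ge0 addr_ge0 ?sqr_ge0.
    apply: ler_wpM2l; first by rewrite invr_ge0 addr_ge0 ?sqr_ge0.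
    apply: le_trans (ler_normD _ _) _; rewrite !normrM normrN (gtr0_norm a0).
    by apply: lerD; apply: ler_piMr; rewrite ?normr_ge0 ?(ltW a0) ?sin_max ?cos_max.
  + exact: cvg_cst.
  + rewrite -[X in _ --> X](mul0r (a^-1 + (a ^+ 2 + v ^+ 2)^-1 * (`|v| + a))).
    by apply: cvgMr_tmp; exact: cvg_expRN.
- by move=> y _; have [] := dF y.
- by apply: cvg_at_right_filter; exact: is_derive_continuous (dF 0).
- by move=> y _; rewrite derive1E; have [] := dF y.
Qed.


Lemma has_integral_ge0 D f v : measurable D -> measurable_fun D f ->
  (forall x, D x -> 0 <= f x) -> (\int[mu]_(x in D) (f x)%:E)%E = v%:E -> has_integral D f v.
Proof.
move=> mD mf f0 e; split=> //; apply/integrableP; split; first exact/measurable_EFinP.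
under eq_integral => x.
  by rewrite inE => Dx; rewrite /= ger0_norm ?f0 //; over.
by rewrite e ltry.
Qed.

Lemma continuous_measurableW D f : measurable D -> continuous f -> measurable_fun D f.
Proof.
by move=> mD cf; apply: measurable_funTS; exact: continuous_measurable_fun.
Qed.

Lemma continuous_lin (k : R) : continuous (fun y : R => k * y).
Proof. by move=> y; exact: is_derive_continuous (is_derive_lin k y). Qed.

Lemma continuous_expRM (k : R) : continuous (fun y => expR (k * y)).
Proof. by move=> y; exact: is_derive_continuous (is_derive_expR_comp (is_derive_lin k y)). Qed.

Lemma continuous_exp_cosD1 (a v c : R) : continuous (fun y => expR (a * y) * (1 + cos (v * y + c))).
Proof.
move=> y; exact: (is_derive_continuous (is_derive_mul
  (is_derive_expR_comp (is_derive_lin a y)) (is_derive_add (is_derive_const 1 y)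
  (is_derive_cos_comp (is_derive_add (is_derive_lin v y) (is_derive_const c y)))))).
Qed.

Lemma has_integral_exp (a : R) : 0 < a -> has_integral D0 (fun y => expR (- a * y)) a^-1.
Proof.
(* With v = 0 and phase pi / 2 the cosine term is zero. *)
move=> a0; have := @integral_exp_cos1 a 0 (pi / 2) a0.
rewrite cos_pihalf mulr0 mul0r subr0 mul0r addr0.
under eq_integral => y _ do rewrite mul0r add0r cos_pihalf addr0 mulr1.
move=> h; apply: has_integral_ge0 => //.
exact: (continuous_measurableW mD0 (@continuous_expRM (- a))).
Qed.

Lemma has_integral_exp_cos (a v c : R) : 0 < a ->
  has_integral D0 (fun y => expR (- a * y) * cos (v * y + c))
    ((a * cos c - v * sin c) / (a ^+ 2 + v ^+ 2)).
Proof.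
move=> a0; have h1 : has_integral D0 (fun y => expR (- a * y) * (1 + cos (v * y + c)))
    (a^-1 + (a * cos c - v * sin c) / (a ^+ 2 + v ^+ 2)).
  apply: has_integral_ge0 (integral_exp_cos1 v c a0) => [//||x _].
    exact: (continuous_measurableW mD0 (@continuous_exp_cosD1 (- a) v c)).
  by rewrite mulr_ge0 ?expR_ge0 ?cosD1_ge0.
have := has_integralD mD0 h1 (has_integralZ (-1) mD0 (has_integral_exp a0)).
rewrite mulN1r addrAC subrr add0r => h2; apply: has_integral_eq h2 => // x _; ring.
Qed.

Lemma ge0_has_integral_even f v : (forall x, 0 <= f x) -> continuous f ->
  (forall x, f (- x) = f x) -> (\int[mu]_(x in D0) (f x)%:E)%E = v%:E ->
  has_integral setT f (2 * v).
Proof.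
move=> f0 cf ef e; apply: has_integral_ge0 => //; first exact: (continuous_measurableW measurableT cf).
rewrite ge0_symfun_integralT //; last by move=> x; rewrite /= ef.
by rewrite -set_itvcy e EFinM.
Qed.

Lemma continuous_expRN_norm (a : R) : continuous (fun t : R => expR (- a * `|t|)).
Proof.
move=> t; apply: (continuous_comp (f := fun t : R => `|t|) (g := fun y => expR (- a * y))).
  exact: norm_continuous.
exact: continuous_expRM.
Qed.

Lemma has_integral_expN_norm (a : R) : 0 < a ->
  has_integral setT (fun t : R => expR (- a * `|t|)) (2 * a^-1).
Proof.
move=> a0; apply: ge0_has_integral_even => [x||x|].
- exact: expR_ge0.
- exact: continuous_expRN_norm.
- by rewrite normrN.
- rewrite -(has_integral_exp a0).2; apply: eq_integral => x.
  by rewrite inE /= in_itv /= andbT => x0; rewrite ger0_norm.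
Qed.

(** The Fourier transform of e^{-a|t|}, that is the Poisson kernel. *)
Lemma has_integral_expN_norm_cos (a v : R) : 0 < a ->
  has_integral setT (fun t : R => expR (- a * `|t|) * cos (v * t)) (2 * a / (a ^+ 2 + v ^+ 2)).
Proof.
move=> a0.
have h : has_integral setT (fun t : R => expR (- a * `|t|) * (1 + cos (v * t)))
    (2 * (a^-1 + (a * cos 0 - v * sin 0) / (a ^+ 2 + v ^+ 2))).
  apply: ge0_has_integral_even => [x||x|].
  - by rewrite mulr_ge0 ?expR_ge0 ?cosD1_ge0.
  - move=> t; apply: cvgM; first exact: continuous_expRN_norm.
    have := @continuous_exp_cosD1 0 v 0 t.
    by rewrite (_ : (fun y => _) = (fun y => 1 + cos (v * y))) //;
      apply/funext => y; rewrite mul0r expR0 mul1r addr0.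
  - by rewrite normrN mulrN cosN.
  - rewrite -(integral_exp_cos1 _ _ a0); apply: eq_integral => x.
    by rewrite inE /= in_itv /= andbT => x0; rewrite ger0_norm // addr0.
have := has_integralD measurableT h (has_integralZ (-1) measurableT (has_integral_expN_norm a0)).
rewrite cos0 sin0 mulr1 mulr0 subr0 mulN1r mulrDr addrAC subrr add0r mulrA.
by move=> h2; apply: has_integral_eq h2 => // x _; ring.
Qed.
End IntegralValues.

(** * Dominated convergence and integrability on the line *)

Section Integrability.
Variable R : realType.
Local Open Scope classical_set_scope.
Local Open Scope ring_scope.
Local Notation mu := (@lebesgue_measure R).
Local Notation MR := (measurableTypeR R).
Local Notation D0 := (`[0%R, +oo[%classic : set MR).
Implicit Types (D : set MR) (f g : R -> R).

Lemma has_integral_le D f g v : measurable D -> measurable_fun D f ->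
  (forall x, D x -> `|f x| <= g x) -> has_integral D g v -> mu.-integrable D (EFin \o f).
Proof.
move=> mD mf fg [ig _]; apply: le_integrable ig => //; first exact/measurable_EFinP.
by move=> x Dx; rewrite /= lee_fin (le_trans (fg x Dx)) // ler_norm.
Qed.

Lemma integrable_has_integral D f : measurable D -> mu.-integrable D (EFin \o f) ->
  has_integral D f (\int[mu]_(x in D) f x).
Proof. by move=> mD fi; split=> //; rewrite /Rintegral fineK // integrable_fin_num. Qed.

Lemma has_integral_indic D f v : measurable D ->
  has_integral D f v <-> has_integral setT (fun x => \1_D x * f x) v.
Proof.
move=> mD; have e : EFin \o (fun x => \1_D x * f x) = (EFin \o f) \_ D.
  by rewrite restrict_EFin patch_indic; apply/funext => x /=; rewrite mulrC.
have e' : (\int[mu]_(x in D) (f x)%:E = \int[mu]_x (\1_D x * f x)%:E)%E.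
  rewrite [LHS]integral_mkcond; apply: eq_integral => x _.
  by rewrite patchE indicE; case: (_ \in _); rewrite ?mul1r ?mul0r.
rewrite /has_integral e' e; split=> -[h1 h2]; split=> //.
  exact: (integrable_mkcond _ mD).1.
exact: (integrable_mkcond _ mD).2.
Qed.

Lemma dominated_has_integral D (F : nat -> R -> R) f g v : measurable D ->
  (forall n, measurable_fun D (F n)) -> measurable_fun D f -> has_integral D g v ->
  (forall n x, D x -> `|F n x| <= g x) ->
  (forall x, D x -> F ^~ x @ \oo --> f x) ->
  \int[mu]_(x in D) F n x @[n --> \oo] --> \int[mu]_(x in D) f x.
Proof.
move=> mD mF mf hg Fg Ff.
have c x : D x -> (EFin \o F n) x @[n --> \oo] --> (EFin \o f) x.
  by move=> Dx; apply/fine_cvgP; split; [exact: nearW|exact: Ff].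
have [fi _ cv] := @dominated_convergence _ _ _ mu D mD (fun n => EFin \o F n) (EFin \o f) (EFin \o g)
  (fun n => (measurable_EFinP _ _).2 (mF n)) ((measurable_EFinP _ _).2 mf)
  (aeW _ c) hg.1
  (aeW _ (fun x n Dx => Fg n x Dx)).
have cv' : (\int[mu]_(x in D) (F n x)%:E)%E @[n --> \oo] --> (\int[mu]_(x in D) f x)%:E.
  by rewrite -(integrable_has_integral mD fi).2.
by move/fine_cvgP : cv' => [].
Qed.

(** The integrals over [-n, n] vanish by reflection and converge to the full integral by
    domination. *)
Lemma has_integral_odd f : continuous f -> mu.-integrable setT (EFin \o f) ->
  (forall x, f (- x) = - f x) -> has_integral setT f 0.
Proof.
move=> cf fi of_.
have mf : measurable_fun (setT : set MR) f by exact: continuous_measurable_fun.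
pose I n : set MR := `[- n%:R, n%:R]%classic.
have mI n : measurable (I n) by exact: measurable_itv.
have z n : \int[mu]_x (\1_(I n) x * f x) = 0.
  have fI : mu.-integrable (I n) (EFin \o f) by exact: integrableS fi.
  have h := integrable_has_integral (mI n) fI.
  rewrite (has_integral_Rintegral ((has_integral_indic _ _ (mI n)).1 h)).
  have := @integration_by_substitution_oppr R f (- n%:R) n%:R _ _.
  rewrite opprK => /(_ (ge0_cp (ler0n _ _)).2 (continuous_subspaceT cf)) e.
  have : \int[mu]_(x in I n) f x = - \int[mu]_(x in I n) f x.
    rewrite {1}/Rintegral e.
    rewrite -[RHS]mulN1r -(has_integral_Rintegral (has_integralZ (-1) (mI n) h)).
    rewrite /Rintegral; congr fine; apply: eq_integral => x _.
    by rewrite /= of_ mulN1r.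
  by move/eqP; rewrite -addr_eq0 -mulr2n mulrn_eq0 /= => /eqP.
have hn := integrable_has_integral measurableT (integrable_norm fi).
have H : \int[mu]_x (\1_(I n) x * f x) @[n --> \oo] --> \int[mu]_x f x.
  apply: (dominated_has_integral measurableT _ mf hn).
  - by move=> n; apply: measurable_funM => //; exact: measurable_indic.
  - by move=> n x _; rewrite /= normrM indicE; case: (_ \in _); rewrite ?normr1 ?normr0 ?mul1r ?mul0r.
  - move=> x _; apply: cvg_near_cst; exists (Num.truncn `|x|).+1 => //= n /= hx.
    have : `|x| <= n%:R by rewrite (le_trans (ltW (truncnS_gt _))) // ler_nat.
    rewrite ler_norml => xn; have xI : I n x by rewrite /I /= in_itv.
    by rewrite indicE mem_set //= mul1r.
rewrite (funext z) in H.
have e := cvg_unique (@norm_hausdorff _ R) (cvg_cst (0 : R)) H.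
by have := integrable_has_integral measurableT fi; rewrite -e.
Qed.

Lemma has_integral_oneDsqr : has_integral setT (fun t : R => (1 + t ^+ 2)^-1) (2 * (pi / 2)).
Proof.
apply: ge0_has_integral_even => [x||x|].
- by rewrite invr_ge0 addr_ge0 // sqr_ge0.
- exact: continuous_oneDsqrV.
- by rewrite sqrrN.
- exact: integral0y_oneDsqr.
Qed.

Variables al be : R.
Hypothesis al0 : 0 < al.

(** The squared modulus of be^2 + (al + i t)^2. *)
Definition lorentz (t : R) := (al ^+ 2 + be ^+ 2 - t ^+ 2) ^+ 2 + (2 * al * t) ^+ 2.

Lemma lorentzE t : lorentz t = (al ^+ 2 + (be - t) ^+ 2) * (al ^+ 2 + (be + t) ^+ 2).
Proof. by rewrite /lorentz; ring. Qed.

Lemma lorentz_ge t : al ^+ 4 <= lorentz t.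
Proof.
rewrite lorentzE (_ : al ^+ 4 = al ^+ 2 * al ^+ 2); last by ring.
by apply: ler_pM; rewrite ?sqr_ge0 ?lerDl ?sqr_ge0.
Qed.

Lemma lorentz_gt0 t : 0 < lorentz t.
Proof. by apply: lt_le_trans (lorentz_ge t); rewrite exprn_gt0. Qed.

Lemma continuous_lorentz : continuous lorentz.
Proof.
have c1 : continuous (fun t : R => al ^+ 2 + be ^+ 2 - t ^+ 2).
  by move=> t; apply: cvgB; [exact: cvg_cst|apply: cvgM; exact: cvg_id].
have c2 : continuous (fun t : R => 2 * al * t) by exact: continuous_lin.
by move=> t; apply: cvgD; apply: cvgM; [exact: c1|exact: c1|exact: c2|exact: c2].
Qed.

(** The numerator is at most a multiple of the square root of [lorentz], and so is 1 + t^2; hence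
    the quotient decays like 1 / (1 + t^2). *)
Lemma lorentz_bound : exists M, forall t u,
  `|u| <= `|al ^+ 2 + be ^+ 2 - t ^+ 2| + `|2 * al * t| -> `|u / lorentz t| <= M * (1 + t ^+ 2)^-1.
Proof.
(* The constants come from 1 + t^2 = k - w with w = al^2 + be^2 - t^2, from (k - w)^2 <= 2 k^2 + 2
   w^2, and from the lower bound al^4 of [lorentz]. *)
pose k := 1 + al ^+ 2 + be ^+ 2; pose M0 := 2 * k ^+ 2 / al ^+ 4 + 2.
exists (1 + M0 / 2) => t u hu.
have Q0 := lorentz_gt0 t; have t0 : 0 < 1 + t ^+ 2 by rewrite ltr_pwDl ?sqr_ge0.
rewrite normrM normfV (gtr0_norm Q0) ler_pdivrMr // mulrAC ler_pdivlMr //.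
set w := al ^+ 2 + be ^+ 2 - t ^+ 2 in hu *.
have e1 : (`|w| + `|2 * al * t|) ^+ 2 <= 2 * lorentz t.
  rewrite /lorentz -/w -(real_normK (num_real w)) -(real_normK (num_real (2 * al * t))).
  by rewrite -subr_ge0 (_ : _ - _ = (`|w| - `|2 * al * t|) ^+ 2) ?sqr_ge0 //; ring.
have e2 : (1 + t ^+ 2) ^+ 2 <= M0 * lorentz t.
  have -> : 1 + t ^+ 2 = k - w by rewrite /k /w; ring.
  have e3 : (k - w) ^+ 2 <= 2 * k ^+ 2 + 2 * w ^+ 2.
    by rewrite -subr_ge0 (_ : _ - _ = (k + w) ^+ 2) ?sqr_ge0 //; ring.
  apply: le_trans e3 _; rewrite /M0 [X in _ <= X]mulrDl; apply: lerD.
    rewrite -[X in _ <= X]mulrA; apply: ler_peMr; first by rewrite mulr_ge0 // sqr_ge0.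
    by rewrite mulrC ler_pdivlMr ?exprn_gt0 // mul1r lorentz_ge.
  by rewrite ler_pM2l // /lorentz -/w lerDl sqr_ge0.
have e4 : 2 * (`|u| * (1 + t ^+ 2)) <= (`|w| + `|2 * al * t|) ^+ 2 + (1 + t ^+ 2) ^+ 2.
  apply: (@le_trans _ _ (2 * ((`|w| + `|2 * al * t|) * (1 + t ^+ 2)))).
    by rewrite ler_pM2l // ler_pM2r.
  by rewrite -subr_ge0 (_ : _ - _ = (`|w| + `|2 * al * t| - (1 + t ^+ 2)) ^+ 2) ?sqr_ge0 //; ring.
have := le_trans e4 (lerD e1 e2); lra.
Qed.

Lemma integrable_lorentz (u : R -> R) : continuous u ->
  (forall t, `|u t| <= `|al ^+ 2 + be ^+ 2 - t ^+ 2| + `|2 * al * t|) ->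
  mu.-integrable setT (EFin \o (fun t => u t / lorentz t)).
Proof.
move=> cu hu; have [M hM] := lorentz_bound.
apply: has_integral_le (has_integralZ M measurableT has_integral_oneDsqr) => //.
  apply: continuous_measurable_fun => t; apply: cvgM; first exact: cu.
  apply: cvgV; first by rewrite gt_eqF ?lorentz_gt0.
  exact: continuous_lorentz.
by move=> t _; exact: hM (hu t).
Qed.

End Integrability.

(** * Fourier inversion with the Poisson kernel *)

Section FourierInversion.
Variable R : realType.
Local Open Scope classical_set_scope.
Local Open Scope ring_scope.
Local Notation mu := (@lebesgue_measure R).
Local Notation MR := (measurableTypeR R).
Local Notation D0 := (`[0%R, +oo[%classic : set MR).
Variables al be x : R.
Hypotheses (al0 : 0 < al) (be0 : 0 < be) (x0 : 0 < x).

Let mD0 : measurable D0. Proof. exact: measurable_itv. Qed.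

Lemma cosB_pihalf (z : R) : cos (z - pi / 2) = sin z.
Proof. by rewrite cosB cos_pihalf sin_pihalf mulr0 add0r mulr1. Qed.

Lemma sinB_pihalf (z : R) : sin (z - pi / 2) = - cos z.
Proof. by rewrite sinB cos_pihalf sin_pihalf mulr0 sub0r mulr1. Qed.

Definition damped_sin (y : R) : R := expR (- al * y) * (sin (be * y) / be).
Local Notation psi := damped_sin.

(** The real part of e^{i x t} / (be^2 + (al + i t)^2); [line_im] is its imaginary part. *)
Definition line_re (t : R) : R :=
  ((al ^+ 2 + be ^+ 2 - t ^+ 2) * cos (x * t) + 2 * al * t * sin (x * t)) / lorentz al be t.
Local Notation h := line_re.

Lemma has_integral_damped_cos t :
  has_integral D0 (fun y => psi y * cos ((x - y) * t)) (h t).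
Proof.
have k0 : 2 * be != 0 by rewrite mulf_neq0 ?gt_eqF.
(* The product of the sine and the cosine is a sum of two sines, written as cosines with phase shift
   - pi / 2. *)
have := has_integralZ (2 * be)^-1 mD0 (has_integralD mD0
  (has_integral_exp_cos (be - t) (x * t - pi / 2) al0)
  (has_integral_exp_cos (be + t) (- (x * t) - pi / 2) al0)).
rewrite !cosB_pihalf !sinB_pihalf sinN cosN.
have A0 (v : R) : al ^+ 2 + v ^+ 2 != 0 by rewrite gt_eqF // ltr_pwDl ?exprn_gt0 ?sqr_ge0.
rewrite (_ : _^-1 * _ = h t); last first.
  rewrite /h lorentzE; field; rewrite !A0 gt_eqF //.
move=> H; apply: has_integral_eq H => // y _; rewrite /psi.
rewrite (_ : (be - t) * y + (x * t - pi / 2) = (be * y + (x - y) * t) - pi / 2); last by ring.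
rewrite (_ : (be + t) * y + (- (x * t) - pi / 2) = (be * y - (x - y) * t) - pi / 2); last by ring.
rewrite !cosB_pihalf sinD sinB; field.
by rewrite gt_eqF.
Qed.

Lemma continuous_line_re_num : continuous (fun t : R =>
  (al ^+ 2 + be ^+ 2 - t ^+ 2) * cos (x * t) + 2 * al * t * sin (x * t)).
Proof.
move=> t; apply: cvgD; apply: cvgM.
- by apply: cvgB; [exact: cvg_cst|apply: cvgM; exact: cvg_id].
- by apply: continuous_comp; [exact: continuous_lin|exact: continuous_cos].
- exact: continuous_lin.
- by apply: continuous_comp; [exact: continuous_lin|exact: continuous_sin].
Qed.

Lemma integrable_line_re : mu.-integrable setT (EFin \o h).
Proof.
apply: integrable_lorentz => //; first exact: continuous_line_re_num.
move=> t; apply: le_trans (ler_normD _ _) _; rewrite normrM [X in _ + X]normrM.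
by apply: lerD; apply: ler_piMr; rewrite ?normr_ge0 ?sin_max ?cos_max.
Qed.

Let kern (eps y : R) : R := 2 * eps / (eps ^+ 2 + (x - y) ^+ 2).

(** The factor e^{-eps|t|} makes the double integral absolutely convergent. Integrating in y first
    gives [line_re], in t first the Poisson kernel. *)
Lemma damped_fubini eps : 0 < eps ->
  (\int[mu]_t (expR (- eps * `|t|) * h t)%:E = \int[mu]_(y in D0) (psi y * kern eps y)%:E)%E.
Proof.
move=> eps0.
pose F (p : MR * MR) : R := expR (- eps * `|p.1|) * (\1_D0 p.2 * psi p.2) * cos ((x - p.2) * p.1).
(* [G] has separated variables and dominates [F] up to the factor 1 / be. *)
pose G (p : MR * MR) : R := expR (- eps * `|p.1|) * (\1_D0 p.2 * expR (- al * p.2)).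
have m1 (f : R -> R) : continuous f -> measurable_fun setT (fun p : MR * MR => f p.1).
  move=> cf; apply: (measurableT_comp (f := f : MR -> R)); last exact: measurable_fst.
  exact: continuous_measurable_fun.
have m2 (f : R -> R) : continuous f -> measurable_fun setT (fun p : MR * MR => f p.2).
  move=> cf; apply: (measurableT_comp (f := f : MR -> R)); last exact: measurable_snd.
  exact: continuous_measurable_fun.
have mI : measurable_fun setT (fun p : MR * MR => \1_D0 p.2 : R).
  apply: (measurableT_comp (f := \1_D0 : MR -> R)); last exact: measurable_snd.
  exact: measurable_indic.
have cpsi : continuous psi.
  by move=> y; apply: cvgM; [exact: continuous_expRM|apply: cvgM; [|exact: cvg_cst]];
    apply: continuous_comp; [exact: continuous_lin|exact: continuous_sin].
have mF : measurable_fun setT F.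
  apply: measurable_funM; first apply: measurable_funM.
  - exact: (m1 _ (@continuous_expRN_norm R eps)).
  - by apply: measurable_funM; [exact: mI|exact: m2].
  - apply: (measurableT_comp (f := @cos R)); first exact: continuous_measurable_fun (@continuous_cos R).
    apply: measurable_funM; last exact: measurable_fst.
    by apply: measurable_funB; [exact: measurable_cst|exact: measurable_snd].
have mG : measurable_fun setT G.
  apply: measurable_funM; first exact: (m1 _ (@continuous_expRN_norm R eps)).
  by apply: measurable_funM; [exact: mI|exact: (m2 _ (@continuous_expRM R (- al)))].
have G0 p : 0 <= G p by rewrite /G !mulr_ge0 ?expR_ge0 // indicE; case: (_ \in _).
have iG : (mu \x mu)%E.-integrable setT (EFin \o G).
  apply/integrable12ltyP; first exact/measurable_EFinP.
  have e t : (\int[mu]_y `|(EFin \o G) (t, y)| = (al^-1 * expR (- eps * `|t|))%:E)%E.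
    under eq_integral => y _ do rewrite /= ger0_norm ?G0 //.
    rewrite mulrC; have [_ <-] := has_integralZ (expR (- eps * `|t|)) measurableT
      ((has_integral_indic _ _ mD0).1 (has_integral_exp al0)).
    by apply: eq_integral.
  under eq_integral => t _ do rewrite e.
  have [_ ->] := has_integralZ al^-1 measurableT (has_integral_expN_norm eps0).
  exact: ltry.
have iF : (mu \x mu)%E.-integrable setT (EFin \o F).
  have : (mu \x mu)%E.-integrable setT (EFin \o (fun p => be^-1 * G p)).
    rewrite (_ : EFin \o _ = (fun p => be^-1%:E * (EFin \o G) p)%E); first exact: integrableZl.
    by apply/funext => p; rewrite /= EFinM.
  apply: le_integrable => //; first exact/measurable_EFinP.
  move=> p _; rewrite /= lee_fin [X in _ <= X]ger0_norm; last by rewrite mulr_ge0 ?invr_ge0 ?(ltW be0).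
  rewrite /F /G /psi !normrM !(ger0_norm (expR_ge0 _)) normfV (gtr0_norm be0).
  have i0 : 0 <= \1_D0 p.2 :> R by rewrite indicE; case: (_ \in _).
  rewrite (ger0_norm i0).
  have -> : be^-1 * (expR (- eps * `|p.1|) * (\1_D0 p.2 * expR (- al * p.2))) =
     (expR (- eps * `|p.1|) * (\1_D0 p.2 * (expR (- al * p.2) * (1 * be^-1)))) * 1 by ring.
  apply: ler_pM; rewrite ?cos_max ?normr_ge0 //; first by rewrite !mulr_ge0 ?expR_ge0 ?invr_ge0 ?(ltW be0).
  apply: ler_wpM2l; first exact: expR_ge0.
  apply: ler_wpM2l; first exact: i0.
  apply: ler_wpM2l; first exact: expR_ge0.
  by apply: ler_wpM2r; rewrite ?invr_ge0 ?(ltW be0) ?sin_max.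
have := Fubini iF.
have e1 t : (\int[mu]_y (EFin \o F) (t, y) = (expR (- eps * `|t|) * h t)%:E)%E.
  have [_ <-] := has_integralZ (expR (- eps * `|t|)) measurableT
    ((has_integral_indic _ _ mD0).1 (has_integral_damped_cos t)).
  by apply: eq_integral => y _; rewrite /F /=; congr EFin; ring.
have e2 y : (\int[mu]_t (EFin \o F) (t, y) = (\1_D0 y * (psi y * kern eps y))%:E)%E.
  rewrite mulrA; have [_ <-] := has_integralZ (\1_D0 y * psi y) measurableT
    (has_integral_expN_norm_cos (x - y) eps0).
  by apply: eq_integral => t _; rewrite /F /=; congr EFin; ring.
under eq_integral => t _ do rewrite e1.
move=> ->; under eq_integral => y _ do rewrite e2.
rewrite [RHS]integral_mkcond; apply: eq_integral => y _.
by rewrite patchE indicE; case: (_ \in _); rewrite ?mul1r ?mul0r.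
Qed.

(** Mean value theorem: for y >= 0 the exponential is at most 1, so the derivative is bounded by al
    / be + 1. *)
Lemma damped_sin_lip y : 0 <= y -> `|psi y - psi x| <= (al / be + 1) * `|y - x|.
Proof.
pose dpsi (s : R) := expR (- al * s) * - al * (sin (be * s) / be) +
   expR (- al * s) * (cos (be * s) * be / be).
have d (s : R) : is_derive s 1 psi (dpsi s).
  have ds := is_derive_mul (is_derive_sin_comp (is_derive_lin be s)) (is_derive_const be^-1 s).
  apply: (is_derive_eq (is_derive_mul (is_derive_expR_comp (is_derive_lin (- al) s)) ds)).
  by rewrite /dpsi; ring.
have b s : 0 <= s -> `|dpsi s| <= al / be + 1.
  move=> s0; have e1 : expR (- al * s) <= 1.
    by rewrite -(expR0 R) ler_expR mulNr oppr_le0 mulr_ge0 // ltW.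
  rewrite /dpsi mulfK ?gt_eqF //; apply: le_trans (ler_normD _ _) _; apply: lerD.
    rewrite !normrM normrN (gtr0_norm al0) normfV (gtr0_norm be0) ger0_norm ?expR_ge0 //.
    rewrite -mulrA mulrCA; apply: ler_wpM2l; first exact: ltW.
    rewrite mulrA -[X in _ <= X]mul1r; apply: ler_wpM2r; first by rewrite invr_ge0 ltW.
    by rewrite -[1]mulr1; apply: ler_pM; rewrite ?expR_ge0 ?normr_ge0 ?sin_max.
  rewrite normrM ger0_norm ?expR_ge0 // -[1]mulr1.
  by apply: ler_pM; rewrite ?expR_ge0 ?normr_ge0 ?cos_max.
have key u v : 0 <= u -> u <= v -> `|psi v - psi u| <= (al / be + 1) * (v - u).
  move=> u0 uv; have [|c] := MVT_segment uv (fun s _ => d s).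
    by apply: continuous_subspaceT => s; exact: is_derive_continuous (d s).
  rewrite in_itv /= => /andP[uc _] ->; rewrite normrM (ger0_norm (_ : 0 <= v - u)) ?subr_ge0 //.
  by apply: ler_wpM2r; rewrite ?subr_ge0 // b // (le_trans u0).
move=> y0; have [xy|/ltW yx] := leP x y.
  by rewrite (ger0_norm (_ : 0 <= y - x)) ?subr_ge0 // key // ltW.
by rewrite distrC [`|y - x|]distrC (ger0_norm (_ : 0 <= x - y)) ?subr_ge0 // key.
Qed.

(** A cut-off to an interval symmetric about x, over which the kernel has an explicit integral;
    [psi x * chi y] agrees with [psi y] at y = x. *)
Let chi (y : R) : R := \1_(`[0, 2 * x]%classic : set MR) y.

Lemma integral_kern eps : 0 < eps ->
  has_integral D0 (fun y => chi y * kern eps y) (4 * atan (x / eps)).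
Proof.
move=> eps0; have mI : measurable (`[0, 2 * x]%classic : set MR) by exact: measurable_itv.
have d (y : R) : is_derive y 1 (fun s => 2 * atan (eps^-1 * s + - (eps^-1 * x))) (kern eps y).
  have dl := is_derive_add (is_derive_lin eps^-1 y) (is_derive_const (- (eps^-1 * x)) y).
  apply: (is_derive_eq (is_derive_mul (is_derive_const 2 y) (is_derive1_comp (is_derive1_atan _) dl))).
  have h0 : eps != 0 by rewrite gt_eqF.
  have h1 : eps ^+ 2 + (x - y) ^+ 2 != 0 by rewrite gt_eqF // ltr_pwDl ?exprn_gt0 ?sqr_ge0.
  have E : 1 + (eps^-1 * y - eps^-1 * x) ^+ 2 = (eps ^+ 2 + (x - y) ^+ 2) / eps ^+ 2 by field.
  rewrite E mul0r !addr0 /kern invfM invrK.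
  by move: (eps ^+ 2 + (x - y) ^+ 2) h1 => z h1; field; rewrite h0 h1.
have ck : continuous (kern eps).
  move=> y; apply: cvgM; first exact: cvg_cst.
  apply: cvgV; first by rewrite gt_eqF // ltr_pwDl ?exprn_gt0 ?sqr_ge0.
  by apply: cvgD; [exact: cvg_cst|apply: cvgM]; (apply: cvgB; [exact: cvg_cst|exact: cvg_id]).
have H : has_integral (`[0, 2 * x]%classic : set MR) (kern eps) (4 * atan (x / eps)).
  apply: has_integral_ge0 => //.
  - exact: continuous_measurableW.
  - by move=> y _; rewrite /kern divr_ge0 ?mulr_ge0 ?addr_ge0 ?sqr_ge0 ?(ltW eps0).
  rewrite (@continuous_FTC2 R _ (fun s => 2 * atan (eps^-1 * s + - (eps^-1 * x)))).
  - rewrite -EFinD; congr EFin; rewrite mulr0 add0r atanN.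
    by rewrite (_ : eps^-1 * (2 * x) + - (eps^-1 * x) = x / eps) 1?[eps^-1 * x]mulrC; ring.
  - by rewrite mulr_gt0.
  - exact: continuous_subspaceT.
  - split=> [y _||]; first by have [] := d y.
      by apply: cvg_at_right_filter; exact: is_derive_continuous (d 0).
    by apply: cvg_at_left_filter; exact: is_derive_continuous (d (2 * x)).
  - by move=> y _; rewrite derive1E; have [] := d y.
apply/(has_integral_indic _ _ mD0); have := (has_integral_indic _ _ mI).1 H.
move=> H2; apply: has_integral_eq H2 => // y _; rewrite /chi !indicE [RHS]mulrA; congr (_ * _).
have [yI|yI] := boolP (y \in `[0, 2 * x]%classic); last by rewrite mulr0.
rewrite mulr1 mem_set //=.
by move: yI; rewrite inE /= in_itv /= => /andP[y0 _]; rewrite in_itv /= y0.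
Qed.


Let harm (n : nat) : R := n.+1%:R^-1.

Let harm_gt0 n : 0 < harm n. Proof. by rewrite invr_gt0 ltr0n. Qed.

Let cpsi : continuous psi.
Proof.
by move=> y; apply: cvgM; [exact: continuous_expRM|apply: cvgM; [|exact: cvg_cst]];
  apply: continuous_comp; [exact: continuous_lin|exact: continuous_sin].
Qed.

Let ckern eps : 0 < eps -> continuous (kern eps).
Proof.
move=> eps0 y; apply: cvgM; first exact: cvg_cst.
apply: cvgV; first by rewrite gt_eqF // ltr_pwDl ?exprn_gt0 ?sqr_ge0.
by apply: cvgD; [exact: cvg_cst|apply: cvgM]; (apply: cvgB; [exact: cvg_cst|exact: cvg_id]).
Qed.

(** The first term serves y <= 2 x, where e^{2 al x} e^{- al y} >= 1 brings the exponential decay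
    into the Lipschitz bound; the second serves y > 2 x, where |y - x| >= x. *)
Let K : R := (al / be + 1) * expR (2 * al * x) + (be * x)^-1.

Lemma damped_diff_bound y : 0 <= y ->
  `|psi y - psi x * chi y| <= K * expR (- al * y) * `|y - x|.
Proof.
move=> y0.
have K1 : 0 <= (al / be + 1) * expR (2 * al * x).
  by rewrite mulr_ge0 ?expR_ge0 // addr_ge0 // divr_ge0 // ltW.
have K2 : 0 <= (be * x)^-1 by rewrite invr_ge0 mulr_ge0 // ltW.
have [y2|y2] := leP y (2 * x).
  have -> : chi y = 1 by rewrite /chi indicE mem_set //= in_itv /= y0.
  rewrite mulr1; apply: le_trans (damped_sin_lip y0) _.
  apply: ler_wpM2r; first exact: normr_ge0.
  rewrite /K mulrDl; apply: (@le_trans _ _ ((al / be + 1) * expR (2 * al * x) * expR (- al * y))).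
    rewrite -mulrA -expRD; apply: ler_peMr; first by rewrite addr_ge0 // divr_ge0 // ltW.
    rewrite -[X in X <= _]expR0 ler_expR (_ : _ + _ = al * (2 * x - y)); last by ring.
    by rewrite mulr_ge0 ?subr_ge0 // ltW.
  by rewrite lerDl mulr_ge0 ?expR_ge0.
have -> : chi y = 0.
  by rewrite /chi indicE memNset //= in_itv /= y0 /= => h; move: y2; rewrite ltNge h.
rewrite mulr0 subr0 /psi normrM ger0_norm ?expR_ge0 // normrM normfV (gtr0_norm be0).
have d : x <= `|y - x| by rewrite (le_trans _ (ler_norm _)) // lerBrDl; move: y2; lra.
apply: (@le_trans _ _ ((be * x)^-1 * expR (- al * y) * `|y - x|)); last first.
  apply: ler_wpM2r; first exact: normr_ge0.
  apply: ler_wpM2r; first exact: expR_ge0.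
  by rewrite lerDr.
rewrite [(be * x)^-1 * _]mulrC -mulrA; apply: ler_wpM2l; first exact: expR_ge0.
have -> : (be * x)^-1 * `|y - x| = (x^-1 * `|y - x|) / be by field; rewrite !gt_eqF.
apply: ler_wpM2r; first by rewrite invr_ge0 ltW.
by apply: (le_trans (sin_max _)); rewrite mulrC ler_pdivlMr // mul1r.
Qed.

(** This is 2 eps |x - y| <= eps^2 + (x - y)^2. It absorbs the factor |y - x| of
    [damped_diff_bound], so the remainder is dominated uniformly in eps. *)
Lemma kern_dist eps y : 0 < eps -> `|y - x| * kern eps y <= 1.
Proof.
move=> eps0; have z : 0 < eps ^+ 2 + (x - y) ^+ 2 by rewrite ltr_pwDl ?exprn_gt0 ?sqr_ge0.
rewrite /kern mulrA ler_pdivrMr // mul1r -(real_normK (num_real (x - y))) distrC.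
by rewrite -subr_ge0 (_ : _ - _ = (eps - `|x - y|) ^+ 2) ?sqr_ge0 //; ring.
Qed.

Let rem n y := (psi y - psi x * chi y) * kern (harm n) y.

Let rem_bound n y : 0 <= y -> `|rem n y| <= K * expR (- al * y).
Proof.
move=> y0; have k0 : 0 <= kern (harm n) y.
  by rewrite /kern divr_ge0 ?addr_ge0 ?sqr_ge0 // mulr_ge0 // ltW.
rewrite /rem normrM (ger0_norm k0).
apply: (@le_trans _ _ (K * expR (- al * y) * `|y - x| * kern (harm n) y)).
  by apply: ler_wpM2r => //; exact: damped_diff_bound.
rewrite -mulrA; apply: ler_piMr; last exact: kern_dist.
by rewrite mulr_ge0 ?expR_ge0 // /K addr_ge0 ?invr_ge0 ?mulr_ge0 ?expR_ge0 ?addr_ge0 ?divr_ge0 ?ltW.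
Qed.

Let mrem n : measurable_fun D0 (rem n).
Proof.
apply: measurable_funM; last exact: (continuous_measurableW mD0 (ckern (harm_gt0 n))).
apply: measurable_funB; first exact: (continuous_measurableW mD0 cpsi).
by apply: measurable_funM; [exact: measurable_cst|apply: measurable_funTS; exact: measurable_indic].
Qed.

(** At y = x the remainder is zero, and elsewhere the kernel tends to 0 with eps. *)
Let cvg_rem : \int[mu]_(y in D0) rem n y @[n --> \oo] --> (0 : R).
Proof.
rewrite -[X in _ --> X](has_integral_Rintegral (has_integral0 D0)).
apply: (dominated_has_integral mD0 mrem _ (has_integralZ K mD0 (has_integral_exp al0))).
- exact: measurable_cst.
- by move=> n y /=; rewrite in_itv /= andbT => y0; exact: rem_bound.
- move=> y _; have [->|yx] := eqVneq y x.
    rewrite (_ : rem ^~ x = fun=> 0); first exact: cvg_cst.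
    apply/funext => n; rewrite /rem (_ : chi x = 1) ?mulr1 ?subrr ?mul0r //.
    by rewrite /chi indicE mem_set //= in_itv /= ltW //= ler_peMl ?ler1n // ltW.
  rewrite -[X in _ --> X](mulr0 (psi y - psi x * chi y)); apply: cvgM; first exact: cvg_cst.
  have : kern e y @[e --> (0 : R)] --> kern 0 y.
    apply: cvgM; first by apply: cvgM; [exact: cvg_cst|exact: cvg_id].
    apply: cvgV; first by rewrite expr0n add0r expf_neq0 // subr_eq0 eq_sym.
    by apply: cvgD; [apply: cvgM; exact: cvg_id|exact: cvg_cst].
  rewrite {2}/kern mulr0 mul0r => h.
  exact: (cvg_comp _ _ (@cvg_harmonic R) h).
Qed.

Let cvg_atan_harm : atan (x / harm n) @[n --> \oo] --> (pi / 2 : R).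
Proof.
rewrite (_ : (fun n => _) = (fun n => atan (x * n.+1%:R))); last first.
  by apply/funext => n; rewrite /harm invrK.
apply: (cvg_comp (fun n => x * n.+1%:R) atan _ (@cvgy_atan R)).
apply: (cvg_comp (fun n => n.+1%:R : R) (fun z => x * z) _ (gt0_cvgMry x0 cvg_id)).
by have := @cvgr_idn R; rewrite -(cvg_shiftS (fun n => n%:R : R)).
Qed.

(** Along eps = 1 / (n + 1) the kernel mass 4 atan(x / eps) tends to 2 pi and the remainder to 0,
    while the damped integral tends to the undamped one. *)
Lemma has_integral_line_re : has_integral setT h (2 * pi * psi x).
Proof.
have hi := integrable_has_integral measurableT integrable_line_re.
suff <- : \int[mu]_t h t = 2 * pi * psi x by [].
have mh : measurable_fun (setT : set MR) h.
  by apply/measurable_EFinP; exact: (measurable_int _ integrable_line_re).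
have c1 : \int[mu]_t (expR (- harm n * `|t|) * h t) @[n --> \oo] --> \int[mu]_t h t.
  apply: (dominated_has_integral measurableT _ mh
    (integrable_has_integral measurableT (integrable_norm integrable_line_re))).
  - move=> n; apply: measurable_funM => //.
    exact: continuous_measurable_fun (@continuous_expRN_norm R (harm n)).
  - move=> n t _; rewrite /= normrM ger0_norm ?expR_ge0 //; apply: ler_piMl => //.
    by rewrite -[X in _ <= X]expR0 ler_expR mulNr oppr_le0 mulr_ge0 // ltW.
  - move=> t _; rewrite -[X in _ --> X]mul1r; apply: cvgM; last exact: cvg_cst.
    have h0 : expR (- e * `|t|) @[e --> (0 : R)] --> (1 : R).
      have := @continuous_expRM R (- `|t|) 0; rewrite /continuous_at mulr0 expR0.
      by under eq_fun do rewrite mulNr -mulrN mulrC.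
    exact: (cvg_comp _ _ (@cvg_harmonic R) h0).
have e n : \int[mu]_t (expR (- harm n * `|t|) * h t) =
    psi x * (4 * atan (x / harm n)) + \int[mu]_(y in D0) rem n y.
  rewrite {1}/Rintegral damped_fubini //.
  have ri : has_integral D0 (rem n) (\int[mu]_(y in D0) rem n y).
    apply: integrable_has_integral => //.
    apply: (has_integral_le mD0 (mrem n) _ (has_integralZ K mD0 (has_integral_exp al0))).
    by move=> y /=; rewrite in_itv /= andbT => y0; exact: rem_bound.
  have := has_integralD mD0 (has_integralZ (psi x) mD0 (integral_kern (harm_gt0 n))) ri.
  move/has_integral_Rintegral => <-; apply: eq_Rintegral => y _.
  by rewrite /rem; ring.
rewrite (funext e) in c1.
have c2 : psi x * (4 * atan (x / harm n)) + \int[mu]_(y in D0) rem n y @[n --> \oo] -->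
    psi x * (4 * (pi / 2)) + 0.
  apply: cvgD; last exact: cvg_rem.
  by apply: cvgM; [exact: cvg_cst|apply: cvgM; [exact: cvg_cst|exact: cvg_atan_harm]].
by rewrite (cvg_unique (@norm_hausdorff _ R) c1 c2); field.
Qed.

Definition line_im (t : R) : R :=
  ((al ^+ 2 + be ^+ 2 - t ^+ 2) * sin (x * t) - 2 * al * t * cos (x * t)) / lorentz al be t.

(** The integrand is odd in t. *)
Lemma has_integral_line_im : has_integral setT line_im 0.
Proof.
have cn : continuous (fun t : R =>
    (al ^+ 2 + be ^+ 2 - t ^+ 2) * sin (x * t) - 2 * al * t * cos (x * t)).
  move=> t; apply: cvgB; apply: cvgM.
  - by apply: cvgB; [exact: cvg_cst|apply: cvgM; exact: cvg_id].
  - by apply: continuous_comp; [exact: continuous_lin|exact: continuous_sin].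
  - exact: continuous_lin.
  - by apply: continuous_comp; [exact: continuous_lin|exact: continuous_cos].
apply: has_integral_odd.
- move=> t; apply: cvgM; first exact: cn.
  apply: cvgV; first by rewrite gt_eqF ?lorentz_gt0.
  exact: continuous_lorentz.
- apply: integrable_lorentz => // t; apply: le_trans (ler_normB _ _) _.
  rewrite normrM [X in _ + X]normrM.
  by apply: lerD; apply: ler_piMr; rewrite ?normr_ge0 ?sin_max ?cos_max.
- by move=> t; rewrite /line_im /lorentz !mulrN sinN cosN !sqrrN; ring.
Qed.

End FourierInversion.

(** * Partial fractions and the vertical line integral *)

(** After clearing denominators the difference [p] of the two sides has degree below n and vanishes
    at the n distinct points - c_j. *)
Lemma partial_fractions (F : fieldType) (n : nat) (c : 'I_n -> F) (w : F) :
  (0 < n)%N -> injective c -> (forall j, c j + w != 0) ->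
  (\prod_j (c j + w))^-1 = \sum_j (\prod_(k | k != j) (c k - c j))^-1 / (c j + w).
Proof.
move=> n0 cI cw; pose q j : {poly F} := \prod_(k | k != j) ('X - (- c k)%:P).
have qE j z : (q j).[z] = \prod_(k | k != j) (c k + z).
  by rewrite horner_prod; apply: eq_bigr => k _; rewrite !hornerE opprK addrC.
pose p := \sum_j (\prod_(k | k != j) (c k - c j))^-1 *: q j - 1.
have nz j : \prod_(k | k != j) (c k - c j) != 0.
  by apply/prodf_neq0 => k kj; rewrite subr_eq0 (inj_eq cI).
have p0 : p = 0.
  apply: (@roots_geq_poly_eq0 _ _ [seq - c j | j <- enum 'I_n]).
  - apply/allP => _ /mapP[j _ ->]; rewrite rootE hornerD hornerN hornerC horner_sum.
    under eq_bigr => k _ do rewrite hornerZ qE.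
    rewrite (bigD1 j) //= [X in _ + X - 1]big1 ?addr0 => [|k kj]; first by rewrite mulVf ?nz ?subrr.
    by rewrite [X in _ * X](bigD1 j) 1?eq_sym //= subrr mul0r mulr0.
  - by rewrite map_inj_uniq ?enum_uniq // => i j /oppr_inj/cI.
  - rewrite size_map size_enum_ord; apply: (leq_trans (size_polyD _ _)).
    rewrite geq_max size_polyN size_poly1 n0 andbT.
    apply: (leq_trans (size_sum _ _ _)); apply/bigmax_leqP => j _.
    apply: (leq_trans (size_scale_leq _ _)).
    rewrite (_ : q j = \prod_(k <- enum (predC1 j)) ('X - (- c k)%:P)); last by rewrite big_enum.
    by rewrite size_prod_XsubC -cardE cardC1 card_ord prednK.
have P0 : \prod_j (c j + w) != 0 by apply/prodf_neq0.
apply: (mulfI P0); rewrite mulfV // mulr_sumr.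
have := congr1 (fun r : {poly F} => r.[w]) p0.
rewrite hornerD hornerN hornerC horner0 horner_sum => /eqP; rewrite subr_eq0 => /eqP e.
rewrite -[LHS]e; apply: eq_bigr => j _; rewrite hornerZ qE [in RHS](bigD1 j) //=.
by rewrite [RHS]mulrC -mulrA mulKf.
Qed.

(** * The integral over a vertical line *)

Section VerticalLine.
Variable R : realType.
Local Notation C := R[i].
Local Notation mu := (@lebesgue_measure R).
Variables (alpha x : R) (alpha0 : 0 < alpha) (x0 : 0 < x).

(** Its squared modulus is [lorentz], which is positive. *)
Lemma line_den_neq0 (b t : R) : b%:C ^+ 2 + (alpha +i* t) ^+ 2 != 0 :> C.
Proof.
have := lorentz_gt0 b alpha0 t; apply: contraTneq => /eqP.
rewrite eq_complex /= => /andP[/eqP e1 /eqP e2].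
have -> : lorentz alpha b t = (b * b - 0 * 0 + (alpha * alpha - t * t)) ^+ 2 +
   (b * 0 + 0 * b + (alpha * t + t * alpha)) ^+ 2 by rewrite /lorentz; ring.
by rewrite e1 e2 expr0n /= addr0 ltxx.
Qed.

Lemma line_term (b t : R) :
  cexp (x%:C * (alpha +i* t)) / (b%:C ^+ 2 + (alpha +i* t) ^+ 2) =
  (expR (x * alpha) * line_re alpha b x t) +i* (expR (x * alpha) * line_im alpha b x t).
Proof.
have Q0 := lt0r_neq0 (lorentz_gt0 b alpha0 t).
have aux (w p c s Q : R) : Q != 0 -> Q = w ^+ 2 + p ^+ 2 ->
    c = (w * c + p * s) / Q * w - (w * s - p * c) / Q * p /\
    s = (w * c + p * s) / Q * p + (w * s - p * c) / Q * w.
  move=> h e; split; apply: (mulIf h); rewrite {1}e; field; exact: h.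
have [hc hs] := aux (alpha ^+ 2 + b ^+ 2 - t ^+ 2) (2 * alpha * t) (cos (x * t)) (sin (x * t))
  (lorentz alpha b t) Q0 erefl.
apply: (mulIf (line_den_neq0 b t)); rewrite mulfVK ?line_den_neq0 //.
rewrite /cexp /= !mul0r subr0 addr0; apply: eqC => /=.
  by rewrite {1}hc /line_re /line_im; ring.
by rewrite {1}hs /line_re /line_im; ring.
Qed.

Variables (n : nat) (al : 'I_n -> R).
Hypotheses (n0 : (0 < n)%N) (al0 : forall j, 0 < al j) (al_inj : injective al).

Let K j : R := (\prod_(k | k != j) (al k ^+ 2 - al j ^+ 2))^-1.

Let f (z : C) : C := cexp (x%:C * z) / \prod_(j < n) ((al j)%:C ^+ 2 + z ^+ 2).

Lemma line_sum t : f (alpha +i* t) =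
  (\sum_j K j * (expR (x * alpha) * line_re alpha (al j) x t)) +i*
  (\sum_j K j * (expR (x * alpha) * line_im alpha (al j) x t)).
Proof.
have E : f (alpha +i* t) = \sum_j (K j)%:C * ((expR (x * alpha) * line_re alpha (al j) x t) +i*
    (expR (x * alpha) * line_im alpha (al j) x t)).
  rewrite /f (@partial_fractions _ _ (fun j => (al j)%:C ^+ 2) _ n0).
  - rewrite mulr_sumr; apply: eq_bigr => j _.
    rewrite -line_term mulrCA; congr (_ * _).
    rewrite /K fmorphV rmorph_prod; congr (_^-1); apply: eq_bigr => k _.
    by rewrite rmorphB !rmorphXn.
  - move=> i j; rewrite -!rmorphXn => /complexI/eqP; rewrite eqrXn2 ?ltW // => /eqP.
    exact: al_inj.
  - by move=> j; exact: line_den_neq0.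
rewrite E; apply: eqC; rewrite ?Re_sum ?Im_sum /=; apply: eq_bigr => j _ /=.
  by rewrite mul0r subr0.
by rewrite mul0r addr0.
Qed.

(** Each partial fraction contributes 2 pi e^{x alpha} e^{-alpha x} sin(x al_j) / al_j, so alpha
    drops out. The imaginary part integrates to 0, and dz = i dt accounts for the i. *)
Lemma vline_integral_prod : vline_integrable alpha f /\
  (2 * pi%:C * 'i%C)^-1 * vline_integral alpha f =
  (\sum_j sin (x * al j) / (al j * \prod_(k | k != j) (al k ^+ 2 - al j ^+ 2)))%:C.
Proof.
have hr : has_integral setT (fun t => complex.Re (f (alpha +i* t)))
    (\sum_j K j * (expR (x * alpha) * (2 * pi * damped_sin alpha (al j) x))).
  have H := has_integral_sum (index_enum 'I_n) measurableT (fun j =>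
    has_integralZ (K j) measurableT (has_integralZ (expR (x * alpha)) measurableT
      (has_integral_line_re alpha0 (al0 j) x0))).
  by apply: has_integral_eq H => // t _; rewrite line_sum.
have hi : has_integral setT (fun t => complex.Im (f (alpha +i* t)))
    (\sum_j K j * (expR (x * alpha) * 0)).
  have H := has_integral_sum (index_enum 'I_n) measurableT (fun j =>
    has_integralZ (K j) measurableT (has_integralZ (expR (x * alpha)) measurableT
      (has_integral_line_im (al j) x alpha0))).
  by apply: has_integral_eq H => // t _; rewrite line_sum.
split; first by split; [exact: hr.1|exact: hi.1].
rewrite /vline_integral (has_integral_Rintegral hr) (has_integral_Rintegral hi).
have -> : \sum_j K j * (expR (x * alpha) * 0) = 0 by apply: big1 => j _; rewrite !mulr0.
pose S := \sum_j sin (x * al j) / (al j * \prod_(k | k != j) (al k ^+ 2 - al j ^+ 2)).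
have -> : \sum_j K j * (expR (x * alpha) * (2 * pi * damped_sin alpha (al j) x)) =
  (2 * pi) * S.
  rewrite mulr_sumr; apply: eq_bigr => j _; rewrite /damped_sin /K.
  have e : expR (- alpha * x) = (expR (x * alpha))^-1 by rewrite -expRN mulNr mulrC.
  have p0 : \prod_(k | k != j) (al k ^+ 2 - al j ^+ 2) != 0.
    apply/prodf_neq0 => k kj; rewrite subr_eq0 eqrXn2 ?ltW //.
    by rewrite (inj_eq al_inj).
  have a0 := lt0r_neq0 (al0 j); have e0 := lt0r_neq0 (expR_gt0 (x * alpha)).
  by rewrite e [al j * x]mulrC invfM; field; rewrite p0 a0 e0.
transitivity (S%:C); last by [].
move: S => S.
have i0 : 'i%C != 0 :> C by rewrite eq_complex /= oner_eq0 andbF.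
have -> : (2 * pi * S) +i* 0 = 2 * pi%:C * S%:C :> C.
  by apply: eqC; rewrite /= !(mul0r, mulr0, subr0, addr0, add0r).
have p0 : pi%:C != 0 :> C by rewrite fmorph_eq0 gt_eqF ?pi_gt0.
move: (pi%:C) p0 => q q0; field.
by rewrite i0 q0.
Qed.

End VerticalLine.

(** * The character ratio *)

Lemma cancel_scale (F : fieldType) (s N y p q : F) :
  s / (N * y * (p * q)) = (N * p)^-1 * (s / (y * q)).
Proof. by rewrite !invfM; ring. Qed.

Section CharacterRatio.
Variables (R : realType) (n' : nat).
Local Notation n := n'.+1.
Variables (a : 'I_n -> nat) (ha : forall i j : 'I_n, (i <= j)%N -> (a i <= a j)%N).
Variables (d : nat) (rho : 'M[R]_(n.*2.+1) -> 'M[R[i]]_d).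
Hypothesis hrho : SO_irrep_indexed_by a rho.

Let la (k : 'I_n) : int := (a (rev_ord k))%:Z.

Let la_ge0 k : 0 <= la k. Proof. by []. Qed.

Let la_dec (k l : 'I_n) : (k <= l)%N -> la l <= la k.
Proof. by move=> kl; rewrite lez_nat ha //= leq_sub2l. Qed.

Let N0 : n%:R != 0 :> R. Proof. by rewrite pnatr_eq0. Qed.

(** Indices count from 0, so j - 1/2 becomes the [halfodd] coordinate j + 1/2. *)
Lemma top_freq_alpha k : top_freq R la k = n%:R * alpha_coef R a (rev_ord k).
Proof.
rewrite /alpha_coef mulrC divfK // /top_freq /half_sum /halfodd /la.
have -> : ((rev_ord k).+1%:R : R) = (rev_ord k)%:R + 1 by rewrite -natr1.
by rewrite /= pmulrn; field.
Qed.

Lemma alpha_coef_gt0 j : 0 < alpha_coef R a j.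
Proof.
have := top_freq_gt0 R la_ge0 (rev_ord j).
by rewrite top_freq_alpha rev_ordK pmulr_rgt0 // ltr0n.
Qed.

Lemma alpha_coef_inj : injective (alpha_coef R a).
Proof.
move=> i j e; apply: rev_ord_inj; apply: (@top_freq_inj R _ _ la_dec).
by rewrite !top_freq_alpha !rev_ordK e.
Qed.

(** Passing from [top_freq] to [alpha_coef] takes out n^(2n-1): one n from the simple factor and n^2
    from each of the n - 1 differences of squares. *)
Lemma trace_plane_rot theta :
  (sin (theta / 2) ^+ n'.*2.+1)%:C * \tr (rho (plane_rot n.*2.+1 0 1 theta)) =
  ((n'.*2.+1)`!%:R / (2 * n%:R) ^+ n'.*2.+1 * d%:R *
   \sum_j sin (n%:R * theta * alpha_coef R a j) / (alpha_coef R a j *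
      \prod_(k | k != j) (alpha_coef R a k ^+ 2 - alpha_coef R a j ^+ 2)))%:C.
Proof.
have [hrep hirr hw] := hrho.
have [P Pu [mu hmu]] := weight_basis hrep.
have [X hX] := infinitesimal_rotations_exist hrep.
have [c hc] := casimir_scalar hrep hX hirr.
have -> : plane_rot n.*2.+1 0 1 theta = torus (coord_fun ord0 theta).
  by rewrite torus_coord pl0E pl1E.
rewrite (mxtrace_torus Pu hmu) (chr_first_coord hrep Pu hmu hX hc hw la_ge0 la_dec theta).
congr (_%:C); rewrite exprMn.
suff -> : \sum_k sin (top_freq R la k * theta) / (top_freq R la k *
     \prod_(l | l != k) (top_freq R la l ^+ 2 - top_freq R la k ^+ 2)) =
   (n%:R ^+ n'.*2.+1)^-1 * \sum_j sin (n%:R * theta * alpha_coef R a j) / (alpha_coef R a j *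
      \prod_(k | k != j) (alpha_coef R a k ^+ 2 - alpha_coef R a j ^+ 2)).
  by rewrite invfM [in LHS]mulrA; congr (_ * _); ring.
rewrite [in RHS](reindex_inj rev_ord_inj) mulr_sumr; apply: eq_bigr => k _.
rewrite top_freq_alpha [X in sin X](_ : _ = n%:R * theta * alpha_coef R a (rev_ord k)); last by ring.
have -> : \prod_(l | l != k) (top_freq R la l ^+ 2 - (n%:R * alpha_coef R a (rev_ord k)) ^+ 2) =
   n%:R ^+ n'.*2 * \prod_(l | l != rev_ord k) (alpha_coef R a l ^+ 2 - alpha_coef R a (rev_ord k) ^+ 2).
  rewrite [in RHS](reindex_inj rev_ord_inj) /=.
  rewrite [X in _ = _ * X](eq_bigl (fun l => l != k)); last by move=> l; rewrite (inj_eq rev_ord_inj).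
  rewrite -mul2n exprM (_ : n%:R ^+ 2 ^+ n' = \prod_(l : 'I_n | l != k) n%:R ^+ 2); last first.
    by rewrite prodr_const cardC1 card_ord.
  by rewrite -big_split /=; apply: eq_bigr => l _; rewrite top_freq_alpha !exprMn mulrBr.
by rewrite (exprS _ n'.*2) cancel_scale.
Qed.

End CharacterRatio.

Lemma ratio_of_trace (R : realType) (t : R[i]) (M s N S : R) (m d : nat) :
  s != 0 -> N != 0 -> d%:R != 0 :> R ->
  (s ^+ m)%:C * t = (M / (2 * N) ^+ m * d%:R * S)%:C ->
  t / d%:R = (M / (2 * N * s) ^+ m)%:C * S%:C.
Proof.
move=> s0 N0 d0 T; have q0 : s ^+ m != 0 by rewrite expf_neq0.
have r0 : (2 * N) ^+ m != 0 by rewrite expf_neq0 // mulf_neq0 ?pnatr_eq0.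
have q0' : (s ^+ m)%:C != 0 :> R[i] by rewrite fmorph_eq0.
rewrite (exprMn m (2 * N) s); apply: (mulfI q0'); rewrite mulrA T.
move: (s ^+ m) q0 ((2 * N) ^+ m) r0 {q0' T} => q q0 r r0.
rewrite -(rmorph_nat (real_complex R) d) -fmorphV -!rmorphM; congr (_%:C).
by field; rewrite q0 r0 d0.
Qed.

Theorem lemma2p1 (R : realType) (n : nat) (hn : (1 <= n)%N)
    (theta : R) (htheta0 : 0 < theta) (hthetapi : theta <= pi)
    (a : 'I_n -> nat) (ha : forall i j : 'I_n, (i <= j)%N -> (a i <= a j)%N)
    (d : nat) (rho : 'M[R]_(n.*2.+1) -> 'M[R[i]]_d)
    (hrho : SO_irrep_indexed_by a rho)
    (alpha : R) (halpha : 0 < alpha) :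
  let f := fun z : R[i] =>
    cexp ((n%:R * theta)%:C * z) /
      \prod_(j < n) ((alpha_coef R a j)%:C ^+ 2 + z ^+ 2) in
  vline_integrable alpha f /\
  character_ratio rho theta =
    ((n.*2.-1)`!%:R / (n.*2%:R * sin (theta / 2)) ^+ n.*2.-1)%:C *
    ((2 * pi%:C * 'i%C)^-1 * vline_integral alpha f).
Proof.
case: n hn a ha rho hrho => [//|n'] hn a ha rho hrho f.
have x0 : 0 < n'.+1%:R * theta by rewrite mulr_gt0 // ltr0n.
have [hi he] := vline_integral_prod halpha x0 hn (alpha_coef_gt0 R a) (alpha_coef_inj (R := R) ha).
split; first exact: hi.
rewrite he {he hi}; have T := trace_plane_rot ha hrho theta.
(* Since theta <= pi, the half angle lies in (0, pi), where the sine is positive. *)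
have s0 : sin (theta / 2) != 0.
  rewrite gt_eqF // sin_gt0_pi // divr_gt0 //= ltr_pdivrMr //.
  by rewrite (le_lt_trans hthetapi) // ltr_pMr ?pi_gt0 // ltr1n.
have N0 : n'.+1%:R != 0 :> R by rewrite pnatr_eq0.
have em : n'.+1.*2.-1 = n'.*2.+1 by [].
have e2 : n'.+1.*2%:R = 2 * n'.+1%:R :> R by rewrite -mul2n natrM.
have d0 : d%:R != 0 :> R by case: hrho => _ [dp _] _; rewrite pnatr_eq0 -lt0n.
rewrite em e2; exact: ratio_of_trace s0 N0 d0 T.
Qed.
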